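(* Let $p=2$ or $3$, let $\widehat u$ be the solution of the approximate problem with load $\widehat W$, and let $(U_h^m)_{m=0}^M\subset{\sf S}_h^p$ be the Crank-Nicolson fully-discrete approximations of $\widehat u$, given by $U_h^0:=0$ and, for $m=1,\dots,M$, $$(U_h^m-U_h^{m-1},\chi)_{L^2(D)}+\tfrac{\Delta\tau}{2}\big(\partial_x^2(U_h^m+U_h^{m-1}),\partial_x^2\chi\big)_{L^2(D)}=\int_{\tau_{m-1}}^{\tau_m}(\widehat W(s,\cdot),\chi)_{L^2(D)}\,ds\qquad\forall\chi\in{\sf S}_h^p .$$ Then there exists a constant $C>0$, independent of ${\sf M}_\star$, $\Delta t$, $h$ and $\Delta\tau$, such that $$\max_{0\le m\le M}\Big(\mathbb E\big[\|U_h^m-\widehat u(\tau_m,\cdot)\|_{L^2(D)}^2\big]\Big)^{1/2}\le C\left(\epsilon_1^{-\frac12}h^{\frac p2-\epsilon_1}+\epsilon_2^{-\frac12}\Delta\tau^{\frac38-\epsilon_2}\right)$$ for all $\epsilon_1\in(0,\tfrac p2]$ and all $\epsilon_2\in(0,\tfrac38]$.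
   Context: $T>0$ is fixed, $D=(0,1)$, $(\Omega,\mathcal F,P)$ is a complete probability space, $\mathbb E$ is expectation, $\dot W$ is a space-time white noise on $[0,T]\times D$, and $\int\int\Phi\,dW$ denotes the Wiener integral of a deterministic $\Phi\in L^2((0,T)\times D)$. For $k\in\mathbb N=\{1,2,\dots\}$: $\lambda_k:=k\pi$, $\varepsilon_k(z):=\sqrt2\sin(\lambda_k z)$, $G(t;x,y):=\sum_{k=1}^\infty e^{-\lambda_k^4t}\varepsilon_k(x)\varepsilon_k(y)$. Approximate problem: let ${\sf M}_\star,{\sf N}_\star\in\mathbb N$, $\Delta t:=T/{\sf N}_\star$, $t_n:=n\Delta t$, $T_n:=(t_{n-1},t_n)$, ${\sf R}_i^n:=\int_{T_n}\int_D\varepsilon_i(x)\,dW(t,x)$ (independent $N(0,\Delta t)$ random variables), and $\widehat W(t,x):=\tfrac1{\Delta t}\sum_{i=1}^{{\sf M}_\star}{\sf R}_i^n\varepsilon_i(x)$ for $t\in T_n$, $x\in D$, $n=1,\dots,{\sf N}_\star$. $\widehat u$ solves $\widehat u_t+\widehat u_{xxxx}=\widehat W$ in $(0,T]\times D$, $\widehat u=\widehat u_{xx}=0$ on $\partial D$, $\widehat u(0,\cdot)=0$; equivalently $\widehat u(t,x)=\int_0^t\int_DG(t-s;x,y)\widehat W(s,y)\,dy\,ds$. Time grid: $M\in\mathbb N$, $\Delta\tau:=T/M$, $\tau_m:=m\Delta\tau$ (unrelated to the grid $t_n$). Finite elements: ${\sf S}_h^p\subset H^2(D)\cap H_0^1(D)$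 is a finite element space of functions that are piecewise polynomials of degree at most $p$ over a partition of $D$ into intervals of maximum length $h$, with the standard approximation property: there is a constant $C_{{\sf FM},p}>0$ (independent of $h$) such that $\inf_{\chi\in{\sf S}_h^p}\|v-\chi\|_{H^2(D)}\le C_{{\sf FM},p}\,h^{\ell-2}\|v\|_{H^\ell(D)}$ for all $v\in H^\ell(D)\cap H_0^1(D)$, $\ell=3,\dots,p+1$. *)

(* Defs.v *)
From HB Require Import structures.
From mathcomp Require Export all_boot all_order all_algebra.
From mathcomp Require Export all_classical all_reals all_analysis.

Set Implicit Arguments.
Unset Strict Implicit.
Unset Printing Implicit Defensive.

Import Order.TTheory GRing.Theory Num.Theory.
Import numFieldNormedType.Exports.

Local Open Scope classical_set_scope.
Local Open Scope ring_scope.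

Section L2.
Context d (X : measurableType d) (R : realType) (mu : {measure set X -> \bar R}).

Definition L2 (A : set X) (f : X -> R) : Prop :=
  measurable_fun A f /\ mu.-integrable A (fun x => (f x ^+ 2)%:E).

End L2.

Section Sobolev.
Context {R : realType}.
Implicit Types (v w f g : R -> R) (S : set (R -> R)).

Local Notation leb := (@lebesgue_measure R).

Definition D : set R := `]0, 1[.

Definition L2D v : Prop := L2 leb D v.

Definition inner f g : R := \int[leb]_(x in D) (f x * g x).

Definition C1c_D (phi : R -> R) : Prop :=
  [/\ forall x, derivable phi x 1,
      continuous (derive1 phi)
    & exists a b, [/\ 0 < a, b < 1 & forall x, x \notin `[a, b] -> phi x = 0]].

Definition is_weak_derivative v w : Prop :=
  forall phi, C1c_D phi -> inner v (derive1 phi) = - inner w phi.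

(* H^l(D) with generalized derivatives, defined by recursion on l; testing
   against C^1 functions with compact support is enough for first-order
   derivatives *)
Fixpoint Sobolev (l : nat) v : Prop :=
  if l is l'.+1 then
    L2D v /\ exists w, is_weak_derivative v w /\ Sobolev l' w
  else L2D v.

(* The square integrable weak derivative of v: unique up to a null set of D
   when it exists; the null function otherwise. *)
Definition weakD v : R -> R :=
  xget (cst 0) [set w | L2D w /\ is_weak_derivative v w].

Definition Sobolev_norm (l : nat) v : R :=
  Num.sqrt (\sum_(j < l.+1) inner (iter j weakD v) (iter j weakD v)).

(* Elements of H^1(D) whose trace, i.e. the boundary value of the continuous
   representative, vanishes at both end points of D. *)
Definition Sobolev10 v : Prop :=
  Sobolev 1 v /\
  exists g, [/\ {within `[0, 1], continuous g},
                {ae leb, forall x, D x -> v x = g x}, g 0 = 0 & g 1 = 0].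

(* h is the length of the longest interval of the partition *)
Definition piecewise_poly_space (p : nat) (h : R) S : Prop :=
  exists (J : nat) (x : nat -> R),
    [/\ x 0%N = 0, x J = 1, forall j, (j < J)%N -> x j < x j.+1,
        h = \big[Num.max/0]_(j < J) (x j.+1 - x j)
      & forall chi, S chi -> forall j, (j < J)%N ->
          exists2 q : {poly R}, (size q <= p.+1)%N &
            forall y, y \in `[x j, x j.+1] -> chi y = q.[y]].

Definition fe_space (p : nat) (h : R) S : Prop :=
  [/\ S (cst 0),
      forall (a : R) f g, S f -> S g -> S (fun x => a * f x + g x),
      forall chi, S chi -> Sobolev 2 chi /\ Sobolev10 chi
    & piecewise_poly_space p h S].

Definition approximation_property (p : nat) (CFM h : R) S : Prop :=
  forall l : nat, (3 <= l <= p.+1)%N ->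
  forall v, Sobolev l v -> Sobolev10 v ->
    inf [set Sobolev_norm 2 (fun x => v x - chi x) | chi in S]
      <= CFM * h ^+ (l - 2) * Sobolev_norm l v.

End Sobolev.

Section Noise.
Context d {Omega : measurableType d} {R : realType} (P : probability Omega R).

Local Notation leb := (@lebesgue_measure R).
Local Notation leb2 := (leb \x leb)%E.

(* normal_prob 0 0 is not the Dirac mass at 0, hence the case distinction *)
Definition centered_gaussian (X : {RV P >-> R}) (v : R) : Prop :=
  if v == 0 then {ae P, forall w, X w = 0}
  else forall A : set R, measurable A ->
         distribution P X A = normal_prob 0 (Num.sqrt v) A.

Definition QT (T : R) : set (R * R) := `]0, T[ `*` D.

(* Space-time white noise on [0,T] x D, given through its Wiener integral
   W Phi = \int\int Phi dW: an almost surely linear map on L^2((0,T) x D) with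
   W Phi ~ N(0, |Phi|^2). By linearity this family is jointly Gaussian, with
   the L^2 scalar product as covariance. *)
Definition white_noise (T : R) (W : (R * R -> R) -> {RV P >-> R}) : Prop :=
  (forall Phi, L2 leb2 (QT T) Phi ->
     centered_gaussian (W Phi) (\int[leb2]_(z in QT T) (Phi z ^+ 2))) /\
  (forall (a : R) Phi Psi, L2 leb2 (QT T) Phi -> L2 leb2 (QT T) Psi ->
     {ae P, forall w, W (fun z => a * Phi z + Psi z) w = a * W Phi w + W Psi w}).

Definition lambda (k : nat) : R := k%:R * pi.

Definition eps (k : nat) (z : R) : R := Num.sqrt 2 * sin (lambda k * z).

Definition Green (t x y : R) : R :=
  limn (fun n => \sum_(1 <= k < n) expR (- lambda k ^+ 4 * t) * eps k x * eps k y).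

Section Approximate.
Variables (T : R) (W : (R * R -> R) -> {RV P >-> R}) (Ms Ns : nat).

Definition Dt : R := T / Ns%:R.
Definition tgrid (n : nat) : R := n%:R * Dt.
Definition Tint (n : nat) : set R := `]tgrid n.-1, tgrid n[.

Definition Rin (n i : nat) : Omega -> R :=
  W (fun z => \1_(Tint n `*` D) z * eps i z.2).

(* at the grid points, where the load is not specified, its value is 0 *)
Definition What (w : Omega) (t x : R) : R :=
  \sum_(1 <= n < Ns.+1)
    \1_(Tint n) t * (Dt^-1 * \sum_(1 <= i < Ms.+1) Rin n i w * eps i x).

Definition uhat (w : Omega) (t x : R) : R :=
  \int[leb]_(s in `[0, t]) \int[leb]_(y in D) (Green (t - s) x y * What w s y).

Definition CN_approximation (M : nat) (S : set (R -> R))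
    (U : nat -> Omega -> R -> R) : Prop :=
  let Dtau : R := T / M%:R in
  let tau (m : nat) : R := m%:R * Dtau in
  [/\ forall m w, (m <= M)%N -> S (U m w),
      forall w, U 0%N w = cst 0
    & forall m w, (1 <= m <= M)%N -> forall chi, S chi ->
        inner (fun x => U m w x - U m.-1 w x) chi
        + Dtau / 2 * inner (weakD (weakD (fun x => U m w x + U m.-1 w x)))
                           (weakD (weakD chi))
        = \int[leb]_(s in `[tau m.-1, tau m]) inner (What w s) chi].

End Approximate.

(* E[ |Z|_{L^2(D)}^2 ], in the extended reals *)
Definition mean_square_L2 (Z : Omega -> R -> R) : \bar R :=
  (\int[P]_w \int[leb]_(x in D) (Z w x ^+ 2)%:E)%E.

End Noise.

(* Main.v *)
(** Every quantity is linear in the noise, so the error at time [tau_m] is a sum, over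
    the cells [T_n] and the modes [i], of the Gaussian coefficient [R_i^n] times a
    deterministic function of [x]: the average over [T_n] of the difference of the
    discrete and the exact propagator applied to [eps_i].  The isometry of the noise in
    [(n, i)] and Jensen's inequality on each [T_n] bound the mean square error by a
    constant times the sum over [i] of the square of this difference integrated over
    [(0, tau_m) x D].

    With [L = lambda_i ^ 4], compare both propagators with [kappa_n eps_i], where
    [kappa_n] is the Crank-Nicolson solution of the scalar equation [y' = - L y].  The
    time error [kappa - exp] contributes at most [min (1/L, Dtau^2 L / 2)].  The space
    error contributes at most a constant times
    [min (h ^ (4 (p-1)) lambda_i ^ (2 (p-1)), 1/L)]: the discrete solution is minus the
    increment (over [Dtau]) of the homogeneous scheme started at the Galerkin projection
    of [eps_i / L], increments are controlled by energy estimates, and an Aubin-Nitsche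
    duality argument bounds the Galerkin error in [L^2].  Summing over [i] yields
    [Dtau ^ (3/4)] and [h ^ p]; since [h <= 1] and [Dtau <= T], this is better than the
    rates with [e1] and [e2]. *)
From HB Require Import structures.
Require Import Defs.
From mathcomp Require Import all_boot all_order all_algebra.
From mathcomp Require Import all_classical all_reals all_analysis.
From mathcomp Require Import measurable_realfun.
From mathcomp Require Import ring lra.
Set Implicit Arguments.
Unset Strict Implicit.
Unset Printing Implicit Defensive.
Import Order.TTheory GRing.Theory Num.Theory.
Import numFieldNormedType.Exports.
Local Open Scope classical_set_scope.
Local Open Scope ring_scope.

(** * Semi-definite forms and the Crank-Nicolson scheme *)

(** Both exponents come from the crossover of the two bounds inside each minimum. In time, both
    bounds have size about [Dtau] near [lambda_i = Dtau^(-1/4)]; about [Dtau^(-1/4)] modes of that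
    size and a convergent tail give [Dtau^(3/4)]. In space the crossover is at
    [lambda_i = h^(-p/3)], with value [h^(4p/3)], hence [h^p]; the identity [(p/3)(2p+2) = 4(p-1)]
    behind it holds exactly for [p = 2] and [p = 3]. Starting the homogeneous scheme at a projection
    of [eps_i / L] instead of [eps_i] brings the gain [1/L]. The projection must be the Galerkin
    one, because then the increment reproduces the load [(eps_i, chi)] of the first step exactly.
    The obstacle is that elements are plain maps [R -> R] and weak derivatives are chosen ones, so
    identities hold only almost everywhere. Solvability is therefore derived in finite dimension
    modulo null vectors. Boundary terms are controlled by the quantitative condition
    [|f x| <= K x (1 - x)], and best approximations are replaced by approximations up to an
    arbitrary slack, since the infimum may not be attained. *)

(* Functions are not identified modulo null sets, so that the L^2 and energy forms are
   only semi-definite. *)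
Section PsdForm.
Context {R : realFieldType} {V : lmodType R}.
Implicit Types (f g h u : V) (b q : V -> V -> R).

Record psd_form b : Prop := PsdForm {
  form_linear : forall c f g h, b (c *: f + g) h = c * b f h + b g h;
  form_sym : forall f g, b f g = b g f;
  form_ge0 : forall f, 0 <= b f f }.

Section Theory.
Variables (b : V -> V -> R) (hb : psd_form b).

Lemma formDl f g h : b (f + g) h = b f h + b g h.
Proof. by rewrite -[f]scale1r (form_linear hb) mul1r scale1r. Qed.

Lemma form0l h : b 0 h = 0.
Proof. by apply: (@addrI _ (b 0 h)); rewrite -formDl !addr0. Qed.

Lemma formZl c f h : b (c *: f) h = c * b f h.
Proof. by rewrite -[c *: f]addr0 (form_linear hb) form0l addr0. Qed.

Lemma formNl f h : b (- f) h = - b f h.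
Proof. by rewrite -scaleN1r formZl mulN1r. Qed.

Lemma formBl f g h : b (f - g) h = b f h - b g h.
Proof. by rewrite formDl formNl. Qed.

Lemma form_suml I (s : seq I) (P : pred I) (F : I -> V) h :
  b (\sum_(i <- s | P i) F i) h = \sum_(i <- s | P i) b (F i) h.
Proof. by apply: (big_morph (b^~ h)) => [x y|]; rewrite ?formDl ?form0l. Qed.

Lemma formDr f g h : b h (f + g) = b h f + b h g.
Proof. by rewrite !(form_sym hb h) formDl. Qed.

Lemma form0r h : b h 0 = 0.
Proof. by rewrite form_sym// form0l. Qed.

Lemma formZr c f h : b h (c *: f) = c * b h f.
Proof. by rewrite !(form_sym hb h) formZl. Qed.

Lemma formNr f h : b h (- f) = - b h f.
Proof. by rewrite !(form_sym hb h) formNl. Qed.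

Lemma formBr f g h : b h (f - g) = b h f - b h g.
Proof. by rewrite !(form_sym hb h) formBl. Qed.

Definition formE := (formDl, formDr, formNl, formNr, formZl, formZr,
  form0l, form0r).

Lemma form_CS f g : b f g ^+ 2 <= b f f * b g g.
Proof.
have bg0 := form_ge0 hb g.
have [bg|bgN0] := eqVneq (b g g) 0.
  suff -> : b f g = 0 by rewrite expr0n/= bg mulr0.
  apply/eqP/negPn/negP => bfg0.
  (* Since [b g g = 0], the form is affine in [t] along [f + t *: g]; this choice makes its value
     [-1]. *)
  pose t := - (b f f + 1) / (2 * b f g).
  have := form_ge0 hb (f + t *: g); rewrite !formE (form_sym hb g f) bg.
  have tb : t * b f g = - (b f f + 1) / 2 by rewrite /t; field.
  lra.
have bgp : 0 < b g g by rewrite lt_def bgN0.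
have := form_ge0 hb (f - (b f g / b g g) *: g).
rewrite !formE (form_sym hb g f) => H.
rewrite -subr_ge0.
have -> : b f f * b g g - b f g ^+ 2 = b g g *
  (b f f - b f g / b g g * b f g - (b f g / b g g * (b f g - b f g / b g g * b g g))).
  by field.
apply: mulr_ge0 => //; apply: le_trans H _; lra.
Qed.

Lemma form_null f g : b f f = 0 -> b f g = 0.
Proof.
move=> bf; apply/eqP; rewrite -sqrf_eq0 eq_le sqr_ge0 andbT.
by rewrite (le_trans (form_CS _ _))// bf mul0r.
Qed.

Lemma form_parallelogram f g : b (f - g) (f - g) <= 2 * (b f f + b g g).
Proof.
have := form_ge0 hb (f + g); rewrite !formE (form_sym hb g f); lra.
Qed.

End Theory.

Lemma psd_form_comb b q c : 0 <= c -> psd_form b -> psd_form q ->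
  psd_form (fun f g => b f g + c * q f g).
Proof.
move=> c0 hb hq; split => [k f g h|f g|f].
- by rewrite !formE//; ring.
- by rewrite (form_sym hb) (form_sym hq).
- by apply: addr_ge0; [exact: (form_ge0 hb)|apply: mulr_ge0 => //; exact: (form_ge0 hq)].
Qed.

Definition subspace (S : set V) :=
  S 0 /\ forall c f g, S f -> S g -> S (c *: f + g).

Section Subspace.
Variables (S : set V) (hS : subspace S).

Lemma subspaceZ c f : S f -> S (c *: f).
Proof. by move=> Sf; rewrite -[c *: f]addr0; apply: (hS.2) => //; apply: hS.1. Qed.

Lemma subspaceD f g : S f -> S g -> S (f + g).
Proof. by move=> Sf Sg; rewrite -[f]scale1r; apply: (hS.2). Qed.

Lemma subspaceB f g : S f -> S g -> S (f - g).
Proof. by move=> Sf Sg; apply: subspaceD => //; rewrite -scaleN1r; apply: subspaceZ. Qed.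

Lemma subspace_sum I (s : seq I) (P : pred I) (F : I -> V) :
  (forall i, S (F i)) -> S (\sum_(i <- s | P i) F i).
Proof. by move=> SF; apply: big_ind => //; [exact: hS.1|exact: subspaceD]. Qed.

End Subspace.

(* Finite dimension, up to the kernel of [q]: any [N.+1] elements are linearly
   dependent modulo that kernel. *)
Definition dim_le q (N : nat) (S : set V) :=
  forall f : 'I_N.+1 -> V, (forall k, S (f k)) ->
    exists c : 'I_N.+1 -> R, (exists k, c k != 0) /\
      q (\sum_k c k *: f k) (\sum_k c k *: f k) = 0.

(** Induction on the dimension bound: split off one [g] with [q g g != 0] and represent [l] on its
    orthogonal complement, where the bound drops by one. Compatibility of [l] with null vectors
    takes the place of definiteness of [q]. *)
Lemma riesz q (hq : psd_form q) N S (l : V -> R) :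
  subspace S -> dim_le q N S ->
  (forall c f g, S f -> S g -> l (c *: f + g) = c * l f + l g) ->
  (forall f, S f -> q f f = 0 -> l f = 0) ->
  exists2 u, S u & forall f, S f -> q u f = l f.
Proof.
elim: N S => [|N IH] S hS dS ll l0.
  exists 0; first exact: hS.1.
  move=> f Sf; rewrite formE//; apply/esym/l0 => //.
  have [c [[k ck]]] := dS (fun=> f) (fun=> Sf).
  rewrite !big_ord_recl !big_ord0 !addr0 !formE// (ord1 k) in ck *.
  by move=> /eqP; rewrite !mulf_eq0 (negbTE ck)/= => /eqP.
have [[g [Sg gN0]]|nog] := pselect (exists g, S g /\ q g g != 0); last first.
  exists 0; first exact: hS.1.
  move=> f Sf; rewrite formE//; apply/esym/l0 => //.
  by apply/eqP/negPn/negP => qf; apply: nog; exists f.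
pose S' := [set f | S f /\ q f g = 0].
have hS' : subspace S'.
  split; first by split; [exact: hS.1|rewrite formE].
  by move=> c f h [Sf fg] [Sh hg]; split; [exact: hS.2|rewrite !formE// fg hg; ring].
have [u [Su ug] uP] : exists2 u, S' u & forall f, S' f -> q u f = l f.
  apply: IH => // [|c f h [Sf _] [Sh _]|f [Sf _]]; [|exact: ll|exact: l0].
  (* With [g] put in front of the family, orthogonality forces its coefficient to vanish, so the
     dependence relation only involves [f]. *)
  move=> f Sf; pose f' (k : 'I_N.+2) := if unlift ord0 k is Some j then f j else g.
  have Sf' k : S (f' k) by rewrite /f'; case: unliftP => [j _|_]; [exact: (Sf j).1|].
  have [c [[k ck] cf]] := dS f' Sf'.
  move: cf; rewrite (big_ord_recl N.+1) /f' unlift_none.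
  under eq_bigr do rewrite liftK.
  set s := \sum_(i < N.+1) _ => cf.
  have sg : q s g = 0.
    rewrite /s form_suml// big1// => i _.
    by rewrite !formE// (Sf i).2 mulr0.
  have c0 : c ord0 = 0.
    have := form_null hq g cf; rewrite !formE// sg addr0 => /eqP.
    by rewrite mulf_eq0 (negbTE gN0) orbF => /eqP.
  exists (fun i => c (lift ord0 i)); split; last first.
    by move: cf; rewrite c0 scale0r add0r.
  by move: ck; case: (unliftP ord0 k) => [j ->|->] ck; [exists j|rewrite c0 eqxx in ck].
exists (u + (l g / q g g) *: g).
  by apply: (subspaceD hS) => //; apply: (subspaceZ hS).
move=> f Sf.
have Sf' : S' (- (q f g / q g g) *: g + f).
  by split; [exact: hS.2|rewrite !formE//; field].
have := uP _ Sf'; rewrite ll// !formE// ug (form_sym hq g f) => H.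
transitivity (l f); last by [].
have -> : l f = - (- (q f g / q g g) * l g) + (- (q f g / q g g) * l g + l f) by ring.
by rewrite -H; field.
Qed.

End PsdForm.

(** * The abstract Crank-Nicolson scheme, its impulse responses and the duality argument *)

Section CrankNicolson.
Context {R : realFieldType} {V : lmodType R}.
Variables (a b : V -> V -> R) (ha : psd_form a) (hb : psd_form b).
Variables (S : set V) (hS : subspace S) (k : R) (k_gt0 : 0 < k).

Local Ltac atoms := repeat match goal with
  | |- context [a ?x ?y] => let t := fresh "t" in set t := (a x y) in *; clearbody t
  | |- context [b ?x ?y] => let t := fresh "t" in set t := (b x y) in *; clearbody t
  | H : context [a ?x ?y] |- _ => let t := fresh "t" in set t := (a x y) in *; clearbody t
  | H : context [b ?x ?y] |- _ => let t := fresh "t" in set t := (b x y) in *; clearbody t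
  end.
Local Ltac flra := generalize k_gt0; intros; atoms; lra.

(** Residual of one step of length [k] from [x] to [y], tested with [f]; [b] stands for the [L^2]
    product and [a] for the energy form. *)
Definition cn_step (x y f : V) := b (y - x) f + k / 2 * a (y + x) f.

Lemma cn_step_linear x y x' y' c f :
  cn_step (c *: x + x') (c *: y + y') f = c * cn_step x y f + cn_step x' y' f.
Proof. by rewrite /cn_step !(formE ha, formE hb); field. Qed.

Lemma cn_step0 f : cn_step 0 0 f = 0.
Proof. by rewrite /cn_step subr0 addr0 !(formE ha, formE hb); field. Qed.

Lemma cn_step_sum I (s : seq I) (x y : I -> V) f :
  cn_step (\sum_(i <- s) x i) (\sum_(i <- s) y i) f = \sum_(i <- s) cn_step (x i) (y i) f.
Proof.
elim: s => [|i s IH]; first by rewrite !big_nil cn_step0.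
rewrite !big_cons -[x i]scale1r -[y i]scale1r cn_step_linear mul1r !scale1r.
by rewrite IH.
Qed.

(** The test function [y + x] turns the [b]-term into [b y y - b x x], while the [a]-term is
    nonnegative. *)
Lemma cn_step_stable x y : cn_step x y (y + x) = 0 -> b y y <= b x x.
Proof.
have /(mulr_ge0 (ltW k_gt0)) := form_ge0 ha (y + x); rewrite /cn_step.
rewrite (formBl hb) !(formDr hb) (form_sym hb x y); flra.
Qed.

(* Testing with the increment gives control of the increments themselves. *)
Lemma cn_increments (th : nat -> V) (d : nat -> R) (q : V) :
  (forall n, S (th n)) ->
  (forall n f, S f -> cn_step (th n) (th n.+1) f = d n * b q f) ->
  forall m, \sum_(n < m) b (th n.+1 - th n) (th n.+1 - th n)
    <= k * a (th 0%N) (th 0%N) + (\sum_(n < m) d n ^+ 2) * b q q.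
Proof.
move=> Sth eqth m.
have stp n : b (th n.+1 - th n) (th n.+1 - th n)
    <= d n ^+ 2 * b q q + k * (a (th n) (th n) - a (th n.+1) (th n.+1)).
  have := eqth n _ (subspaceB hS (Sth n.+1) (Sth n)).
  (* Young's inequality: the load tested with the increment is at most half of [d n ^+ 2 * b q q]
     plus half of the squared increment, which is absorbed on the left. *)
  have := form_ge0 hb (d n *: q - (th n.+1 - th n)); rewrite /cn_step.
  have -> : a (th n.+1 + th n) (th n.+1 - th n) = a (th n.+1) (th n.+1) - a (th n) (th n).
    by rewrite (formDl ha) !(formBr ha) (form_sym ha (th n.+1) (th n)); ring.
  move: (th n.+1 - th n) => D.
  rewrite !(formE hb) (form_sym hb D q) expr2.
  flra.
suff : \sum_(n < m) b (th n.+1 - th n) (th n.+1 - th n)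
    <= k * (a (th 0%N) (th 0%N) - a (th m) (th m)) + (\sum_(n < m) d n ^+ 2) * b q q.
  by have /(mulr_ge0 (ltW k_gt0)) := form_ge0 ha (th m); flra.
elim: m => [|m IH]; first by rewrite !big_ord0; flra.
by rewrite !big_ord_recr/=; have := stp m; flra.
Qed.

Section Existence.
Variable N : nat.
Hypothesis dimS : forall f : 'I_N.+1 -> V, (forall i, S (f i)) ->
  exists c : 'I_N.+1 -> R, (exists i, c i != 0) /\
    let z := \sum_i c i *: f i in a z z = 0 /\ b z z = 0.

Lemma galerkin_exists v : exists2 G, S G & forall f, S f -> a G f = a v f.
Proof.
apply: (riesz ha (N := N)) => // [f Sf|c f g _ _|f _ af].
- by have [c [nz [/= az bz]]] := dimS Sf; exists c.
- by rewrite !(formE ha).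
- by rewrite (form_sym ha) (form_null ha).
Qed.

(** One step is a linear problem for the form [b + k / 2 * a], whose null vectors are null for both
    [a] and [b]. *)
Lemma cn_exists x : exists2 y, S y & forall f, S f -> cn_step x y f = 0.
Proof.
have k2_gt0 : 0 < k / 2 by rewrite divr_gt0.
have k2 := ltW k2_gt0.
have [y Sy yP] : exists2 y, S y & forall f, S f ->
    b y f + k / 2 * a y f = b x f - k / 2 * a x f.
  apply: (riesz (psd_form_comb k2 hb ha) (N := N)) => // [f Sf|c f g _ _|f _ /eqP].
  - by have [c [nz [/= az bz]]] := dimS Sf; exists c; rewrite az bz; split => //; ring.
  - by rewrite !(formE ha, formE hb); ring.
  - rewrite paddr_eq0 ?(mulr_ge0 k2) ?(form_ge0 ha) ?(form_ge0 hb)// => /andP[/eqP bf].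
    rewrite mulf_eq0 (gt_eqF k2_gt0)/=.
    move=> /eqP af; rewrite (form_sym hb) (form_sym ha) (form_null ha)// (form_null hb)//; lra.
exists y => // f Sf; rewrite /cn_step (formBl hb) (formDl ha).
by have := yP f Sf; flra.
Qed.

Section Mode.
Variables (e : V) (L : R).
Hypotheses (L_gt0 : 0 < L) (e_eigen : forall f, S f -> a e f = L * b e f).
Hypotheses (ae : a e e = L) (be : b e e = 1).

(** Amplification factor of the scheme for [y' = - L y]. The kernel defined next is the state after
    [n.+1] steps from rest under a unit load in the first step, whence the exponent [n]. *)
Definition cn_ratio := (1 - k * L / 2) / (1 + k * L / 2).
Definition cn_kernel n := cn_ratio ^+ n / (1 + k * L / 2).

Let r := cn_ratio.
Let kL_gt0 : 0 < k * L. Proof. exact: mulr_gt0. Qed.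

Local Ltac nz := rewrite ?(gt_eqF k_gt0) ?(gt_eqF L_gt0)/= ?andbT; apply: lt0r_neq0;
  generalize kL_gt0; intros; lra.

(** Increments of the scalar homogeneous solution [r ^+ n / L]. That they equal [- k] times the
    kernel is the scalar model of the construction of [X] from [Z] below. *)
Let dz n := r ^+ n.+1 / L - r ^+ n / L.

Let dzE n : dz n = - k * cn_kernel n.
Proof.
rewrite /dz /cn_kernel exprS -/r.
have -> : r = 1 - k * L / (1 + k * L / 2) by rewrite /r /cn_ratio; field; nz.
by field; nz.
Qed.

(** The sum telescopes: [1 - r^2 = 2 k L / (1 + k L / 2)^2], so the [n]-th term is
    [(r^(2n) - r^(2n+2)) / (2 L)]. *)
Lemma cn_kernel_sum m : k * \sum_(n < m) cn_kernel n ^+ 2 = (1 - cn_ratio ^+ (m + m)) / (2 * L).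
Proof.
elim: m => [|m IH]; first by rewrite big_ord0 addn0 expr0; ring.
rewrite big_ord_recr/= mulrDr IH addSn addnS /cn_kernel -/r.
rewrite [r ^+ (m + m).+2]exprS [r ^+ (m + m).+1]exprS exprD.
move: (r ^+ m) => p.
have -> : r = (1 - k * L / 2) / (1 + k * L / 2) by [].
by field; nz.
Qed.

Lemma cn_kernel_sum_le m : k * \sum_(n < m) cn_kernel n ^+ 2 <= (2 * L)^-1.
Proof.
rewrite cn_kernel_sum ler_pdivrMr ?mulr_gt0// mulVf ?gt_eqF ?mulr_gt0//.
by rewrite exprD -expr2 gerBl sqr_ge0.
Qed.

(* [X] is [- k^-1] times the increments of the homogeneous scheme [Z] started at the
   Galerkin approximation [L^-1 (e - q)] of [L^-1 e]. *)
Lemma cn_mode_exists : exists2 q : V, (S (e - q) /\ forall f, S f -> a q f = 0) &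
  exists X : nat -> V, [/\ forall n, S (X n),
    forall f, S f -> cn_step 0 (X 0%N) f = b e f,
    forall n f, S f -> cn_step (X n) (X n.+1) f = 0,
    forall m, k * \sum_(n < m) b (X n - cn_kernel n *: e) (X n - cn_kernel n *: e)
      <= 2 / L * b q q
  & forall m, k * \sum_(n < m) b (X n - cn_kernel n *: e) (X n - cn_kernel n *: e)
      <= 3 / L].
Proof.
have [G SG GP] := galerkin_exists e.
exists (e - G).
  by split=> [|f Sf]; [rewrite opprB addrC subrK|rewrite (formBl ha) GP// subrr].
have /choice[stp Sstp] x : exists y, S y /\ forall f, S f -> cn_step x y f = 0.
  by have [y Sy yP] := cn_exists x; exists y.
pose Z n := iter n stp (L^-1 *: G).
have SZ n : S (Z n) by case: n => [|n]; [exact: subspaceZ|exact: (Sstp _).1].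
have ZP n f : S f -> cn_step (Z n) (Z n.+1) f = 0 by exact: (Sstp (Z n)).2.
have dsum m : \sum_(n < m) dz n ^+ 2 <= k / (2 * L).
  have -> : \sum_(n < m) dz n ^+ 2 = k * (k * \sum_(n < m) cn_kernel n ^+ 2).
    by rewrite !mulr_sumr; apply: eq_bigr => n _; rewrite dzE; ring.
  by rewrite ler_pM2l// cn_kernel_sum_le.
pose q := e - G; pose X n := k^-1 *: (Z n - Z n.+1).
have kN0 : k != 0 by rewrite gt_eqF.
have XE n : X n - cn_kernel n *: e = - k^-1 *: ((Z n.+1 - Z n) - dz n *: e).
  rewrite /X [RHS]scalerBr scalerA [in RHS]scaleNr -scalerN opprB dzE.
  by congr (_ - _ *: _); field.
have bX x : b (- k^-1 *: x) (- k^-1 *: x) = (k ^+ 2)^-1 * b x x.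
  by rewrite (formZl hb) (formZr hb); field.
exists X; split => [n|f Sf|n f Sf|m|m].
- by apply: subspaceZ => //; exact: subspaceB.
(* The Galerkin start enters here: the residual for [X 0] reduces to
   [a (Z 0) f = L^-1 * a e f = b e f]. *)
- have := ZP 0%N f Sf; rewrite /X /cn_step subr0 addr0 !(formE ha, formE hb).
  set Z1 := Z 1%N; rewrite /=; rewrite GP// e_eigen// => H.
  have {}H : b Z1 f = L^-1 * b G f - k / 2 * (a Z1 f + b e f).
    have -> : b e f = L^-1 * (L * b e f) by field; rewrite gt_eqF.
    by flra.
  by rewrite H; field; rewrite kN0/= gt_eqF.
- have := ZP n f Sf; have := ZP n.+1 f Sf.
  rewrite /X /cn_step !(formE ha, formE hb) => H1 H2.
  transitivity (k^-1 * ((b (Z n.+1) f + - b (Z n) f + k / 2 * (a (Z n.+1) f + a (Z n) f)) -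
    (b (Z n.+2) f + - b (Z n.+1) f + k / 2 * (a (Z n.+2) f + a (Z n.+1) f)))).
    by field.
  by rewrite H1 H2; ring.
(* First bound: compare [Z] with the scalar solution times [G]. The difference starts at [0] and is
   driven only by the load [dz n * b q], so [cn_increments] controls it by [b q q]; the factor
   [2 / L] is [4 * (k / (2 L)) / k]. *)
- pose th n := Z n - (r ^+ n / L) *: G.
  have Sth n : S (th n) by apply: subspaceB => //; exact: subspaceZ.
  have thP n f : S f -> cn_step (th n) (th n.+1) f = dz n * b q f.
    move=> Sf; rewrite /th.
    have := ZP n f Sf; rewrite /q /cn_step !(formE ha, formE hb) GP// e_eigen//.
    have : k / 2 * (r ^+ n.+1 / L + r ^+ n / L) * L = - dz n.
      rewrite dzE /cn_kernel exprS -/r.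
      have -> : r = (1 - k * L / 2) / (1 + k * L / 2) by [].
      by field; nz.
    rewrite /dz => H1 H2.
    have H3 : k / 2 * (r ^+ n.+1 / L + r ^+ n / L) * L * b e f = - (r ^+ n.+1 / L - r ^+ n / L) * b e f.
      by rewrite H1.
    flra.
  have th0 : th 0%N = 0 by rewrite /th expr0 mul1r subrr.
  have := cn_increments Sth thP m; rewrite th0 !(formE ha) mulr0 add0r => H.
  have E n : Z n.+1 - Z n - dz n *: e = (th n.+1 - th n) - dz n *: q.
    rewrite /th /q [dz n *: (e - G)]scalerBr [dz n *: G]scalerBl.
    move: (Z n.+1) (Z n) (r ^+ n.+1 / L *: G) (r ^+ n / L *: G) (dz n *: e) => x y A B C.
    have -> : x - A - (y - B) = x - y - (A - B).
      by rewrite !opprB [LHS]addrACA [RHS]addrACA [- A - y]addrC.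
    by move: (A - B) => E; rewrite opprB addrA subrK.
  have -> : k * \sum_(n < m) b (X n - cn_kernel n *: e) (X n - cn_kernel n *: e) =
     k^-1 * \sum_(n < m) b ((th n.+1 - th n) - dz n *: q) ((th n.+1 - th n) - dz n *: q).
    rewrite !mulr_sumr; apply: eq_bigr => n _.
    by rewrite XE bX// E; field.
  have H2 : \sum_(n < m) b ((th n.+1 - th n) - dz n *: q) ((th n.+1 - th n) - dz n *: q)
     <= 4 * (\sum_(n < m) dz n ^+ 2) * b q q.
    apply: (@le_trans _ _ (\sum_(n < m) (2 * (b (th n.+1 - th n) (th n.+1 - th n) + dz n ^+ 2 * b q q)))).
      apply: ler_sum => n _; apply: (le_trans (form_parallelogram hb _ _)).
      by rewrite (formZl hb (dz n)) (formZr hb (dz n)) mulrA -expr2.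
    by rewrite -mulr_sumr big_split/= -mulr_suml; flra.
  apply: (@le_trans _ _ (k^-1 * (4 * (k / (2 * L)) * b q q))).
    rewrite ler_pM2l ?invr_gt0//; apply: (le_trans H2).
    by rewrite ler_wpM2r ?(form_ge0 hb)// ler_wpM2l.
  by rewrite le_eqVlt; apply/orP; left; apply/eqP; field; rewrite kN0/= gt_eqF.
(* Second bound, without any approximation property: the Galerkin projection does not increase the
   energy, so the start has energy at most [L^-2 * L]. The factor [3] is [2 * (1 + 1/2)], from the
   increments of [Z] and of the scalar solution. *)
- have ZP0 n f : S f -> cn_step (Z n) (Z n.+1) f = 0 * b 0 f.
    by move=> Sf; rewrite ZP// mul0r.
  have := cn_increments SZ ZP0 m.
  rewrite [X in _ + X](_ : _ = 0) ?addr0; last by rewrite (form0l hb) mulr0.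
  rewrite [a (Z 0%N) _](_ : _ = L^-1 / L * a G G); last first.
    by rewrite /Z/= (formZl ha) (formZr ha) mulrA.
  have aGe : a G e = a G G by rewrite (form_sym ha) -GP.
  have : a G G <= L.
    have := form_ge0 ha (e - G); rewrite !(formE ha) (form_sym ha e G) aGe ae; flra.
  move=> aG H.
  have {}H : \sum_(n < m) b (Z n.+1 - Z n) (Z n.+1 - Z n) <= k / L.
    apply: (le_trans H); rewrite ler_pM2l//.
    rewrite -(ler_pM2l (mulr_gt0 L_gt0 L_gt0)).
    have -> : L * L * (L^-1 / L * a G G) = a G G by field; rewrite gt_eqF.
    by have -> : L * L / L = L by field; rewrite gt_eqF.
  have -> : k * \sum_(n < m) b (X n - cn_kernel n *: e) (X n - cn_kernel n *: e) =
     k^-1 * \sum_(n < m) b ((Z n.+1 - Z n) - dz n *: e) ((Z n.+1 - Z n) - dz n *: e).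
    rewrite !mulr_sumr; apply: eq_bigr => n _.
    by rewrite XE bX//; field.
  have H2 : \sum_(n < m) b ((Z n.+1 - Z n) - dz n *: e) ((Z n.+1 - Z n) - dz n *: e)
     <= 2 * (k / L + k / (2 * L)).
    apply: (@le_trans _ _ (\sum_(n < m) (2 * (b (Z n.+1 - Z n) (Z n.+1 - Z n) + dz n ^+ 2)))).
      apply: ler_sum => n _; apply: (le_trans (form_parallelogram hb _ _)).
      by rewrite (formZl hb (dz n)) (formZr hb (dz n)) be mulr1 -expr2.
    rewrite -mulr_sumr big_split/= ler_pM2l//.
    by apply: lerD => //; exact: dsum.
  apply: (@le_trans _ _ (k^-1 * (2 * (k / L + k / (2 * L))))).
    by rewrite ler_pM2l ?invr_gt0.
  by rewrite le_eqVlt; apply/orP; left; apply/eqP; field; rewrite kN0/= gt_eqF.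
Qed.

End Mode.
End Existence.

(** Superposition of impulse responses: at time [m] the load of step [j] has acted for [m - j]
    steps, which is index [m - j.+1] of [X]. The difference from [U] solves the homogeneous scheme,
    so stability keeps its [b]-norm at zero; as [b] is semi-definite, this is weaker than
    equality. *)
Lemma cn_duhamel I (s : seq I) (e : I -> V) (X : I -> nat -> V)
    (c : I -> nat -> R) (M : nat) (U : nat -> V) :
  (forall i n, S (X i n)) ->
  (forall i f, S f -> cn_step 0 (X i 0%N) f = b (e i) f) ->
  (forall i n f, S f -> cn_step (X i n) (X i n.+1) f = 0) ->
  (forall m, (m <= M)%N -> S (U m)) -> U 0%N = 0 ->
  (forall m f, (m < M)%N -> S f ->
    cn_step (U m) (U m.+1) f = \sum_(i <- s) c i m * b (e i) f) ->
  forall m, (m <= M)%N ->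
    let u := U m - \sum_(i <- s) \sum_(j < m) c i j *: X i (m - j.+1)%N in
    b u u = 0.
Proof.
move=> SX X0 XS SU U0 UP.
pose Vm m := \sum_(i <- s) \sum_(j < m) c i j *: X i (m - j.+1)%N.
have VP m f : S f -> cn_step (Vm m) (Vm m.+1) f = \sum_(i <- s) c i m * b (e i) f.
  move=> Sf; rewrite /Vm cn_step_sum; apply: eq_bigr => i _.
  rewrite big_ord_recr/= subnn.
  have shift x y z g : cn_step x (y + c i m *: z) g = cn_step (c i m *: 0 + x) (c i m *: z + y) g.
    by rewrite scaler0 add0r addrC.
  rewrite shift cn_step_linear X0// cn_step_sum big1 ?addr0// => j _.
  rewrite subSn// -[c i j *: X i _]addr0 -[c i j *: X i (_ - _).+1]addr0.
  by rewrite cn_step_linear XS// cn_step0; ring.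
have SV m : S (Vm m).
  by apply: (subspace_sum hS) => i; apply: (subspace_sum hS) => j; exact: subspaceZ.
elim => [|m IH] lem /=.
  by rewrite U0 big1 ?subr0 ?(formE hb)// => i _; rewrite big_ord0.
have := IH (ltnW lem); rewrite /= -/(Vm m) -/(Vm m.+1) => b0.
apply/eqP; rewrite eq_le (form_ge0 hb) andbT -[leRHS]b0.
apply: cn_step_stable.
set f := U m.+1 - Vm m.+1 + (U m - Vm m).
have Sf : S f by apply: (subspaceD hS); apply: (subspaceB hS) => //; apply: SU => //; exact: ltnW.
have -> : U m - Vm m = -1 *: Vm m + U m by rewrite scaleN1r addrC.
have -> : U m.+1 - Vm m.+1 = -1 *: Vm m.+1 + U m.+1 by rewrite scaleN1r addrC.
by rewrite cn_step_linear VP// UP//; ring.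
Qed.

(* Aubin-Nitsche: [w] solves the dual problem with datum [q]. *)
Lemma duality_bound (e w q : V) (A B : R) : S (e - q) ->
  (forall f, S f -> a q f = 0) ->
  a w q = b q q -> 0 <= A -> 0 <= B ->
  (forall t, 0 < t -> exists2 f, S f & a (w - f) (w - f) <= (A + t) ^+ 2) ->
  (forall t, 0 < t -> exists2 f, S f & a (e - f) (e - f) <= (B + t) ^+ 2) ->
  b q q <= A * B.
Proof.
move=> Sq qP wq A0 B0 hw he.
have key t : 0 < t -> b q q <= (A + t) * (B + t).
  move=> t0; have [f Sf wf] := hw _ t0; have [g Sg eg] := he _ t0.
  (* Galerkin orthogonality gives [a (e - g) q = a q q], so Cauchy-Schwarz bounds the energy of [q]
     by that of any [e - g] with [g] in [S]. *)
  have aq : a q q <= (B + t) ^+ 2.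
    have E : a (e - g) q = a q q.
      have -> : e - g = (e - q - g) + q by rewrite addrAC subrK.
      by rewrite (formDl ha) (form_sym ha _ q) qP ?add0r//; exact: subspaceB.
    have := form_CS ha (e - g) q; rewrite E expr2.
    have [->|qN0] := eqVneq (a q q) 0; first by rewrite sqr_ge0.
    rewrite ler_pM2r ?lt_def ?qN0 ?(form_ge0 ha)// => H.
    exact: le_trans H eg.
  have E : a (w - f) q = b q q by rewrite (formBl ha) (form_sym ha f q) qP// subr0.
  have := form_CS ha (w - f) q; rewrite E => H.
  rewrite -(ler_pXn2r (ltn0Sn 1)) ?nnegrE ?(form_ge0 hb)//; last by rewrite mulr_ge0//; lra.
  rewrite exprMn; apply: (le_trans H).
  by apply: ler_pM => //; exact: (form_ge0 ha).
apply/ler_addgt0Pr => d d0.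
(* For [t <= 1] the excess of [(A + t) * (B + t)] over [A * B] is at most [t * (A + B + 1)]. *)
pose t := Num.min 1 (d / (A + B + 1)).
have AB : 0 < A + B + 1 by lra.
have t0 : 0 < t by rewrite lt_min ltr01 divr_gt0.
apply: (le_trans (key _ t0)).
have t1 : t <= 1 by rewrite ge_min lexx.
have td : t * (A + B + 1) <= d by rewrite -ler_pdivlMr// ge_min lexx orbT.
nra.
Qed.

End CrankNicolson.

(** * Scalar Crank-Nicolson kernel against the exponential *)

Section Calculus.
Context {R : realType}.
Local Notation leb := (@lebesgue_measure R).

Lemma is_derive_continuous (F f : R -> R) : (forall x : R, is_derive x 1 F (f x)) -> continuous F.
Proof.
move=> dF x; apply/differentiable_continuous/derivable1_diffP.
by have [] := dF x.
Qed.

Lemma Rintegral_FTC (F f : R -> R) (s t : R) : s <= t ->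
  (forall x : R, is_derive x 1 F (f x)) -> continuous f ->
  \int[leb]_(x in `[s, t]) f x = F t - F s.
Proof.
rewrite le_eqVlt => /predU1P[<- _ _|st dF cf].
  by rewrite set_itv1 Rintegral_set1 subrr.
have cF := is_derive_continuous dF.
rewrite /Rintegral (@continuous_FTC2 _ f F s t) //.
- by apply: continuous_subspaceT => x; exact: cf.
- by split => [x _||]; [have [] := dF x|exact/cvg_at_right_filter/cF|exact/cvg_at_left_filter/cF].
- by move=> x _; rewrite derive1E; have [] := dF x.
Qed.

Lemma derive_ge0_ge0 (f df : R -> R) (z : R) : 0 <= z ->
  (forall x : R, is_derive x 1 f (df x)) -> (forall x : R, 0 <= x -> 0 <= df x) ->
  f 0 = 0 -> 0 <= f z.
Proof.
move=> z0 dF df0 f0.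
have [|c] := @MVT_segment R f df 0 z z0 (fun x _ => dF x).
  by apply: continuous_subspaceT => x; exact: is_derive_continuous.
rewrite in_itv/= => /andP[c0 _]; rewrite f0 !subr0 => ->.
by rewrite mulr_ge0 ?df0.
Qed.

Lemma expRN_le (z : R) : 0 <= z -> expR (- z) <= 1 - z + z ^+ 2 / 2.
Proof.
move=> z0; rewrite -subr_ge0.
apply: (@derive_ge0_ge0 (fun x => 1 - x + x ^+ 2 / 2 - expR (- x)) (fun x => x - 1 + expR (- x))) => //.
- by move=> x; apply: is_derive_eq; rewrite /GRing.scale/=; field.
- by move=> x _ /=; have := expR_ge1Dx (- x); lra.
- by rewrite oppr0 expR0; ring.
Qed.

(** Equivalently [(1 - z / 2) / (1 + z / 2) <= exp (- z)]: the Crank-Nicolson ratio never exceeds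
    the exact decay factor. *)
Lemma expRN_ge (z : R) : 0 <= z -> 1 - z / 2 <= (1 + z / 2) * expR (- z).
Proof.
move=> z0; rewrite -subr_ge0.
apply: (@derive_ge0_ge0 (fun x => (1 + x / 2) * expR (- x) - (1 - x / 2))
  (fun x => (1 - (1 + x) * expR (- x)) / 2)) => //.
- by move=> x; apply: is_derive_eq; rewrite /GRing.scale/=; field.
- move=> x _; rewrite divr_ge0// subr_ge0.
  rewrite -(ler_pM2r (expR_gt0 x)) mul1r -mulrA [expR (- x) * _]mulrC expRxMexpNx_1 mulr1.
  exact: expR_ge1Dx.
- by rewrite oppr0 expR0; ring.
Qed.

End Calculus.

Section TimeKernel.
Context {R : realType}.
Local Notation leb := (@lebesgue_measure R).
Variables (k L : R).
Hypotheses (k_gt0 : 0 < k) (L_gt0 : 0 < L).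

Lemma integral_kernel_sqr (K c s t : R) : s <= t ->
  \int[leb]_(x in `[s, t]) ((K - expR (- L * (c - x))) ^+ 2) =
  (K ^+ 2 * t - 2 * K * expR (- L * (c - t)) / L + expR (- L * (c - t)) ^+ 2 / (2 * L))
  - (K ^+ 2 * s - 2 * K * expR (- L * (c - s)) / L + expR (- L * (c - s)) ^+ 2 / (2 * L)).
Proof.
move=> st.
have LN0 : L != 0 by rewrite gt_eqF.
apply: (@Rintegral_FTC R (fun x => K ^+ 2 * x - 2 * K * expR (- L * (c - x)) / L
   + expR (- L * (c - x)) ^+ 2 / (2 * L)) (fun x => (K - expR (- L * (c - x))) ^+ 2)) => //.
- by move=> x; apply: is_derive_eq; rewrite /GRing.scale/=; field; exact: LN0.
- move=> x.
  have : is_derive (x : R) 1 (fun x => (K - expR (- L * (c - x))) ^+ 2)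
     (2 * (K - expR (- L * (c - x))) * (- L * expR (- L * (c - x)))).
    by apply: is_derive_eq; rewrite /GRing.scale/=; ring.
  by move=> [dx _]; apply/differentiable_continuous/derivable1_diffP.
Qed.

(** The left side is computed in closed form. The two square terms contribute [(1 - r^(2m)) / (2 L)]
    and [(1 - E^(2m)) / (2 L)], the cross term a geometric series of ratio [r E]. What survives is
    at most [(1 - rho) / L] with [1 - rho <= min (1, (k L)^2 / 2)]. *)
Lemma time_kernel_bound (m : nat) :
  \sum_(j < m) \int[leb]_(s in `[j%:R * k, j.+1%:R * k])
     ((cn_kernel k L (m - j.+1) - expR (- L * (m%:R * k - s))) ^+ 2)
  <= Num.min (L^-1) (k ^+ 2 * L / 2).
Proof.
set E := expR (- (k * L)).
set r := cn_ratio k L.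
have kL_gt0 : 0 < k * L by rewrite mulr_gt0.
have E_gt0 : 0 < E by exact: expR_gt0.
have E_lt1 : E < 1 by rewrite expR_lt1 oppr_lt0.
(* The cross term sums to [- rho * (1 - (r E)^m) / L]; the denominator is
   [(1 + k L / 2) * (1 - r E)]. *)
pose rho := 2 * (1 - E) / ((1 + k * L / 2) - (1 - k * L / 2) * E).
have D_gt : k * L / 2 <= (1 + k * L / 2) - (1 - k * L / 2) * E.
  have : 0 < k * L * E by rewrite mulr_gt0.
  lra.
have D_gt0 : 0 < (1 + k * L / 2) - (1 - k * L / 2) * E by lra.
have rho_ge0 : 0 <= rho.
  by apply: divr_ge0; [apply: mulr_ge0 => //; lra|exact: ltW].
have rhoE : 1 - rho = ((k * L / 2 - 1) + (1 + k * L / 2) * E) /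
    ((1 + k * L / 2) - (1 - k * L / 2) * E).
  by rewrite /rho; field; rewrite gt_eqF//; lra.
have rho_le1 : rho <= 1.
  rewrite -subr_ge0 rhoE divr_ge0 ?(ltW D_gt0)//.
  by have := expRN_ge (ltW kL_gt0); rewrite -/E; lra.
(* With [z = k L], the numerator of [1 - rho] is at most [z^3 / 4] by the second order bound of
   [exp (- z)], and the denominator is at least [z / 2]. *)
have rho_le : 1 - rho <= (k * L) ^+ 2 / 2.
  rewrite rhoE ler_pdivrMr//.
  apply: (@le_trans _ _ ((k * L) ^+ 2 / 2 * (k * L / 2))); last first.
    by rewrite ler_wpM2l// divr_ge0// sqr_ge0.
  have := expRN_le (ltW kL_gt0); rewrite -/E => H.
  have : (1 + k * L / 2) * E <= (1 + k * L / 2) * (1 - k * L + (k * L) ^+ 2 / 2).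
    by rewrite ler_wpM2l//; lra.
  lra.
suff sumE : \sum_(j < m) \int[leb]_(s in `[j%:R * k, j.+1%:R * k])
     ((cn_kernel k L (m - j.+1) - expR (- L * (m%:R * k - s))) ^+ 2)
   = (1 - rho - (E ^+ m * E ^+ m + r ^+ m * r ^+ m) / 2 + rho * (r ^+ m * E ^+ m)) / L.
  apply: (@le_trans _ _ ((1 - rho) / L)); last first.
    rewrite le_min; apply/andP; split.
      by rewrite ler_piMl ?invr_ge0 ?(ltW L_gt0)//; lra.
    rewrite ler_pdivrMr//; apply: (le_trans rho_le).
    by rewrite le_eqVlt; apply/orP; left; apply/eqP; field.
  rewrite sumE ler_pM2r ?invr_gt0//.
  move: (E ^+ m) (r ^+ m) => x y.
  (* This is exactly the quantity by which [1 - rho] exceeds the closed form. *)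
  have : 0 <= (1 - rho) * (x ^+ 2 + y ^+ 2) / 2 + rho * ((x - y) ^+ 2) / 2.
    have [x2 y2 xy2] := And3 (sqr_ge0 x) (sqr_ge0 y) (sqr_ge0 (x - y)).
    apply: addr_ge0; apply: divr_ge0 => //; apply: mulr_ge0 => //; lra.
  lra.
have intE j : (j < m)%N -> \int[leb]_(s in `[j%:R * k, j.+1%:R * k])
     ((cn_kernel k L (m - j.+1) - expR (- L * (m%:R * k - s))) ^+ 2) =
   k * cn_kernel k L (m - j.+1) ^+ 2
   - 2 * cn_kernel k L (m - j.+1) * (1 - E) * E ^+ (m - j.+1) / L
   + (1 - E ^+ 2) * E ^+ (m - j.+1) ^+ 2 / (2 * L).
  move=> jm; rewrite integral_kernel_sqr; last by rewrite ler_pM2r// ler_nat.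
  have e1 : expR (- L * (m%:R * k - j.+1%:R * k)) = E ^+ (m - j.+1).
    rewrite -mulrBl -natrB// /E -expRM_natl; congr expR; ring.
  have e2 : expR (- L * (m%:R * k - j%:R * k)) = E * E ^+ (m - j.+1).
    rewrite -exprS -subSn// subSS -mulrBl -natrB ?(ltnW jm)// /E -expRM_natl; congr expR; ring.
  rewrite e1 e2 -[j.+1]addn1 natrD; field; exact: lt0r_neq0.
under eq_bigr => j _ do rewrite intE//.
(* Reversing the sum makes the summand depend on the age [m - j.+1] only, so that induction on [m]
   adds a last term. *)
rewrite {intE} (reindex_inj rev_ord_inj)/=.
under eq_bigr => j _ do rewrite subnSK// subKn ?(ltnW (ltn_ord j))//.
rewrite -/E; elim: m => [|m IH].
  by rewrite big_ord0 !expr0; field; exact: lt0r_neq0.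
rewrite big_ord_recr/= IH !exprS /cn_kernel -/r /rho.
move: (E ^+ m) (r ^+ m) => x y.
have -> : r = (1 - k * L / 2) / (1 + k * L / 2) by [].
by field; rewrite !lt0r_neq0//=; lra.
Qed.

End TimeKernel.

Section Sums.
Context {R : realType}.

(** The hypotheses give [F i * (1 + H i)^2 <= 4 A], treating [H i <= 1] and [H i > 1] separately.
    The sum is then a lower Riemann sum of mesh [H] for the integral of [4 A / (1 + x)^2] over the
    half line; the induction carries the value of the integral up to [H N]. *)
Lemma sum_min_bound (H A : R) (F : nat -> R) (N : nat) : 0 < H -> 0 <= A ->
  (forall i, (0 < i)%N -> [/\ 0 <= F i, F i <= A & F i * (H * i%:R) ^+ 4 <= A]) ->
  H * \sum_(1 <= i < N.+1) F i <= 4 * A.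
Proof.
move=> H0 A0 FA.
suff : H * \sum_(1 <= i < N.+1) F i <= 4 * A * (1 - (1 + H * N%:R)^-1).
  move=> /le_trans; apply; rewrite ler_piMr ?mulr_ge0//.
  by rewrite gerBl invr_ge0 addr_ge0// mulr_ge0// ltW.
elim: N => [|N IH]; first by rewrite big_nil mulr0 addr0 invr1 subrr !mulr0.
rewrite big_nat_recr//= mulrDr.
have [F0 F1 F2] := FA N.+1 isT.
have HN : 0 <= H * N%:R by rewrite mulr_ge0// ltW.
have : H * F N.+1 <= 4 * A * ((1 + H * N%:R)^-1 - (1 + H * N.+1%:R)^-1); last by lra.
set x := H * N.+1%:R in F2 *.
have xE : H * N%:R = x - H by rewrite /x -addn1 natrD; ring.
rewrite xE in HN *.
have -> : (1 + (x - H))^-1 - (1 + x)^-1 = H / ((1 + (x - H)) * (1 + x)).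
  by field; rewrite !lt0r_neq0//=; lra.
rewrite mulrCA ler_pM2l//.
have Fx : F N.+1 * (1 + x) ^+ 2 <= 4 * A.
  have [x1|x1] := leP x 1.
    apply: (@le_trans _ _ (F N.+1 * 4)); last lra.
    rewrite ler_wpM2l//; nra.
  apply: (@le_trans _ _ (F N.+1 * (4 * x ^+ 4))); last lra.
  rewrite ler_wpM2l//.
  have : x ^+ 2 <= x ^+ 4 by rewrite ler_eXn2l ?ltW.
  nra.
rewrite ler_pdivlMr; last by rewrite mulr_gt0//; lra.
apply: le_trans Fx.
by rewrite ler_wpM2l// expr2 ler_wpM2r//; lra.
Qed.

End Sums.

(** * Square integrable functions and weak derivatives on D *)

Section L2Theory.
Context d (X : measurableType d) (R : realType) (mu : {measure set X -> \bar R}).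
Variables (A : set X) (mA : measurable A).
Implicit Types f g : X -> R.

Lemma L2_mul_integrable f g : L2 mu A f -> L2 mu A g ->
  mu.-integrable A (EFin \o (fun x => f x * g x)).
Proof.
move=> [mf f2] [mg g2].
apply: (le_integrable mA _ _ (integrableD mA f2 g2)).
  by apply/measurable_EFinP; exact: measurable_funM.
move=> x _ /=; rewrite lee_fin.
rewrite [leRHS]ger0_norm ?addr_ge0 ?sqr_ge0// ler_norml.
have := sqr_ge0 (f x + g x); have := sqr_ge0 (f x - g x).
have := sqr_ge0 (f x); have := sqr_ge0 (g x).
by move=> h1 h2 h3 h4; apply/andP; split; nra.
Qed.

Lemma L2_lin c f g : L2 mu A f -> L2 mu A g -> L2 mu A (fun x => c * f x + g x).
Proof.
move=> Lf Lg.
have [[mf f2] [mg g2]] := (Lf, Lg).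
split; first by apply: measurable_funD => //; exact: measurable_funM.
have -> : (fun x => ((c * f x + g x) ^+ 2)%:E) =
  (fun x => (c ^+ 2)%:E * (f x ^+ 2)%:E + ((2 * c)%:E * (f x * g x)%:E + (g x ^+ 2)%:E))%E.
  by apply/funext => x; rewrite -!EFinM -!EFinD; congr EFin; ring.
apply: integrableD => //; first exact: integrableZl.
by apply: integrableD => //; apply: integrableZl => //; exact: L2_mul_integrable.
Qed.

Lemma L2_bounded f (B : R) : (mu A < +oo)%E -> measurable_fun A f ->
  (forall x, A x -> `|f x| <= B) -> L2 mu A f.
Proof.
move=> Afin mf fB; split => //.
apply: measurable_bounded_integrable => //; first exact: measurable_funX.
exists (B ^+ 2); split; first exact: num_real.
move=> y By x Ax; apply: le_trans (ltW By).
by rewrite normrX lerXn2r ?nnegrE ?fB// (le_trans _ (fB _ Ax)).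
Qed.

Lemma integrable_lin c f g : mu.-integrable A (EFin \o f) -> mu.-integrable A (EFin \o g) ->
  mu.-integrable A (EFin \o (fun x => c * f x + g x)).
Proof.
move=> fi gi; have := integrableD mA (integrableZl mA c fi) gi.
by apply: eq_integrable => // x _ /=; rewrite -EFinM -EFinD.
Qed.

Lemma Rintegral_lin c f g : mu.-integrable A (EFin \o f) -> mu.-integrable A (EFin \o g) ->
  \int[mu]_(x in A) (c * f x + g x) = c * \int[mu]_(x in A) f x + \int[mu]_(x in A) g x.
Proof.
move=> fi gi; rewrite RintegralD ?RintegralZl//.
by have := integrableZl mA c fi; apply: eq_integrable => // x _ /=; rewrite -EFinM.
Qed.

Lemma Rintegral_sum_lin I (s : seq I) (c : I -> R) (F : I -> X -> R) :
  (forall i, mu.-integrable A (EFin \o F i)) ->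
  mu.-integrable A (EFin \o (fun x => \sum_(i <- s) c i * F i x)) /\
  \int[mu]_(x in A) (\sum_(i <- s) c i * F i x) = \sum_(i <- s) c i * \int[mu]_(x in A) F i x.
Proof.
move=> Fi; elim: s => [|i s [IH1 IH2]].
  split; last by under eq_Rintegral do rewrite big_nil; rewrite big_nil Rintegral_cst// mul0r.
  have -> : EFin \o (fun x => \sum_(i <- [::]) c i * F i x) = cst 0%E.
    by apply/funext => x /=; rewrite big_nil.
  exact: integrable0.
have E : (fun x => \sum_(j <- i :: s) c j * F j x) = (fun x => c i * F i x + \sum_(j <- s) c j * F j x).
  by apply/funext => x; rewrite big_cons.
rewrite E; split; first exact: integrable_lin.
by rewrite Rintegral_lin// IH2 big_cons.
Qed.

Lemma Rintegral_ae_eq f g : measurable_fun A f -> measurable_fun A g ->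
  {ae mu, forall x, A x -> f x = g x} ->
  \int[mu]_(x in A) f x = \int[mu]_(x in A) g x.
Proof.
move=> mf mg fg; rewrite /Rintegral; congr fine; apply: ae_eq_integral => //.
- exact/measurable_EFinP.
- exact/measurable_EFinP.
- by apply: filterS fg => x /[apply] ->.
Qed.

Lemma Rdominated_cvg (f_ : nat -> X -> R) f g :
  (forall n, measurable_fun A (f_ n)) -> measurable_fun A f ->
  (forall x, A x -> f_ ^~ x @ \oo --> f x) ->
  mu.-integrable A (EFin \o g) -> (forall n x, A x -> `|f_ n x| <= g x) ->
  \int[mu]_(x in A) f_ n x @[n --> \oo] --> \int[mu]_(x in A) f x.
Proof.
move=> mf_ mf ff gi fg.
have [|||||fi _ cv] := @dominated_convergence _ X R mu A mA
    (fun n => EFin \o f_ n) (EFin \o f) (EFin \o g).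
- by move=> n; exact/measurable_EFinP.
- exact/measurable_EFinP.
- by apply: aeW => x Ax; apply: cvg_EFin; [exact: nearW|exact: ff].
- exact: gi.
- by apply: aeW => x n Ax; rewrite lee_fin; exact: fg.
apply: fine_cvg; rewrite fineK; last exact: integrable_fin_num.
exact: cv.
Qed.

End L2Theory.

(** * Continuously differentiable cutoff functions *)

Section Cutoff.
Context {R : realType}.
Local Notation leb := (@lebesgue_measure R).

(** A quadratic remainder estimate on the whole line reduces the differentiability of [sqpos], also
    at [0], to polynomial inequalities. *)
Lemma is_derive_quadratic (f : R -> R) (x d K : R) :
  (forall h, `|f (h + x) - f x - h * d| <= K * h ^+ 2) -> is_derive x (1 : R) f d.
Proof.
move=> H0; pose K' := `|K| + 1; have K0 : 0 < K' by rewrite ltr_wpDl.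
have H h : `|f (h + x) - f x - h * d| <= K' * h ^+ 2.
  by rewrite (le_trans (H0 h))// ler_wpM2r ?sqr_ge0// (le_trans (ler_norm _))// lerDl.
suff H2 : h^-1 *: ((f \o shift x) (h *: (1 : R)) - f x) @[h --> 0^'] --> d.
  by split; [apply/cvg_ex; exists d|exact/cvg_lim].
apply/cvgrPdist_le => e e0; near=> h.
have h0 : h != 0 by near: h; exact: nbhs_dnbhs_neq.
rewrite /= /GRing.scale/= mulr1.
have -> : d - h^-1 * (f (h + x) - f x) = - (h^-1 * (f (h + x) - f x - h * d)) by field.
rewrite normrN normrM normfV ler_pdivrMl ?normr_gt0//.
apply: (le_trans (H h)); rewrite -real_normK ?num_real// expr2 mulrCA ler_wpM2l//.
rewrite -ler_pdivlMl//.
by near: h; apply: dnbhs0_le; rewrite mulr_gt0 ?invr_gt0.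
Unshelve. all: by end_near. Qed.

Definition pos (x : R) := Num.max x 0.
Definition sqpos (x : R) := pos x ^+ 2.

Lemma continuous_pos : continuous pos.
Proof. by move=> x; apply: continuous_max; [exact: cvg_id|exact: cvg_cst]. Qed.

Lemma posE x : (0 <= x /\ pos x = x) \/ (x <= 0 /\ pos x = 0).
Proof. by rewrite /pos; case: (leP x 0) => H; [right|left; split => //; exact: ltW]. Qed.

Global Instance is_derive_sqpos (x : R) : is_derive x (1 : R) sqpos (2 * pos x).
Proof.
apply: (@is_derive_quadratic _ _ _ 1) => h; rewrite mul1r /sqpos.
rewrite ler_norml.
by case: (posE x) => [][x0 ->]; case: (posE (h + x)) => [][hx0 ->]; apply/andP; split; nra.
Qed.

(** Quadratic spline rising from [0] to [1] on [[0, 1]]; its derivative [dstep] is the hat function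
    of height [2]. It is [C^1], which is all that [C1c_D] asks for. *)
Definition step (x : R) := 2 * sqpos x - 4 * sqpos (x - 2^-1) + 2 * sqpos (x - 1).
Definition dstep (x : R) := 4 * pos x - 8 * pos (x - 2^-1) + 4 * pos (x - 1).

Lemma is_derive_step (x : R) : is_derive x (1 : R) step (dstep x).
Proof.
apply: is_derive_eq; rewrite /dstep /GRing.scale/=; ring.
Qed.

Lemma continuous_dstep : continuous dstep.
Proof.
move=> x; have c y : {for x, continuous (fun z => pos (z - y))}.
  apply: continuous_comp; last exact: continuous_pos.
  by apply: cvgB; [exact: cvg_id|exact: cvg_cst].
apply: cvgD; [apply: cvgB|]; apply: cvgM; try exact: cvg_cst.
- exact: continuous_pos.
- exact: c.
- exact: c.
Qed.

Lemma step_le0 x : x <= 0 -> step x = 0 /\ dstep x = 0.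
Proof.
move=> x0; rewrite /step /dstep /sqpos.
by case: (posE x) => [][? ->]; case: (posE (x - 2^-1)) => [][? ->];
  case: (posE (x - 1)) => [][? ->]; split; nra.
Qed.

Lemma step_ge1 x : 1 <= x -> step x = 1 /\ dstep x = 0.
Proof.
move=> x0; rewrite /step /dstep /sqpos.
by case: (posE x) => [][? ->]; case: (posE (x - 2^-1)) => [][? ->];
  case: (posE (x - 1)) => [][? ->]; split; first [lra|nra].
Qed.

Lemma step_bounds x : 0 <= step x <= 1 /\ `|dstep x| <= 2.
Proof.
rewrite ler_norml /step /dstep /sqpos.
by case: (posE x) => [][? ->]; case: (posE (x - 2^-1)) => [][? ->];
  case: (posE (x - 1)) => [][? ->]; split; apply/andP; split; nra.
Qed.

(* Tends to the indicator function of [`]0, x[] and is admissible as a test function. *)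
Definition cutoff (x : R) (n : nat) (t : R) :=
  step (n.+1%:R * t - 1) * step (n.+1%:R * (x - t) - 1).
Definition dcutoff (x : R) (n : nat) (t : R) :=
  n.+1%:R * (dstep (n.+1%:R * t - 1) * step (n.+1%:R * (x - t) - 1)
             - step (n.+1%:R * t - 1) * dstep (n.+1%:R * (x - t) - 1)).

Lemma is_derive_cutoff x n (t : R) : is_derive t (1 : R) (cutoff x n) (dcutoff x n t).
Proof.
have d1 : is_derive t (1 : R) (fun t => step (n.+1%:R * t - 1)) (n.+1%:R * dstep (n.+1%:R * t - 1)).
  have := is_derive_step (n.+1%:R * t - 1) => H.
  by apply: is_derive_eq; rewrite /GRing.scale/=; ring.
have d2 : is_derive t (1 : R) (fun t => step (n.+1%:R * (x - t) - 1)) (- n.+1%:R * dstep (n.+1%:R * (x - t) - 1)).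
  have := is_derive_step (n.+1%:R * (x - t) - 1) => H.
  by apply: is_derive_eq; rewrite /GRing.scale/=; ring.
apply: is_derive_eq; rewrite /dcutoff /GRing.scale/=; ring.
Qed.

Lemma continuous_dcutoff x n : continuous (dcutoff x n).
Proof.
move=> t.
have ca : {for t, continuous (fun t : R => n.+1%:R * t - 1)}.
  by apply: cvgB; [apply: cvgM; [exact: cvg_cst|exact: cvg_id]|exact: cvg_cst].
have cb : {for t, continuous (fun t : R => n.+1%:R * (x - t) - 1)}.
  apply: cvgB; [apply: cvgM; [exact: cvg_cst|]|exact: cvg_cst].
  by apply: cvgB; [exact: cvg_cst|exact: cvg_id].
have cs := is_derive_continuous is_derive_step.
apply: cvgM; first exact: cvg_cst.
apply: cvgB; apply: cvgM.
- exact: (continuous_comp ca (@continuous_dstep _)).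
- exact: (continuous_comp cb (cs _)).
- exact: (continuous_comp ca (cs _)).
- exact: (continuous_comp cb (@continuous_dstep _)).
Qed.

Lemma cutoff_bounds x n t : 0 <= cutoff x n t <= 1.
Proof.
rewrite /cutoff.
have [/andP[? ?] _] := step_bounds (n.+1%:R * t - 1).
have [/andP[? ?] _] := step_bounds (n.+1%:R * (x - t) - 1).
by rewrite mulr_ge0//= mulr_ile1.
Qed.

Lemma cutoff_out x n t : ~~ (n.+1%:R^-1 <= t <= x - n.+1%:R^-1) -> cutoff x n t = 0.
Proof.
have n0 : (0 : R) < n.+1%:R by rewrite ltr0n.
rewrite negb_and -!ltNge /cutoff => /orP[tn|tn].
  rewrite (step_le0 _).1 ?mul0r// subr_le0.
  by rewrite -ler_pdivlMl// mulr1 ltW.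
rewrite (_ : step (_ * (x - t) - 1) = 0) ?mulr0//.
by apply: (step_le0 _).1; rewrite subr_le0 -ler_pdivlMl// mulr1 lerBlDr addrC -lerBlDr ltW.
Qed.

Lemma cutoff_in x t : 0 < t < x ->
  \forall n \near \oo, cutoff x n t = 1 /\ dcutoff x n t = 0.
Proof.
move=> /andP[t0 tx]; near=> n.
have h1 : 1 <= n.+1%:R * t - 1.
  rewrite lerBrDr -ler_pdivrMr// -natr1 -lerBlDr.
  by near: n; exact: nbhs_infty_ger.
have h2 : 1 <= n.+1%:R * (x - t) - 1.
  rewrite lerBrDr -ler_pdivrMr ?subr_gt0// -natr1 -lerBlDr.
  by near: n; exact: nbhs_infty_ger.
rewrite /cutoff /dcutoff (step_ge1 h1).1 (step_ge1 h1).2 (step_ge1 h2).1 (step_ge1 h2).2.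
by split; ring.
Unshelve. all: by end_near. Qed.

(** The derivative has size of order [n.+1], but only within distance [2 / n.+1] of the end points;
    the weight [t * (1 - t)] compensates this uniformly in [n]. This provides the dominating
    function in the integration by parts with cutoffs. *)
Lemma dcutoff_bound n t : 0 < t < 1 -> `|dcutoff 1 n t| * (t * (1 - t)) <= 8.
Proof.
move=> /andP[t0 t1]; have n0 : (0 : R) < n.+1%:R by rewrite ltr0n.
have key s : 0 < s -> `|n.+1%:R * dstep (n.+1%:R * s - 1)| * s <= 4.
  move=> s0; have [s1|s1] := leP 1 (n.+1%:R * s - 1).
    by rewrite (step_ge1 s1).2 mulr0 normr0 mul0r.
  have [_] := step_bounds (n.+1%:R * s - 1); move: (dstep _) => D D2.
  rewrite normrM gtr0_norm// mulrAC.
  have : n.+1%:R * s <= 2 by lra.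
  have := mulr_ge0 (ltW n0) (ltW s0); move: (n.+1%:R * s) => u u0 u2.
  by have := normr_ge0 D; nra.
have k1 := key _ t0; have t1' : 0 < 1 - t by lra.
have k2 := key _ t1'.
have [/andP[a0 a1] _] := step_bounds (n.+1%:R * t - 1).
have [/andP[b0 b1] _] := step_bounds (n.+1%:R * (1 - t) - 1).
have -> : dcutoff 1 n t = n.+1%:R * dstep (n.+1%:R * t - 1) * step (n.+1%:R * (1 - t) - 1)
    - step (n.+1%:R * t - 1) * (n.+1%:R * dstep (n.+1%:R * (1 - t) - 1)).
  by rewrite /dcutoff; ring.
move: (n.+1%:R * dstep (n.+1%:R * t - 1)) (n.+1%:R * dstep (n.+1%:R * (1 - t) - 1)) k1 k2 => p q k1 k2.
move: (step _) (step _) a0 a1 b0 b1 => a b a0 a1 b0 b1.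
apply: (@le_trans _ _ ((`|p| + `|q|) * (t * (1 - t)))).
  rewrite ler_wpM2r ?mulr_ge0 ?(ltW t0) ?(ltW t1')//.
  apply: (le_trans (ler_normB _ _)); rewrite !normrM (ger0_norm a0) (ger0_norm b0).
  by apply: lerD; [rewrite ler_piMr|rewrite ler_piMl].
have p0 := normr_ge0 p; have q0 := normr_ge0 q.
have : `|p| * t * (1 - t) <= 4 by apply: (le_trans _ k1); rewrite ler_piMr ?mulr_ge0 ?(ltW t0) ?(ltW t1')//; lra.
have : `|q| * (1 - t) * t <= 4 by apply: (le_trans _ k2); rewrite ler_piMr ?mulr_ge0 ?(ltW t0) ?(ltW t1')//; lra.
lra.
Qed.

End Cutoff.

Section Inner.
Context {R : realType}.
Local Notation leb := (@lebesgue_measure R).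
Local Notation D := (@D R).
Implicit Types f g v w : R -> R.

Lemma ae_mono (P Q : R -> Prop) : (forall x, P x -> Q x) ->
  {ae leb, forall x, P x} -> {ae leb, forall x, Q x}.
Proof. by move=> PQ; apply: filterS; first exact: (ae_filter_ringOfSetsType leb). Qed.

Lemma measurable_D : measurable (D : set (measurableTypeR R)).
Proof. exact: measurable_itv. Qed.

Lemma leb_D : leb D = 1%E.
Proof. by rewrite lebesgue_measure_itv/= lte_fin ltr01 oppr0 adde0. Qed.

Lemma leb_D_fin : (leb D < +oo)%E.
Proof. by rewrite leb_D ltry. Qed.

Lemma DE (x : R) : D x <-> 0 < x < 1.
Proof. by rewrite /Defs.D/= in_itv. Qed.

Lemma L2D_integrable f g : L2D f -> L2D g -> leb.-integrable D (EFin \o (fun x => f x * g x)).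
Proof. by apply: L2_mul_integrable; exact: measurable_D. Qed.

Lemma L2D_bounded f (B : R) : measurable_fun D f -> (forall x, D x -> `|f x| <= B) -> L2D f.
Proof. exact: (@L2_bounded _ _ _ leb D measurable_D f B leb_D_fin). Qed.

Lemma L2D_cst (c : R) : L2D (fun=> c).
Proof. by apply: (@L2D_bounded _ `|c|) => //; exact: measurable_cst. Qed.

Lemma L2D_lin c f g : L2D f -> L2D g -> L2D (fun x => c * f x + g x).
Proof. by apply: L2_lin; exact: measurable_D. Qed.

Lemma L2D_integrable1 f : L2D f -> leb.-integrable D (EFin \o f).
Proof.
move=> Lf; have := L2D_integrable Lf (L2D_cst 1).
by apply: eq_integrable => [|x _ /=]; [exact: measurable_D|rewrite mulr1].
Qed.

Lemma continuous_bounded01 f : continuous f -> exists2 B, 0 <= B & forall x, 0 <= x <= 1 -> `|f x| <= B.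
Proof.
move=> cf; have cnf : {within `[(0 : R), 1], continuous (fun x => `|f x|)}.
  apply: continuous_subspaceT => x; apply: continuous_comp; first exact: cf.
  exact: norm_continuous.
have [c _ hc] := EVT_max ler01 cnf.
by exists `|f c| => // x x01; apply: hc; rewrite in_itv.
Qed.

Lemma continuous_L2D f : continuous f -> L2D f.
Proof.
move=> cf; have [B _ fB] := continuous_bounded01 cf.
apply: (@L2D_bounded _ B).
  by apply: measurable_funTS; exact: continuous_measurable_fun.
by move=> x /DE/andP[x0 x1]; apply: fB; rewrite !ltW.
Qed.

Lemma inner_sym f g : inner f g = inner g f.
Proof. by apply: eq_Rintegral => x _; rewrite mulrC. Qed.

Lemma inner_ge0 f : 0 <= inner f f.
Proof. by apply: Rintegral_ge0 => x _; rewrite -expr2 sqr_ge0. Qed.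

Lemma inner_linear c f g h : L2D f -> L2D g -> L2D h ->
  inner (fun x => c * f x + g x) h = c * inner f h + inner g h.
Proof.
move=> Lf Lg Lh; transitivity (\int[leb]_(x in D) (c * (f x * h x) + g x * h x)).
  by apply: eq_Rintegral => x _; ring.
by apply: Rintegral_lin; [exact: measurable_D|exact: L2D_integrable..].
Qed.

Lemma inner_linear_r c f g h : L2D f -> L2D g -> L2D h ->
  inner h (fun x => c * f x + g x) = c * inner h f + inner h g.
Proof. by move=> *; rewrite !(inner_sym h) inner_linear. Qed.

Lemma inner_ae f g h : L2D f -> L2D g -> L2D h -> {ae leb, forall x, D x -> f x = g x} ->
  inner f h = inner g h.
Proof.
move=> [mf _] [mg _] [mh _] fg; apply: Rintegral_ae_eq; first exact: measurable_D.
- exact: measurable_funM.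
- exact: measurable_funM.
- by apply: ae_mono fg => x /[apply] ->.
Qed.

Lemma inner_ae2 f g h k : L2D f -> L2D g -> L2D h -> L2D k ->
  {ae leb, forall x, D x -> f x = g x} -> {ae leb, forall x, D x -> h x = k x} ->
  inner f h = inner g k.
Proof.
by move=> Lf Lg Lh Lk fg hk; rewrite (inner_ae Lf Lg Lh fg) !(inner_sym g) (inner_ae Lh Lk Lg hk).
Qed.

Lemma inner_le f (B : R) : L2D f -> 0 <= B -> (forall x, D x -> `|f x| <= B) -> inner f f <= B ^+ 2.
Proof.
move=> Lf B0 fB.
have -> : B ^+ 2 = \int[leb]_(x in D) B ^+ 2.
  transitivity (B ^+ 2 * fine (leb D)); first by rewrite leb_D mulr1.
  by apply/esym/Rintegral_cst; exact: measurable_D.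
apply: le_Rintegral; first exact: measurable_D.
- exact: L2D_integrable.
- by have := L2D_integrable1 (L2D_cst (B ^+ 2)).
- by move=> x Dx; rewrite -expr2 -real_normK ?num_real// lerXn2r ?nnegrE ?fB.
Qed.

Lemma inner_eq0_ae f : L2D f -> inner f f = 0 -> {ae leb, forall x, D x -> f x = 0}.
Proof.
move=> Lf f0; have ff := L2D_integrable Lf Lf.
have : (\int[leb]_(x in D) `|(f x * f x)%:E|)%E = 0%E.
  under eq_integral do rewrite gee0_abs ?lee_fin -?expr2 ?sqr_ge0//.
  have := integrable_fin_num measurable_D ff.
  by move/fineK => <-; congr EFin; rewrite -[RHS]f0.
have mf : measurable_fun D (fun x => (f x * f x)%:E).
  by case/integrableP : ff.
move=> /(ae_eq_integral_abs leb measurable_D mf).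
apply: ae_mono => x /[apply] /eqP.
by rewrite eqe mulf_eq0 orbb => /eqP.
Qed.

Lemma Rintegral_D01 f : measurable_fun D f ->
  \int[leb]_(x in D) f x = \int[leb]_(x in `[0, 1]) f x.
Proof.
move=> mf; rewrite /Rintegral; congr fine; apply/esym/integral_itv_bndoo.
exact/measurable_EFinP.
Qed.

Lemma inner_FTC f F : (forall x : R, is_derive x (1 : R) F (f x)) -> continuous f ->
  \int[leb]_(x in D) f x = F 1 - F 0.
Proof.
move=> dF cf; rewrite Rintegral_D01; first exact: Rintegral_FTC.
exact: (continuous_L2D cf).1.
Qed.

End Inner.

(** * Weak derivatives: uniqueness, the chosen representative, integration by parts *)

Section WeakDerivative.
Context {R : realType}.
Local Notation leb := (@lebesgue_measure R).
Local Notation D := (@D R).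
Implicit Types f g v w : R -> R.

Lemma C1c_intro (phi dphi : R -> R) (a b : R) :
  (forall x : R, is_derive x (1 : R) phi (dphi x)) -> continuous dphi -> 0 < a -> b < 1 ->
  (forall x, x \notin `[a, b] -> phi x = 0) -> C1c_D phi /\ derive1 phi = dphi.
Proof.
move=> dp cd a0 b1 ab.
have E : derive1 phi = dphi by apply/funext => x; rewrite derive1E; have [] := dp x.
split => //; split; [by move=> x; have [] := dp x|by rewrite E|by exists a, b].
Qed.

Lemma C1c_continuous (phi : R -> R) : C1c_D phi -> continuous phi.
Proof. by move=> [dp _ _] x; apply/differentiable_continuous/derivable1_diffP. Qed.

Lemma C1c_L2D (phi : R -> R) : C1c_D phi -> L2D phi /\ L2D (derive1 phi).
Proof.
by move=> cp; split; apply: continuous_L2D; [exact: C1c_continuous|case: cp].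
Qed.

Lemma cutoff_mul_C1c (y dy : R -> R) (x : R) n : x <= 1 ->
  (forall t : R, is_derive t (1 : R) y (dy t)) -> continuous dy ->
  C1c_D (fun t => cutoff x n t * y t) /\
  derive1 (fun t => cutoff x n t * y t) = (fun t => dcutoff x n t * y t + cutoff x n t * dy t).
Proof.
move=> x1 hy cdy.
have n0 : (0 : R) < n.+1%:R^-1 by rewrite invr_gt0 ltr0n.
apply: (@C1c_intro _ _ (n.+1%:R^-1) (x - n.+1%:R^-1)) => //.
- move=> t; have d1 := is_derive_cutoff x n t; have d2 := hy t.
  by apply: is_derive_eq; rewrite /GRing.scale/=; ring.
- move=> t; apply: cvgD; apply: cvgM.
  + exact: continuous_dcutoff.
  + exact: is_derive_continuous hy t.
  + exact: is_derive_continuous (is_derive_cutoff x n) t.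
  + exact: cdy.
- by rewrite ltrBlDr ltr_pwDr.
- by move=> t; rewrite in_itv/= => tn; rewrite cutoff_out// mul0r.
Qed.

Lemma cvg_eventually_eq (u : nat -> R) (l : R) : (\forall n \near \oo, u n = l) -> u @ \oo --> l.
Proof. by move=> ul; apply: cvg_near_cst. Qed.

Lemma cutoff_C1c (x : R) n : x <= 1 -> C1c_D (cutoff x n).
Proof.
move=> x1; have [] := @cutoff_mul_C1c (fun=> 1) (fun=> 0) x n x1.
- by move=> t; exact: cvg_cst.
by move=> + _; congr C1c_D; apply/funext => t; rewrite mulr1.
Qed.

(** Fundamental lemma of the calculus of variations. Cutoffs converge boundedly to the indicator of
    []0, x[], so the primitive of [u] vanishes at every [x], and Lebesgue differentiation recovers
    [u] almost everywhere. *)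
Lemma ae_eq0_test (u : R -> R) : leb.-integrable D (EFin \o u) ->
  (forall phi, C1c_D phi -> inner u phi = 0) -> {ae leb, forall x, D x -> u x = 0}.
Proof.
move=> ui u0.
have mD := @measurable_D R.
pose v := u \_ D.
have vi : leb.-integrable setT (EFin \o v).
  by have := (@integrable_mkcond _ _ _ leb D (EFin \o u) mD).1 ui; rewrite /v restrict_EFin.
have mu : measurable_fun D u by case/integrableP : ui => /measurable_EFinP.
have key x : 0 < x <= 1 -> \int[leb]_(t in D) (u t * \1_`]0, x[ t) = 0.
  move=> /andP[x0 x1].
  have cv : \int[leb]_(t in D) (u t * cutoff x n t) @[n --> \oo] -->
      \int[leb]_(t in D) (u t * \1_`]0, x[ t).
    apply: (Rdominated_cvg mD (g := fun t => `|u t|)) => //.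
    - move=> n; apply: measurable_funM => //.
      exact: (continuous_L2D (C1c_continuous (cutoff_C1c n x1))).1.
    - by apply: measurable_funM => //; apply: measurable_funTS; exact: measurable_indic.
    - move=> t /DE/andP[t0 t1]; apply: cvgM; first exact: cvg_cst.
      apply: cvg_eventually_eq; rewrite indicE mem_setE in_itv/= t0/=.
      have [tx|tx] := ltP t x.
        by apply: filterS (@cutoff_in _ x t _) => [n []//|]; rewrite t0.
      apply: nearW => n; apply: cutoff_out; rewrite negb_and -!ltNge; apply/orP; right.
      by rewrite ltrBlDr ltr_pwDr// invr_gt0.
    - exact: integrable_norm.
    - move=> n t Dt; rewrite normrM ler_piMr//.
      by have /andP[c0 c1] := cutoff_bounds x n t; rewrite ger0_norm.
  have h : \int[leb]_(t in D) (u t * cutoff x n t) @[n --> \oo] --> (0 : R).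
    apply: cvg_eventually_eq; apply: nearW => n; exact: u0 (cutoff_C1c n x1).
  have e1 := cvg_lim (@Rhausdorff R) cv; have e2 := cvg_lim (@Rhausdorff R) h.
  by rewrite -e1 -[RHS]e2.
have F0 x : \int[leb]_(t in `]-oo, x]) v t = 0.
  have -> : \int[leb]_(t in `]-oo, x]) v t = \int[leb]_(t in D) (u t * \1_`]-oo, x] t).
    rewrite [LHS]Rintegral_mkcond [RHS]Rintegral_mkcond; apply: eq_Rintegral => t _.
    rewrite /v !patchE indicE; case: (t \in D); case: (t \in _); rewrite ?mulr1 ?mulr0//.
  have [x0|x0] := leP x 0.
    rewrite -[RHS](@Rintegral_set0 _ _ _ leb u) Rintegral_mkcond [RHS]Rintegral_mkcond.
    apply: eq_Rintegral => t _; rewrite !patchE in_set0 indicE.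
    case: ifPn => // /set_mem/DE/andP[t0 _].
    by rewrite memNset ?mulr0//= in_itv/= => /(lt_le_trans t0); rewrite ltNge x0.
  have [x1|x1] := leP x 1.
    rewrite -(key x) ?x0//; apply: Rintegral_ae_eq => //.
    - by apply: measurable_funM => //; apply: measurable_funTS; exact: measurable_indic.
    - by apply: measurable_funM => //; apply: measurable_funTS; exact: measurable_indic.
    exists [set x]; split => //; first exact: lebesgue_measure_set1.
    move=> t /=; apply: contra_notP => tx /DE/andP[t0 t1].
    rewrite !indicE !mem_setE !in_itv/= t0 le_eqVlt.
    by case: eqP.
  rewrite -(key 1) ?ltr01 ?lexx//; apply: eq_Rintegral => t /set_mem/DE/andP[t0 t1].
  by rewrite !indicE !mem_setE !in_itv/= t0 t1 (ltW (lt_trans t1 x1)).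
have vloc : locally_integrable setT v by exact: open_integrable_locally openT vi.
have vinti y : leb.-integrable `]-oo, y] (EFin \o v) by apply: integrableS vi.
apply: ae_mono (FTC1Ny vinti vloc) => x [_ dF] Dx.
have -> : u x = v x by rewrite /v patchE mem_set.
rewrite -dF (_ : (fun _ => _) = cst 0) ?derive1_cst//.
by apply/funext => y; exact: F0.
Qed.

(** Square integrability is bundled in because the integrals in [is_weak_derivative] could otherwise
    be default values. *)
Definition weak_derivable v w := [/\ L2D v, L2D w & is_weak_derivative v w].

Lemma weak_derivative_lin c v w v' w' : weak_derivable v w -> weak_derivable v' w' ->
  weak_derivable (fun x => c * v x + v' x) (fun x => c * w x + w' x).
Proof.
move=> [Lv Lw vw] [Lv' Lw' vw']; split; [exact: L2D_lin..|].
move=> phi cphi; have [Lp Ldp] := C1c_L2D cphi.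
by rewrite !inner_linear// vw// vw'//; ring.
Qed.

Lemma weak_derivative_unique v w v' w' : weak_derivable v w -> weak_derivable v' w' ->
  {ae leb, forall x, D x -> v x = v' x} -> {ae leb, forall x, D x -> w x = w' x}.
Proof.
move=> [Lv Lw vw] [Lv' Lw' vw'] vv'.
have Ld := L2D_lin (-1) Lw' Lw.
have := ae_eq0_test (L2D_integrable1 Ld).
move=> H; apply: ae_mono (H _) => [x /[apply]|phi cphi]; first by lra.
have [Lp Ldp] := C1c_L2D cphi.
rewrite inner_linear//; have := vw _ cphi; rewrite (inner_ae Lv Lv' Ldp vv') vw'//.
lra.
Qed.

Lemma weak_derivable_ae v w v' w' : weak_derivable v w -> L2D v' -> L2D w' ->
  {ae leb, forall x, D x -> v x = v' x} -> {ae leb, forall x, D x -> w x = w' x} ->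
  weak_derivable v' w'.
Proof.
move=> [Lv Lw vw] Lv' Lw' vv' ww'; split => // phi cphi.
have [Lp Ldp] := C1c_L2D cphi.
by rewrite -(inner_ae Lv Lv' Ldp vv') -(inner_ae Lw Lw' Lp ww') vw.
Qed.

(** [weakD] selects an unspecified admissible derivative; uniqueness ties it to any known one up to
    a null set. *)
Lemma weakDP v w : weak_derivable v w -> weak_derivable v (weakD v) /\
  {ae leb, forall x, D x -> weakD v x = w x}.
Proof.
move=> vw; have [Lv Lw dvw] := vw.
have [L1 d1] : [set w | L2D w /\ is_weak_derivative v w] (weakD v).
  by rewrite /weakD; apply: xgetPex; exists w.
have v1 : weak_derivable v (weakD v) by [].
by split => //; apply: (weak_derivative_unique v1 vw); apply: aeW.
Qed.

Lemma weakD_weak_derivable v w w' : weak_derivable v w -> weak_derivable w w' ->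
  weak_derivable (weakD v) w'.
Proof.
move=> vw ww'; have [[_ Ld _] E] := weakDP vw; have [_ Lw' _] := ww'.
apply: (weak_derivable_ae ww' Ld Lw'); last exact: aeW.
by apply: ae_mono E => x Ex Dx; rewrite Ex.
Qed.

Lemma Sobolev2P v : Sobolev 2 v <->
  weak_derivable v (weakD v) /\ weak_derivable (weakD v) (weakD (weakD v)).
Proof.
split=> [[Lv [w [vw [Lw [w' [ww' Lw']]]]]]|[[Lv Lw vw] [_ Lw' ww']]]; last first.
  by split => //; exists (weakD v); split => //; split => //; exists (weakD (weakD v)).
have [vd _] := weakDP (And3 Lv Lw vw).
split; first exact: vd.
exact: (weakDP (weakD_weak_derivable (And3 Lv Lw vw) (And3 Lw Lw' ww'))).1.
Qed.

Lemma weakD2_unique v w w' : weak_derivable v w -> weak_derivable w w' ->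
  {ae leb, forall x, D x -> weakD (weakD v) x = w' x}.
Proof.
move=> vw ww'; exact: (weakDP (weakD_weak_derivable vw ww')).2.
Qed.

Lemma smooth_weak_derivable (F f : R -> R) :
  (forall x : R, is_derive x (1 : R) F (f x)) -> continuous f -> weak_derivable F f.
Proof.
move=> dF cf; have cF := is_derive_continuous dF.
split; [exact: continuous_L2D..|] => phi cphi.
have [Lp Ldp] := C1c_L2D cphi; have [dphi cdphi [a [b [a0 b1 ab]]]] := cphi.
have dFp (x : R) : is_derive x (1 : R) (fun x => F x * phi x) (F x * derive1 phi x + f x * phi x).
  have d1 := dF x; have d2 : is_derive x (1 : R) phi (derive1 phi x).
    by rewrite derive1E; apply: derivableP.
  by apply: is_derive_eq; rewrite /GRing.scale/=; ring.
have := inner_FTC dFp.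
rewrite ab ?mulr0; last by rewrite in_itv/= negb_and -!ltNge b1 orbT.
rewrite ab ?mulr0; last by rewrite in_itv/= negb_and -!ltNge a0.
move=> H; have : inner F (derive1 phi) + inner f phi = 0.
  rewrite subrr in H; rewrite -H.
    rewrite -RintegralD //; [exact: measurable_D|exact: L2D_integrable (continuous_L2D cF) _|].
    exact: L2D_integrable (continuous_L2D cf) _.
  move=> x; apply: cvgD; apply: cvgM; [exact: cF|exact: cdphi|exact: cf|].
  exact: C1c_continuous.
lra.
Qed.

(* Integration by parts without a boundary term, by cutting off [y] near the
   end points. *)
Lemma weak_ibp v w (y dy b : R -> R) : weak_derivable v w ->
  (forall x : R, is_derive x (1 : R) y (dy x)) -> continuous dy ->
  leb.-integrable D (EFin \o b) ->
  (forall x, D x -> `|y x * v x| <= x * (1 - x) * b x) ->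
  inner y w = - inner dy v.
Proof.
move=> [Lv Lw vw] hy cdy ib yv; have cy := is_derive_continuous hy.
have Ly := continuous_L2D cy; have Ldy := continuous_L2D cdy.
have mD := @measurable_D R.
have mM f g : measurable_fun D f -> measurable_fun D g -> measurable_fun D (fun x => f x * g x).
  by move=> mf mg; exact: measurable_funM.
have [[mv _] [mw _] [my _] [mdy _]] := And4 Lv Lw Ly Ldy.
have mcut n : measurable_fun D (cutoff 1 n : R -> R).
  exact: (continuous_L2D (is_derive_continuous (is_derive_cutoff 1 n))).1.
have mdcut n : measurable_fun D (dcutoff 1 n : R -> R).
  exact: (continuous_L2D (@continuous_dcutoff R 1 n)).1.
have cut1 x : D x -> cutoff 1 n x @[n --> \oo] --> (1 : R).
  move=> /DE Dx; apply: cvg_eventually_eq.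
  by apply: filterS (cutoff_in Dx) => n [].
have Lcut n f : L2D f -> L2D (fun t => cutoff 1 n t * f t).
  move=> [mf If]; split; first exact: mM.
  apply: (le_integrable mD _ _ If).
    by apply/measurable_EFinP; apply: measurable_funX; exact: mM.
  move=> x _ /=; rewrite lee_fin !ger0_norm ?sqr_ge0// exprMn ler_piMl ?sqr_ge0//.
  by have /andP[c0 c1] := cutoff_bounds 1 n x; rewrite exprn_ile1.
have cutb n x : `|cutoff 1 n x| <= 1.
  by have /andP[c0 c1] := cutoff_bounds 1 n x; rewrite ger0_norm.
(* The boundary contribution tends to zero: [dcutoff] vanishes eventually at each interior point,
   and the decay [x * (1 - x) * b x] of the product absorbs its growth near the ends. *)
have H1 : \int[leb]_(x in D) (v x * (dcutoff 1 n x * y x)) @[n --> \oo] --> \int[leb]_(x in D) (0 : R).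
  apply: (Rdominated_cvg mD (g := fun x => 8 * `|b x|)) => //.
  - by move=> n; do 2 apply: (mM) => //.
  - move=> x Dx; apply: cvg_eventually_eq; move/DE : (Dx) => Dx'.
    by apply: filterS (cutoff_in Dx') => n [_ ->]; rewrite mul0r mulr0.
  - have := integrableZl mD 8 (integrable_norm ib).
    by apply: eq_integrable => // x _ /=; rewrite -EFinM.
  - move=> n x Dx; have /DE Dx' := Dx; have /andP[x0 x1] := Dx'.
    have x01 : 0 <= x * (1 - x) by rewrite mulr_ge0// ?subr_ge0 ltW.
    have db := dcutoff_bound n Dx'.
    rewrite mulrCA normrM [v x * y x]mulrC.
    apply: (@le_trans _ _ (`|dcutoff 1 n x| * (x * (1 - x) * `|b x|))).
      rewrite ler_wpM2l//; apply: (le_trans (yv x Dx)).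
      by rewrite ler_wpM2l// ler_norm.
    by rewrite mulrA ler_wpM2r.
have H2 : \int[leb]_(x in D) (v x * (cutoff 1 n x * dy x)) @[n --> \oo] --> \int[leb]_(x in D) (v x * (1 * dy x)).
  apply: (Rdominated_cvg mD (g := fun x => `|v x * dy x|)) => //.
  - by move=> n; do 2 apply: (mM) => //.
  - by do 2 apply: (mM) => //.
  - move=> x Dx; apply: cvgM; first exact: cvg_cst.
    by apply: cvgM; [exact: cut1|exact: cvg_cst].
  - by apply: integrable_norm; exact: L2D_integrable.
  - by move=> n x Dx /=; rewrite mulrCA normrM ler_piMl ?normr_ge0 ?cutb.
have H3 : \int[leb]_(x in D) (w x * (cutoff 1 n x * y x)) @[n --> \oo] --> \int[leb]_(x in D) (w x * (1 * y x)).
  apply: (Rdominated_cvg mD (g := fun x => `|w x * y x|)) => //.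
  - by move=> n; do 2 apply: (mM) => //.
  - by do 2 apply: (mM) => //.
  - move=> x Dx; apply: cvgM; first exact: cvg_cst.
    by apply: cvgM; [exact: cut1|exact: cvg_cst].
  - by apply: integrable_norm; exact: L2D_integrable.
  - by move=> n x Dx /=; rewrite mulrCA normrM ler_piMl ?normr_ge0 ?cutb.
have E n : \int[leb]_(x in D) (v x * (dcutoff 1 n x * y x)) +
    \int[leb]_(x in D) (v x * (cutoff 1 n x * dy x)) = - \int[leb]_(x in D) (w x * (cutoff 1 n x * y x)).
  have [cc dE] := @cutoff_mul_C1c y dy 1 n (lexx _) hy cdy.
  have := vw _ cc; rewrite dE => <-.
  rewrite -RintegralD//.
  - by apply: eq_Rintegral => x _; rewrite mulrDr.
  - apply: L2D_integrable => //; apply: continuous_L2D => x.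
    by apply: cvgM; [exact: continuous_dcutoff|exact: cy].
  - by apply: L2D_integrable => //; exact: Lcut.
have := cvgD H1 H2; rewrite (_ : (fun n => _) + _ = - (fun n => \int[leb]_(x in D) (w x * (cutoff 1 n x * y x)))); last first.
  by apply/funext => n; exact: E.
move=> L1; have L2 := cvgN H3.
have := cvg_unique (@Rhausdorff R) (L1 _) (L2 _).
rewrite (Rintegral_cst leb mD) mul0r add0r.
have -> : \int[leb]_(x in D) (v x * (1 * dy x)) = inner dy v by apply: eq_Rintegral => x _; ring.
have -> : \int[leb]_(x in D) (w x * (1 * y x)) = inner y w by apply: eq_Rintegral => x _; ring.
by move=> ->; rewrite opprK.
Qed.

End WeakDerivative.

(** * Classical derivatives, the zero boundary condition and Green's formula *)

Section Chain.
Context {R : realType}.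
Local Notation leb := (@lebesgue_measure R).
Local Notation D := (@D R).
Implicit Types f g v w : R -> R.

(** Listing the successive classical derivatives explicitly lets Sobolev membership and norms of
    smooth functions be read off from [W]. *)
Definition derivative_chain (l : nat) (W : nat -> R -> R) :=
  (forall j, (j < l)%N -> forall x : R, is_derive x (1 : R) (W j) (W j.+1 x)) /\ continuous (W l).

Lemma chain_continuous l W j : derivative_chain l W -> (j <= l)%N -> continuous (W j).
Proof.
move=> [dW cW]; rewrite leq_eqVlt => /predU1P[->//|jl].
exact: is_derive_continuous (dW _ jl).
Qed.

Lemma chain_weak l W j : derivative_chain l W -> (j < l)%N -> weak_derivable (W j) (W j.+1).
Proof.
move=> cW jl; apply: smooth_weak_derivable; first exact: cW.1.
exact: chain_continuous cW jl.
Qed.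

Lemma chain_shift l W : derivative_chain l.+1 W -> derivative_chain l (W \o succn).
Proof. by move=> [dW cW]; split=> // j jl; exact: dW. Qed.

Lemma chain_Sobolev l W : derivative_chain l W -> Sobolev l (W 0%N).
Proof.
elim: l W => [|l IH] W cW; first by apply: continuous_L2D; exact: cW.2.
have [L0 _ w01] := chain_weak cW (ltn0Sn l).
by split => //; exists (W 1%N); split => //; exact: IH (chain_shift cW).
Qed.

Lemma chain_iter l W j : derivative_chain l W -> (j <= l)%N ->
  L2D (iter j weakD (W 0%N)) /\ {ae leb, forall x, D x -> iter j weakD (W 0%N) x = W j x}.
Proof.
move=> cW; elim: j => [|j IH] jl.
  by split; [exact: continuous_L2D (chain_continuous cW jl)|exact: aeW].
have [Lj aej] := IH (ltnW jl); have wd := chain_weak cW jl; have [_ L1 _] := wd.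
have wd2 : weak_derivable (iter j weakD (W 0%N)) (W j.+1).
  apply: (weak_derivable_ae wd Lj L1); last exact: aeW.
  by apply: ae_mono aej => x H Dx; rewrite H.
by have [[_ L2 _] ae2] := weakDP wd2.
Qed.

Lemma chain_norm l W : derivative_chain l W ->
  Sobolev_norm l (W 0%N) = Num.sqrt (\sum_(j < l.+1) inner (W j) (W j)).
Proof.
move=> cW; congr Num.sqrt; apply: eq_bigr => j _.
have [Lj aej] := chain_iter cW (ltn_ord j : (j <= l)%N).
have LW := continuous_L2D (chain_continuous cW (ltn_ord j : (j <= l)%N)).
exact: inner_ae2.
Qed.

(** Quantitative substitute for a vanishing trace: stable under linear combinations and directly
    usable as a domination hypothesis in [weak_ibp]. *)
Definition boundary_zero f := exists K, forall x, D x -> `|f x| <= K * (x * (1 - x)).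

Lemma boundary_zero_lin c f g : boundary_zero f -> boundary_zero g ->
  boundary_zero (fun x => c * f x + g x).
Proof.
move=> [K hK] [K' hK']; exists (`|c| * K + K') => x Dx.
apply: (le_trans (ler_normD _ _)); rewrite mulrDl lerD ?hK'// normrM -mulrA.
by rewrite ler_wpM2l ?hK.
Qed.

Lemma mean_value_le (F f : R -> R) (B s t : R) : (forall x : R, is_derive x (1 : R) F (f x)) ->
  0 <= s <= 1 -> 0 <= t <= 1 -> (forall x, 0 <= x <= 1 -> `|f x| <= B) -> `|F t - F s| <= B * `|t - s|.
Proof.
move=> dF + + fB; wlog st : s t / s <= t.
  move=> H hs ht; have [st|/ltW ts] := leP s t; first exact: H.
  by rewrite distrC [X in B * X]distrC; exact: H.
move=> /andP[s0 s1] /andP[t0 t1].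
have [|c] := @MVT_segment R F f s t st (fun x _ => dF x).
  by apply: continuous_subspaceT => x; exact: is_derive_continuous.
rewrite in_itv/= => /andP[sc ct] ->; rewrite normrM ler_wpM2r// fB//.
by rewrite (le_trans s0 sc) (le_trans ct t1).
Qed.

Lemma bounded_of_zero (F f : R -> R) (B s : R) : (forall x : R, is_derive x (1 : R) F (f x)) ->
  (forall x, 0 <= x <= 1 -> `|f x| <= B) -> 0 <= s <= 1 -> F s = 0 ->
  forall x, 0 <= x <= 1 -> `|F x| <= B.
Proof.
move=> dF fB s01 Fs x x01; have := mean_value_le dF s01 x01 fB.
rewrite Fs subr0 => /le_trans; apply.
have B0 : 0 <= B by apply: le_trans (fB s s01).
rewrite ler_piMr// ler_norml; move: s01 x01 => /andP[? ?] /andP[? ?]; apply/andP; split; lra.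
Qed.

Lemma smooth_boundary_zero (F f : R -> R) : (forall x : R, is_derive x (1 : R) F (f x)) ->
  continuous f -> F 0 = 0 -> F 1 = 0 -> boundary_zero F.
Proof.
move=> dF cf F0 F1; have [B B0 fB] := continuous_bounded01 cf.
exists (2 * B) => x /DE/andP[x0 x1].
have x01 : 0 <= x <= 1 by rewrite !ltW.
have z01 : 0 <= (0 : R) <= 1 by apply/andP; split.
have o01 : 0 <= (1 : R) <= 1 by apply/andP; split.
have := mean_value_le dF z01 x01 fB; have := mean_value_le dF o01 x01 fB.
rewrite F0 F1 !subr0 [`|x - 1|]distrC (gtr0_norm x0) (@gtr0_norm _ (1 - x)) ?subr_gt0//.
have x1' : 0 <= 1 - x by rewrite subr_ge0 ltW.
move=> /(ler_wpM2l (ltW x0)) H1 /(ler_wpM2l x1') H2; lra.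
Qed.

(** Two integrations by parts. The first loses its boundary term because [W 0] vanishes linearly at
    the ends, the second because [f] does. *)
Lemma green_formula f W : Sobolev 2 f -> boundary_zero f ->
  derivative_chain 2 W -> W 0%N 0 = 0 -> W 0%N 1 = 0 ->
  inner (W 0%N) (weakD (weakD f)) = inner (W 2%N) f.
Proof.
move=> /Sobolev2P[f1 f2] [K fK] cW W0 W1.
have [B B0 hB] := continuous_bounded01 (chain_continuous cW (isT : (1 <= 2)%N)).
have [K' W0K] := smooth_boundary_zero (cW.1 0%N isT) (chain_continuous cW (isT : (1 <= 2)%N)) W0 W1.
have [_ Ld _] := f1; have mD := @measurable_D R.
rewrite (weak_ibp f2 (cW.1 0%N isT) (chain_continuous cW (isT : (1 <= 2)%N)) (b := fun x => K' * `|weakD f x|)).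
- rewrite (weak_ibp f1 (cW.1 1%N isT) (chain_continuous cW (isT : (2 <= 2)%N)) (b := fun x => B * K)) ?opprK//.
    exact: L2D_integrable1 (L2D_cst _).
  move=> x Dx; have /DE/andP[x0 x1] := Dx; rewrite normrM mulrCA.
  apply: ler_pM => //; first by apply: hB; rewrite !ltW.
  by rewrite mulrC fK.
- have := integrableZl mD K' (integrable_norm (L2D_integrable1 Ld)).
  by apply: eq_integrable => // x _ /=; rewrite -EFinM.
- move=> x Dx; rewrite normrM mulrA; apply: ler_pM => //.
  by rewrite mulrC W0K.
Qed.

End Chain.

(** * The eigenfunctions [eps] *)

Section Eps.
Context {R : realType}.
Local Notation leb := (@lebesgue_measure R).
Local Notation D := (@D R).

Lemma lambda_ge1 k : (0 < k)%N -> 1 <= @lambda R k.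
Proof.
move=> k0; rewrite /lambda; have := pi_ge2 R; have : (1 : R) <= k%:R by rewrite ler1n.
nra.
Qed.

Lemma lambda_gt0 k : (0 < k)%N -> 0 < @lambda R k.
Proof. by move=> /lambda_ge1; apply: lt_le_trans. Qed.

(** The [j]-th derivative of [eps k]; the phase shift by [j * pi / 2] treats sines and cosines
    uniformly. *)
Definition eps_chain (k j : nat) (z : R) : R :=
  Num.sqrt 2 * lambda k ^+ j * sin (lambda k * z + j%:R * (pi / 2)).

Lemma eps_chain0 k : eps_chain k 0%N = eps k.
Proof. by apply/funext => z; rewrite /eps_chain /eps mul0r addr0 expr0 mulr1. Qed.

Lemma eps_chainDD k j : eps_chain k j.+2 = (fun z => - lambda k ^+ 2 * eps_chain k j z).
Proof.
apply/funext => z; rewrite /eps_chain.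
have -> : lambda k * z + j.+2%:R * (pi / 2) = lambda k * z + j%:R * (pi / 2) + pi.
  by rewrite -addn2 natrD; field.
rewrite sinDpi/= !exprS expr0; ring.
Qed.

Lemma eps_chainP k l : derivative_chain l (eps_chain k).
Proof.
have dE j (x : R) : is_derive x (1 : R) (eps_chain k j) (eps_chain k j.+1 x).
  apply: is_derive_eq; rewrite /eps_chain /GRing.scale/= exprS.
  have -> : lambda k * x + j.+1%:R * (pi / 2) = lambda k * x + j%:R * (pi / 2) + pi / 2.
    by rewrite -natr1; ring.
  rewrite sinDpihalf; ring.
by split => [j _ x|]; [exact: dE|exact: is_derive_continuous (dE l)].
Qed.

Lemma eps_chain_bound k j z : `|eps_chain k j z| <= Num.sqrt 2 * lambda k ^+ j.
Proof.
rewrite /eps_chain normrM; have l0 : 0 <= lambda k :> R by rewrite mulr_ge0 ?pi_ge0.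
rewrite ger0_norm ?mulr_ge0 ?sqrtr_ge0 ?exprn_ge0//.
rewrite ler_piMr ?mulr_ge0 ?sqrtr_ge0 ?exprn_ge0//.
by rewrite ler_norml sin_geN1 sin_le1.
Qed.

Lemma continuous_eps k : continuous (@eps R k).
Proof. by rewrite -eps_chain0; exact: chain_continuous (eps_chainP k 0) _. Qed.

Lemma eps_bound k z : `|@eps R k z| <= Num.sqrt 2.
Proof. by rewrite -eps_chain0 (le_trans (eps_chain_bound _ _ _))// expr0 mulr1. Qed.

Lemma eps_at0 k : @eps R k 0 = 0.
Proof. by rewrite /eps mulr0 sin0 mulr0. Qed.

Lemma eps_at1 k : @eps R k 1 = 0.
Proof.
rewrite /eps mulr1 /lambda; suff -> : sin (k%:R * pi) = 0 :> R by rewrite mulr0.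
elim: k => [|k IH]; first by rewrite mul0r sin0.
by rewrite -natr1 mulrDl mul1r sinDpi/= IH oppr0.
Qed.

Lemma eps_boundary_zero k : boundary_zero (@eps R k).
Proof.
have := eps_chainP k 1 => -[dE _]; have dE0 := dE 0%N isT.
rewrite -eps_chain0; apply: (smooth_boundary_zero dE0).
- exact: chain_continuous (eps_chainP k 1) _.
- by rewrite eps_chain0 eps_at0.
- by rewrite eps_chain0 eps_at1.
Qed.

Lemma eps_Sobolev k l : Sobolev l (@eps R k).
Proof. by rewrite -eps_chain0; exact: chain_Sobolev (eps_chainP k l). Qed.

Lemma smooth_Sobolev10 (W : nat -> R -> R) : derivative_chain 1 W -> W 0%N 0 = 0 -> W 0%N 1 = 0 ->
  Sobolev10 (W 0%N).
Proof.
move=> cW W0 W1; split; first exact: chain_Sobolev.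
exists (W 0%N); split => //; last exact: aeW.
by apply: continuous_subspaceT => x; exact: chain_continuous cW _ x.
Qed.

Lemma eps_Sobolev10 k : Sobolev10 (@eps R k).
Proof.
rewrite -eps_chain0; apply: smooth_Sobolev10; first exact: eps_chainP.
- by rewrite eps_chain0 eps_at0.
- by rewrite eps_chain0 eps_at1.
Qed.

(** As [lambda k >= 1], each of the at most five terms is at most [2 * lambda k ^+ (2 * l)], and
    [10 <= 4 ^ 2]. *)
Lemma eps_norm k l : (0 < k)%N -> (l <= 4)%N -> Sobolev_norm l (@eps R k) <= 4 * lambda k ^+ l.
Proof.
move=> k0 l4; rewrite -eps_chain0 (chain_norm (eps_chainP k l)).
have l1 := lambda_ge1 k0.
have ll0 : 0 <= lambda k ^+ l :> R by rewrite exprn_ge0// (le_trans ler01).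
rewrite -(ler_pXn2r (ltn0Sn 1)) ?nnegrE ?sqrtr_ge0 ?(mulr_ge0 _ ll0)//.
rewrite sqr_sqrtr; last by apply: sumr_ge0 => j _; exact: inner_ge0.
apply: (@le_trans _ _ (\sum_(j < l.+1) 2 * (lambda k ^+ l) ^+ 2)).
  apply: ler_sum => j _.
  apply: (@le_trans _ _ ((Num.sqrt 2 * lambda k ^+ j) ^+ 2)).
    apply: inner_le.
    - exact: continuous_L2D (chain_continuous (eps_chainP k j) (leqnn j)).
    - by rewrite mulr_ge0 ?sqrtr_ge0 ?exprn_ge0 ?(le_trans ler01).
    - by move=> x _; exact: eps_chain_bound.
  rewrite exprMn sqr_sqrtr// ler_wpM2l// lerXn2r ?nnegrE ?exprn_ge0 ?(le_trans ler01)//.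
  by rewrite ler_weXn2l// -ltnS.
rewrite sumr_const card_ord -[_ *+ l.+1]mulr_natr [(4 * _) ^+ 2]exprMn mulrAC ler_wpM2r ?sqr_ge0//.
have : (l.+1%:R : R) <= 5 by rewrite ler_nat.
by rewrite expr2; lra.
Qed.

Lemma eps_L2D k : L2D (@eps R k).
Proof. apply: continuous_L2D. exact: continuous_eps. Qed.

Lemma innerZr (c : R) f g : L2D f -> L2D g -> inner f (fun x => c * g x) = c * inner f g.
Proof.
move=> Lf Lg; transitivity (\int[leb]_(x in D) (c * (f x * g x))).
  by apply: eq_Rintegral => x _; ring.
by apply: RintegralZl; [exact: measurable_D|exact: L2D_integrable].
Qed.

Lemma L2DZ (c : R) f : L2D f -> L2D (fun x => c * f x).
Proof.
move=> Lf; have := L2D_lin c Lf (L2D_cst 0).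
by congr L2D; apply/funext => x; rewrite addr0.
Qed.

Lemma eps_green k f : Sobolev 2 f -> boundary_zero f ->
  inner (@eps R k) (weakD (weakD f)) = - lambda k ^+ 2 * inner (eps k) f.
Proof.
move=> S2 b0; have := green_formula S2 b0 (eps_chainP k 2).
rewrite eps_chainDD eps_chain0 eps_at0 eps_at1 => -> //.
by rewrite inner_sym innerZr ?(inner_sym f)//; [case: S2|exact: eps_L2D].
Qed.

Lemma eps_weakD2 k : {ae leb, forall x, D x -> weakD (weakD (@eps R k)) x = - lambda k ^+ 2 * eps k x}.
Proof.
have w1 := chain_weak (eps_chainP k 2) (isT : (0 < 2)%N).
have w2 := chain_weak (eps_chainP k 2) (isT : (1 < 2)%N).
by have := weakD2_unique w1 w2; rewrite eps_chainDD eps_chain0.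
Qed.

Lemma Sobolev2_weakD2_L2D f : Sobolev 2 f -> L2D (weakD (weakD f : R -> R)).
Proof. by move=> /Sobolev2P[_ []]. Qed.

(** For [i != j], symmetry of the second derivative gives [(lambda i ^+ 2 - lambda j ^+ 2) * inner
    (eps i) (eps j) = 0]. For [i = j], integration by parts equates the integral of the squared
    derivative with [lambda i ^+ 2] times the squared norm. *)
Lemma eps_orthonormal i j : (0 < i)%N -> (0 < j)%N -> inner (@eps R i) (eps j) = (i == j)%:R.
Proof.
move=> i0 j0.
have := eps_green i (eps_Sobolev j 2) (eps_boundary_zero j).
rewrite (inner_sym (eps i)) (@inner_ae _ _ (fun x => - lambda j ^+ 2 * eps j x)).
- rewrite inner_sym innerZr; [|exact: eps_L2D..].
  have [<- _|ij] := eqVneq i j; last first.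
    move=> H; have lij : lambda i ^+ 2 - lambda j ^+ 2 != 0 :> R.
      have lne : lambda i != lambda j :> R.
        apply: contra_neq ij; rewrite /lambda => /(mulIf (lt0r_neq0 (pi_gt0 R))) /eqP.
        by rewrite eqr_nat => /eqP.
      by rewrite subr_eq0 eqrXn2// ltW// lambda_gt0.
    apply/eqP; rewrite -(mulrI_eq0 _ (mulfI lij)); apply/eqP; lra.
  have dE := (eps_chainP i 2).1.
  have w2 := chain_weak (eps_chainP i 2) (isT : (1 < 2)%N).
  have l0 := @lambda_gt0 i i0.
  have [K epsK] := eps_boundary_zero i.
  have L1 := continuous_L2D (chain_continuous (eps_chainP i 2) (isT : (1 <= 2)%N)).
  have ib : leb.-integrable D (EFin \o (fun x => K * `|eps_chain i 1 x|)).
    have := integrableZl (@measurable_D R) K (integrable_norm (L2D_integrable1 L1)).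
    by apply: eq_integrable => [|x _ /=]; [exact: measurable_D|rewrite -EFinM].
  have bnd x : D x -> `|eps_chain i 0 x * eps_chain i 1 x| <= x * (1 - x) * (K * `|eps_chain i 1 x|).
    move=> Dx; rewrite normrM mulrA; apply: ler_pM => //.
    by rewrite mulrC eps_chain0 epsK.
  have := weak_ibp w2 (dE 0%N isT) (chain_continuous (eps_chainP i 2) (isT : (1 <= 2)%N)) ib bnd.
  rewrite eps_chainDD eps_chain0 => H.
  rewrite innerZr in H; [|exact: eps_L2D..].
  (* The integrand is constant by [cos^2 + sin^2 = 1], and its two parts have equal integrals, so
     each is half of [2 * lambda i ^+ 2]. *)
  have : \int[leb]_(x in D) (lambda i ^+ 2 * (eps i x * eps i x) + eps_chain i 1 x * eps_chain i 1 x)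
      = \int[leb]_(x in D) (2 * lambda i ^+ 2).
    apply: eq_Rintegral => x _; rewrite /eps_chain /eps mul1r sinDpihalf expr1.
    transitivity (lambda i ^+ 2 * (Num.sqrt 2 ^+ 2) * (cos (lambda i * x) ^+ 2 + sin (lambda i * x) ^+ 2)).
      by ring.
    by rewrite cos2Dsin2 sqr_sqrtr// mulr1 mulrC.
  rewrite (Rintegral_lin (@measurable_D R)); [|exact: L2D_integrable (eps_L2D i) (eps_L2D i)|exact: L2D_integrable].
  rewrite (Rintegral_cst leb (@measurable_D R)) [X in fine X](@leb_D R) mulr1 => H2.
  have {}H2 : lambda i ^+ 2 * inner (@eps R i) (eps i) = lambda i ^+ 2 * 1.
    by move: H H2; rewrite /inner; lra.
  by apply: mulfI H2; rewrite expf_neq0// gt_eqF.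
- exact: Sobolev2_weakD2_L2D (eps_Sobolev _ _).
- exact: L2DZ (eps_L2D _).
- exact: eps_L2D.
- exact: eps_weakD2.
Qed.

End Eps.

(** * Classical solution of the dual problem *)

Section Dual.
Context {R : realType}.
Local Notation leb := (@lebesgue_measure R).
Local Notation D := (@D R).
Implicit Types f g v w : R -> R.

(** Vanishing left of [-2] makes the integral from minus infinity finite and is inherited by the
    primitive, so the construction can be iterated and differentiability holds on the whole line. *)
Lemma primitive_exists f : continuous f -> (forall x, x <= -2 -> f x = 0) ->
  exists2 F : R -> R, (forall x : R, is_derive x (1 : R) F (f x)) & forall x, x <= -2 -> F x = 0.
Proof.
move=> cf f0; exists (fun x => \int[leb]_(t in `]-oo, x]) f t).
  move=> x; have fi : leb.-integrable `]-oo, (x + 1)] (EFin \o f).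
    apply/(@integrable_mkcond _ _ _ leb `]-oo, (x + 1)] (EFin \o f) (measurable_itv _)).
    have -> : (EFin \o f) \_ `]-oo, (x + 1)] = (EFin \o f) \_ `[(-2), (x + 1)].
      apply/funext => t; rewrite !patchE !mem_setE !in_itv/=.
      have [t2|t2] := leP t (-2); last by rewrite (ltW t2).
      by case: ifP => _; case: ifP => _ //=; rewrite f0.
    apply/(@integrable_mkcond _ _ _ leb `[(-2), (x + 1)] (EFin \o f) (measurable_itv _)).
    apply: continuous_compact_integrable; first exact: segment_compact.
    by apply: continuous_subspaceT => t; exact: cf.
  have ay : (-oo%O < BRight x)%E by rewrite ltNyr.
  have xu : x < x + 1 by rewrite ltrDl.
  have [dF EF] := @continuous_FTC1 R f -oo%O x (x + 1) xu fi ay (cf x).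
  by split; [exact: dF|rewrite -derive1E; exact: EF].
move=> x x2; transitivity (\int[leb]_(t in `]-oo, x]) (0 : R)).
  apply: eq_Rintegral => t /set_mem /=; rewrite in_itv/= => tx.
  by rewrite f0// (le_trans tx).
by rewrite (Rintegral_cst leb (measurable_itv _)) mul0r.
Qed.

(** Compose [g] with the projection onto [[0, 1]], then multiply by [step (x + 2)], which is [1]
    from [-1] on and [0] up to [-2]. *)
Lemma extend01 g : {within `[0, 1], continuous g} ->
  exists e : R -> R, [/\ continuous e, forall x, 0 <= x <= 1 -> e x = g x & forall x, x <= -2 -> e x = 0].
Proof.
move=> cg; pose clamp (x : R) := pos x - pos (x - 1).
have clamp01 x : 0 <= clamp x <= 1.
  rewrite /clamp; apply/andP.
  by case: (posE x) => [][? ->]; case: (posE (x - 1)) => [][? ->]; split; lra.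
have cclamp : continuous clamp.
  move=> x; have c : {for x, continuous (fun z : R => pos (z - 1))}.
    apply: continuous_comp; last exact: continuous_pos.
    by apply: cvgB; [exact: cvg_id|exact: cvg_cst].
  by apply: cvgB; [exact: continuous_pos|exact: c].
exists (fun x => step (x + 2) * g (clamp x)); split.
- move=> x; have c : {for x, continuous (fun z : R => step (z + 2))}.
    apply: continuous_comp; last exact: is_derive_continuous is_derive_step _.
    by apply: cvgD; [exact: cvg_id|exact: cvg_cst].
  apply: cvgM; first exact: c.
  have /subspace_continuousP/(_ (clamp x)) := cg.
  rewrite /= in_itv/= clamp01 => /(_ isT) gx.
  apply: cvg_trans gx => P /=; rewrite /= !nbhs_simpl /within/= => nP.
  have := cclamp x _ nP; rewrite nbhs_simpl/=.
  by apply: filterS => y /=; rewrite in_itv/= clamp01; apply.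
- move=> x /andP[x0 x1]; rewrite (step_ge1 _).1; last by lra.
  rewrite mul1r; congr g; rewrite /clamp.
  by case: (posE x) => [][? ->]; case: (posE (x - 1)) => [][? ->]; lra.
- by move=> x x2; rewrite (step_le0 _).1 ?mul0r//; lra.
Qed.

Lemma is_derive_le_increment (F f G g : R -> R) (s t : R) : s <= t ->
  (forall x : R, is_derive x (1 : R) F (f x)) -> (forall x : R, is_derive x (1 : R) G (g x)) ->
  (forall x, `|f x| <= g x) -> `|F t - F s| <= G t - G s.
Proof.
move=> st dF dG fg.
have key (H k : R -> R) : (forall x : R, is_derive x (1 : R) H (k x)) -> (forall x, 0 <= k x) ->
    H s <= H t.
  move=> dH k0; have [|c _ E] := @MVT_segment R H k s t st (fun x _ => dH x).
    by apply: continuous_subspaceT => x; exact: is_derive_continuous.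
  by rewrite -subr_ge0 E mulr_ge0// subr_ge0.
have h x := fg x; rewrite ler_norml; apply/andP; split.
- have : G s + F s <= G t + F t; last by lra.
  apply: (key (fun x => G x + F x) (fun x => g x + f x)) => x.
  by have := h x; rewrite ler_norml => /andP[]; lra.
- have : G s - F s <= G t - F t; last by lra.
  apply: (key (fun x => G x - F x) (fun x => g x - f x)) => x.
  by have := h x; rewrite ler_norml => /andP[]; lra.
Qed.

(** [D] has measure one, so this is the nonnegativity of the variance of [|e|]. *)
Lemma cauchy_schwarz1 e : L2D e -> (\int[leb]_(x in D) `|e x|) ^+ 2 <= inner e e.
Proof.
move=> Le; have Lae : L2D (fun x => `|e x|).
  case: Le => me ie; split; first exact: measurableT_comp.
  by move: ie; apply: eq_integrable => [|x _]; [exact: measurable_D|rewrite real_normK ?num_real].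
set c := \int[leb]_(x in D) `|e x|.
have := inner_ge0 (fun x => (- c) * 1 + `|e x|).
have L1 := @L2D_cst R 1.
rewrite inner_linear//; last exact: L2D_lin.
rewrite !inner_linear_r// (inner_sym (fun=> 1) (fun x => `|e x|)).
have -> : inner (fun x => `|e x|) (fun=> 1) = c by apply: eq_Rintegral => x _; rewrite mulr1.
have -> : inner (fun=> 1 : R) (fun=> 1) = 1.
  by rewrite /inner mulr1 (Rintegral_cst leb (@measurable_D R)) [X in fine X](@leb_D R) mulr1.
have -> : inner (fun x => `|e x|) (fun x => `|e x|) = inner e e.
  by apply: eq_Rintegral => x _; rewrite -expr2 real_normK ?num_real// expr2.
lra.
Qed.

(** Four primitives of [e], corrected by a cubic polynomial, solve [w'''' = e] with [w = w'' = 0] at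
    the ends. All lower derivatives are bounded pointwise by the integral of [|e|], hence by the
    [L^2] norm of [e]. *)
Lemma dual_solution (e : R -> R) : continuous e -> (forall x, x <= -2 -> e x = 0) ->
  exists W : nat -> R -> R, [/\ derivative_chain 4 W, W 4%N = e,
    W 0%N 0 = 0 /\ W 0%N 1 = 0, W 2%N 0 = 0 /\ W 2%N 1 = 0
    & forall j, (j <= 4)%N -> inner (W j) (W j) <= inner e e].
Proof.
move=> ce e0.
have [P1 dP1 P10] := primitive_exists ce e0.
have [P2 dP2 P20] := primitive_exists (is_derive_continuous dP1) P10.
have [P3 dP3 P30] := primitive_exists (is_derive_continuous dP2) P20.
have [P4 dP4 _] := primitive_exists (is_derive_continuous dP3) P30.
(* [c2], [c3] make the second derivative vanish at both ends; [c0], [c1] below then do the same for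
   the function itself. *)
pose c2 := - P2 0; pose c3 := P2 0 - P2 1.
pose V1 x := P3 x + (c3 * x ^+ 2 / 2 + c2 * x).
pose V0 x := P4 x + (c3 * x ^+ 3 / 6 + c2 * x ^+ 2 / 2).
pose c0 := - V0 0; pose c1 := V0 0 - V0 1.
pose W (j : nat) : R -> R := match j with
  | 0%N => fun x => V0 x + (c1 * x + c0)
  | 1%N => fun x => V1 x + c1
  | 2%N => fun x => P2 x + (c3 * x + c2)
  | 3%N => fun x => P1 x + c3
  | _ => e end.
have d3 (x : R) : is_derive x (1 : R) (W 3%N) (e x).
  by have := dP1 x => d; apply: is_derive_eq; rewrite addr0.
have d2 (x : R) : is_derive x (1 : R) (W 2%N) (W 3%N x).
  by have := dP2 x => d; apply: is_derive_eq; rewrite /W /GRing.scale/=; ring.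
have d1 (x : R) : is_derive x (1 : R) (W 1%N) (W 2%N x).
  by have := dP3 x => d; apply: is_derive_eq; rewrite /W /GRing.scale/=; field.
have d0 (x : R) : is_derive x (1 : R) (W 0%N) (W 1%N x).
  by have := dP4 x => d; apply: is_derive_eq; rewrite /W /V1 /GRing.scale/=; field.
have W00 : W 0%N 0 = 0 by rewrite /W /c0; ring.
have W01 : W 0%N 1 = 0 by rewrite /W /c0 /c1; ring.
have W20 : W 2%N 0 = 0 by rewrite /W /c2; ring.
have W21 : W 2%N 1 = 0 by rewrite /W /c2 /c3; ring.
have chW : derivative_chain 4 W.
  by split; [move=> [|[|[|[|//]]]] _|].
exists W; split => //.
have cabs : continuous (fun x => `|e x|).
  by move=> x; apply: continuous_comp; [exact: ce|exact: norm_continuous].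
have [A dA _] := @primitive_exists (fun x => `|e x|) cabs (fun x x2 => etrans (congr1 _ (e0 x x2)) (normr0 _)).
have Ai : \int[leb]_(x in D) `|e x| = A 1 - A 0 by exact: inner_FTC.
set I := A 1 - A 0 in Ai.
have I2 : I ^+ 2 <= inner e e by rewrite -Ai; exact: cauchy_schwarz1 (continuous_L2D ce).
have I0 : 0 <= I by rewrite -Ai; apply: Rintegral_ge0.
have monoA s t : s <= t -> A s <= A t.
  move=> st; rewrite -subr_ge0; apply: (le_trans (normr_ge0 (A t - A s))).
  by apply: (is_derive_le_increment st dA dA) => x; rewrite normr_id.
have incr (s t : R) : 0 <= s <= 1 -> 0 <= t <= 1 -> `|W 3%N t - W 3%N s| <= I.
  wlog st : s t / s <= t.
    move=> H hs ht; have [st|/ltW ts] := leP s t; first exact: H.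
    by rewrite distrC; exact: H.
  move=> /andP[s0 s1] /andP[t0 t1].
  have := is_derive_le_increment st d3 dA (fun x => lexx `|e x|).
  by move=> /le_trans; apply; have := monoA _ _ s0; have := monoA _ _ t1; rewrite /I; lra.
have z01 : 0 <= (0 : R) <= 1 by apply/andP; split.
have rolle (F f : R -> R) : (forall x : R, is_derive x (1 : R) F (f x)) -> F 0 = 0 -> F 1 = 0 ->
    exists2 s, 0 <= s <= 1 & f s = 0.
  move=> dF F0 F1; have [|c] := @MVT_segment R F f 0 1 ler01 (fun x _ => dF x).
    by apply: continuous_subspaceT => x; exact: is_derive_continuous.
  by rewrite in_itv/= F0 F1 subrr subr0 mulr1 => c01 fc; exists c.
(* Each of [W 3], [W 2], [W 1], [W 0] has a zero in [[0, 1]], by Rolle or by a boundary condition,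
   so the bound [I] passes down the chain without growing. *)
have [s3 s3i W3s] := rolle _ _ d2 W20 W21.
have b3 x : 0 <= x <= 1 -> `|W 3%N x| <= I.
  by move=> x01; have := incr _ _ s3i x01; rewrite W3s subr0.
have b2 := bounded_of_zero d2 b3 z01 W20.
have [s1 s1i W1s] := rolle _ _ d0 W00 W01.
have b1 := bounded_of_zero d1 b2 s1i W1s.
have b0 := bounded_of_zero d0 b1 z01 W00.
have le_of_bound j : (j <= 4)%N -> (forall x, 0 <= x <= 1 -> `|W j x| <= I) -> inner (W j) (W j) <= inner e e.
  move=> j4 bj; apply: le_trans I2; apply: inner_le => //.
    exact: continuous_L2D (chain_continuous chW j4).
  by move=> x /DE/andP[x0 x1]; apply: bj; rewrite !ltW.
move=> [|[|[|[|[|//]]]]] j4; [exact: le_of_bound..|exact: lexx].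
Qed.

End Dual.

(** * Finite element spaces *)

Section Partition.
Context {R : realType}.
Variables (J : nat) (x : nat -> R).
Hypotheses (x0 : x 0%N = 0) (xJ : x J = 1) (xlt : forall j, (j < J)%N -> x j < x j.+1).

Lemma partition_gt0 : (0 < J)%N.
Proof.
by case: J x0 xJ => // -> /esym/eqP; rewrite oner_eq0.
Qed.

Lemma partition_le i j : (i <= j <= J)%N -> x i <= x j.
Proof.
move=> /andP[]; elim: j => [|j IH]; first by rewrite leqn0 => /eqP->.
rewrite leq_eqVlt => /predU1P[->//|ij] jJ.
by apply: (le_trans (IH ij (ltnW jJ))); exact/ltW/xlt.
Qed.

Lemma partition_cover t : 0 <= t <= 1 -> exists2 j, (j < J)%N & x j <= t <= x j.+1.
Proof.
move=> /andP[t0 t1].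
suff H j : (j <= J)%N -> t <= x j -> (0 < j)%N -> exists2 i, (i < J)%N & x i <= t <= x i.+1.
  by apply: (H J) => //; [rewrite xJ|exact: partition_gt0].
elim: j => [//|j IH] jJ tj _.
have [xt|tx] := leP (x j) t; first by exists j => //; rewrite xt.
case: j => [|j] in IH jJ tj tx *; first by move: tx; rewrite x0 ltNge t0.
by apply: IH => //; [exact: ltnW|exact: ltW].
Qed.

Lemma partition_mesh : 0 < \big[Num.max/0]_(j < J) (x j.+1 - x j) <= 1.
Proof.
have J0 := partition_gt0; apply/andP; split.
  have h0 : 0 < x 1%N - x 0%N by rewrite subr_gt0 xlt.
  apply: (lt_le_trans h0).
  exact: (@le_bigmax _ _ _ 0 (fun j : 'I_J => x j.+1 - x j) (Ordinal J0)).
apply/bigmax_leP; split => // j _.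
have h1 : x j.+1 <= 1 by rewrite -xJ partition_le// ltn_ord leqnn.
have h2 : 0 <= x j by rewrite -x0 partition_le//= ltnW.
lra.
Qed.

End Partition.

Section FESpace.
Context {R : realType}.
Local Notation leb := (@lebesgue_measure R).
Local Notation D := (@D R).
Implicit Types f g v w : R -> R.

Lemma ae_witness (P : R -> Prop) (a b : R) : {ae leb, forall x, P x} -> a < b ->
  exists2 t, a < t < b & P t.
Proof.
move=> [N [mN N0 PN]] ab; apply: contrapT => nt.
have : (leb `]a, b[ <= leb N)%E.
  have mab : measurable (`]a, b[ : set (measurableTypeR R)) by exact: measurable_itv.
  apply: le_measure; rewrite ?inE//.
  move=> t /=; rewrite in_itv/= => tab; apply: PN => /= Pt.
  by apply: nt; exists t.
by rewrite N0 lebesgue_measure_itv/= lte_fin ab -EFinD lee_fin subr_le0 leNgt ab.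
Qed.

Lemma polynomial_bounded (q : {poly R}) : exists2 B, 0 <= B & forall t, 0 <= t <= 1 -> `|q.[t]| <= B.
Proof. by apply: continuous_bounded01; exact: continuous_horner. Qed.

Lemma polynomial_at_zero (q : {poly R}) (c : R) : q.[c] = 0 ->
  exists2 B, 0 <= B & forall t, 0 <= t <= 1 -> `|q.[t]| <= B * `|t - c|.
Proof.
move/eqP/factor_theorem => [r ->]; have [B B0 rB] := polynomial_bounded r.
exists B => // t t01; rewrite hornerM hornerXsubC normrM.
by rewrite ler_wpM2r// rB.
Qed.

(** Both functions are continuous and agree at points arbitrarily close to the end point [c], since
    an interval is not a null set. *)
Lemma polynomial_trace (q : {poly R}) g (c a b : R) : {within `[0, 1], continuous g} ->
  0 <= a -> b <= 1 -> a < b -> c = a \/ c = b ->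
  {ae leb, forall t, a < t < b -> q.[t] = g t} -> q.[c] = g c.
Proof.
move=> cg a0 b1 ab cab qg.
have c01 : c \in `[(0 : R), 1] by rewrite in_itv/=; case: cab => ->; apply/andP; split; lra.
apply/eqP; rewrite -subr_eq0 -normr_eq0; apply/eqP/le_anti; rewrite normr_ge0 andbT.
apply/ler_addgt0Pr => e e0; rewrite add0r.
have e20 : 0 < e / 2 by rewrite divr_gt0.
have /subspace_continuousP/(_ c c01)/cvgrPdist_lt/(_ _ e20) := cg.
rewrite near_withinE => -[d1 /= d10 H1].
have /cvgrPdist_lt/(_ _ e20) : q.[t] @[t --> c] --> q.[c] by exact: continuous_horner.
move=> -[d2 /= d20 H2].
pose d := Num.min (Num.min d1 d2) (b - a).
have dd1 : d <= d1 by rewrite /d !ge_min lexx.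
have dd2 : d <= d2 by rewrite /d !ge_min lexx orbT.
have dba : d <= b - a by rewrite /d !ge_min lexx orbT.
have d0 : 0 < d by rewrite /d !lt_min d10 d20 subr_gt0.
have [t [tab tc]] : exists t, (a < t < b /\ `|c - t| < d) /\ (a < t < b -> q.[t] = g t).
  case: cab => ->.
    have ad : a < a + d by lra.
    have [t /andP[at1 t1] qt] := ae_witness qg ad.
    exists t; split => //; split; first by apply/andP; split; lra.
    by rewrite ltr_norml; apply/andP; split; lra.
  have ad : b - d < b by lra.
  have [t /andP[at1 t1] qt] := ae_witness qg ad.
  exists t; split => //; split; first by apply/andP; split; lra.
  by rewrite ltr_norml; apply/andP; split; lra.
case: tab => tab ctd; have qgt := tc tab; move/andP: tab => [ta tb].
have t01 : t \in `[(0 : R), 1] by rewrite in_itv/=; apply/andP; split; lra.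
have h1 := H1 t (lt_le_trans ctd dd1) t01.
have h2 := H2 t (lt_le_trans ctd dd2).
have -> : q.[c] - g c = (q.[c] - q.[t]) - (g c - g t) by rewrite qgt; ring.
apply: (le_trans (ler_normB _ _)); lra.
Qed.

Section Facts.
Variables (p : nat) (h : R) (S : set (R -> R)).
Hypothesis feS : fe_space p h S.

Lemma fe_mesh : 0 < h <= 1.
Proof.
case: feS => _ _ _ [J [x [x0 xJ xlt -> _]]].
exact: partition_mesh.
Qed.

(** The first and last polynomial pieces have a root at the end point by the trace condition, hence
    are linearly small there. Elsewhere [f] is bounded and the distance to that end is at least the
    length of the end piece. *)
Lemma fe_boundary_zero f : S f -> boundary_zero f.
Proof.
move=> Sf; case: feS => _ _ reg [J [x [x0 xJ xlt _ /(_ f Sf) pol]]].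
have [_ [_ [g [cg fg g0 g1]]]] := reg f Sf.
have J0 := partition_gt0 x0 xJ.
have le01 j : (j < J)%N -> 0 <= x j /\ x j.+1 <= 1.
  move=> jJ; split; first by rewrite -x0 (partition_le xlt)//= ltnW.
  by rewrite -xJ (partition_le xlt)// jJ leqnn.
have aeq j q : (j < J)%N -> (forall y, y \in `[x j, x j.+1] -> f y = q.[y]) ->
    {ae leb, forall t, x j < t < x j.+1 -> q.[t] = g t}.
  move=> jJ fq; have [xj0 xj1] := le01 j jJ; apply: ae_mono fg => t ft /andP[t0 t1].
  rewrite -ft; last by apply/DE/andP; split; lra.
  by rewrite fq// in_itv/= !ltW.
have [B B0 fB] : exists2 B, 0 <= B & forall t, 0 <= t <= 1 -> `|f t| <= B.
  have : forall n, (n <= J)%N -> exists2 B, 0 <= B & forall t, 0 <= t <= 1 ->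
      forall j, (j < n)%N -> x j <= t <= x j.+1 -> `|f t| <= B.
    elim=> [|n IH] nJ; first by exists 0.
    have [B B0 HB] := IH (ltnW nJ); have [q _ fq] := pol n nJ.
    have [B' B'0 qB] := polynomial_bounded q.
    exists (B + B'); first exact: addr_ge0.
    move=> t t01 j; rewrite ltnS leq_eqVlt => /predU1P[->|jn] tj.
      by rewrite fq ?in_itv//= (le_trans (qB t t01))// lerDr.
    by rewrite (le_trans (HB t t01 j jn tj))// lerDl.
  move=> /(_ J (leqnn J))[B B0 HB]; exists B => // t t01.
  have [j jJ tj] := partition_cover x0 xJ t01; exact: HB t01 j jJ tj.
have [q0 _ fq0] := pol 0%N J0; have [_ x1] := le01 0%N J0; have x1p := xlt 0%N J0.
have q00 : q0.[x 0%N] = g (x 0%N).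
  apply: (@polynomial_trace q0 g (x 0%N) (x 0%N) (x 1%N) cg) => //.
  - by rewrite x0.
  - by left.
  - exact: aeq.
rewrite x0 g0 in q00.
have [L L0 q0L] := polynomial_at_zero q00.
have J1 : (J.-1 < J)%N by rewrite prednK.
have [q1 _ fq1] := pol J.-1 J1; have [xJ1 _] := le01 J.-1 J1; have xJp := xlt J.-1 J1.
have q11 : q1.[x J] = g (x J).
  apply: (@polynomial_trace q1 g (x J) (x J.-1) (x J) cg) => //.
  - by rewrite xJ.
  - by move: xJp; rewrite prednK.
  - by right.
  - by have := aeq J.-1 q1 J1 fq1; rewrite prednK.
rewrite xJ g1 in q11; rewrite prednK// xJ in fq1 xJp.
have [L' L'0 q1L] := polynomial_at_zero q11.
rewrite x0 in x1p.
have K1 t : D t -> `|f t| <= (L + B / x 1%N) * t.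
  move=> /DE/andP[t0 t1]; have t01 : 0 <= t <= 1 by rewrite !ltW.
  have Bx : 0 <= B / x 1%N by rewrite divr_ge0 ?(ltW x1p).
  have [tx|xt] := leP t (x 1%N).
    rewrite fq0 ?in_itv/= ?x0 ?(ltW t0)//; apply: (le_trans (q0L t t01)).
    by rewrite subr0 gtr0_norm// ler_wpM2r ?(ltW t0)// lerDl.
  apply: (le_trans (fB t t01)); rewrite mulrDl -[leLHS]add0r lerD ?mulr_ge0 ?(ltW t0)//.
  by rewrite mulrAC ler_pdivlMr// ler_wpM2l// ltW.
have K2 t : D t -> `|f t| <= (L' + B / (1 - x J.-1)) * (1 - t).
  move=> /DE/andP[t0 t1]; have t01 : 0 <= t <= 1 by rewrite !ltW.
  have xJ0 : 0 < 1 - x J.-1 by rewrite subr_gt0.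
  have t1' : 0 <= 1 - t by rewrite subr_ge0 ltW.
  have Bx : 0 <= B / (1 - x J.-1) by rewrite divr_ge0 ?(ltW xJ0).
  have [tx|xt] := leP (x J.-1) t.
    rewrite fq1 ?in_itv/= ?tx ?(ltW t1)//; apply: (le_trans (q1L t t01)).
    by rewrite distrC (ger0_norm t1') ler_wpM2r// lerDl.
  apply: (le_trans (fB t t01)); rewrite mulrDl -[leLHS]add0r lerD ?mulr_ge0//.
  rewrite mulrAC ler_pdivlMr// ler_wpM2l//; lra.
(* Write [|f t| = (1 - t) * |f t| + t * |f t|] and use the bound in [t] for the first part, the
   bound in [1 - t] for the second. *)
exists ((L + B / x 1%N) + (L' + B / (1 - x J.-1))) => t Dt.
have := K1 t Dt; have := K2 t Dt; have /DE/andP[t0 t1] := Dt.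
have t1' : 0 <= 1 - t by rewrite subr_ge0 ltW.
by move=> /(ler_wpM2l (ltW t0)) H1 /(ler_wpM2l t1') H2; lra.
Qed.

(** A function in [S] is determined on [[0, 1]] by [p.+1] coefficients on each of [J] pieces, so a
    larger family has a coefficient matrix with a nonzero left kernel. *)
Lemma fe_dependent : exists N : nat, forall f : 'I_N.+1 -> R -> R, (forall i, S (f i)) ->
  exists2 c : 'I_N.+1 -> R, exists i, c i != 0 & forall t, 0 <= t <= 1 -> \sum_i c i * f i t = 0.
Proof.
case: feS => _ _ _ [J [x [x0 xJ xlt _ pol]]].
exists (J * p.+1)%N => f Sf.
have /choice[q qP] (ij : 'I_(J * p.+1).+1 * 'I_J) : exists q : {poly R}, (size q <= p.+1)%N /\
    forall y, y \in `[x ij.2, x ij.2.+1] -> f ij.1 y = q.[y].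
  by have [q sq fq] := pol _ (Sf ij.1) ij.2 (ltn_ord _); exists q.
(* Column [l] holds the coefficient of degree [l %% p.+1] on piece [l %/ p.+1]; the inner sum has a
   single term and only converts that quotient to an ordinal. *)
pose A := \matrix_(i < (J * p.+1).+1, l < J * p.+1) \sum_(j < J | j == (l %/ p.+1)%N :> nat) (q (i, j))`_(l %% p.+1)%N.
have kA : kermx A != 0.
  rewrite kermx_eq0; apply/negP => /eqP rA.
  by have := rank_leq_col A; rewrite rA ltnn.
have [i0 v0] : exists i, row i (kermx A) != 0.
  apply: contrapT => nv; move/negP: kA; apply; apply/eqP/row_matrixP => i.
  by rewrite row0; apply/eqP/negPn/negP => ri; apply: nv; exists i.
pose v := row i0 (kermx A).
have vA : v *m A = 0 by rewrite /v -row_mul mulmx_ker row0.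
exists (fun i => v 0 i).
  apply: contrapT => nv; move/negP: v0; apply; apply/eqP/rowP => i.
  by rewrite [RHS]mxE; apply/eqP/negPn/negP => vi; apply: nv; exists i.
move=> t t01; have [j jJ tj] := partition_cover x0 xJ t01.
have -> : \sum_i v 0 i * f i t = (\sum_i v 0 i *: q (i, Ordinal jJ)).[t].
  rewrite horner_sum; apply: eq_bigr => i _; rewrite hornerZ; congr (_ * _).
  by have [_ ->] := qP (i, Ordinal jJ).
suff -> : \sum_i v 0 i *: q (i, Ordinal jJ) = 0 by rewrite horner0.
apply/polyP => c; rewrite coef0 coef_sum.
have [cp|pc] := ltnP c p.+1; last first.
  rewrite big1// => i _; rewrite coefZ nth_default ?mulr0//.
  by have [sq _] := qP (i, Ordinal jJ); exact: leq_trans sq pc.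
have lJ : (j * p.+1 + c < J * p.+1)%N.
  by rewrite (leq_trans (n := (j * p.+1 + p.+1)%N)) ?ltn_add2l// -mulSnr leq_mul2r jJ orbT.
have := congr1 (fun B : 'rV_(J * p.+1) => B 0 (Ordinal lJ)) vA.
rewrite !mxE => H; rewrite -[RHS]H; apply: eq_bigr => i _.
rewrite coefZ mxE /=; congr (_ * _).
rewrite /A mxE /= divnMDl// divn_small// addn0 modnMDl modn_small//.
by rewrite (big_pred1 (Ordinal jJ)).
Qed.

End Facts.
End FESpace.

(** * The energy space, its two forms, and the finite element error for one mode *)

Lemma Sobolev2_lin {R : realType} (c : R) (f g : R -> R) : Sobolev 2 f -> Sobolev 2 g ->
  Sobolev 2 (fun x => c * f x + g x) /\
  {ae (@lebesgue_measure R), forall x, D x ->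
    weakD (weakD (fun x => c * f x + g x)) x = c * weakD (weakD f) x + weakD (weakD g) x}.
Proof.
move=> /Sobolev2P[f1 f2] /Sobolev2P[g1 g2].
have w1 := weak_derivative_lin c f1 g1; have w2 := weak_derivative_lin c f2 g2.
split; last exact: weakD2_unique w1 w2.
have [[L1 L2 d1] [_ L3 d2]] := (w1, w2).
by split => //; exists (fun x => c * weakD f x + weakD g x); split => //; split => //;
  exists (fun x => c * weakD (weakD f) x + weakD (weakD g) x).
Qed.

Lemma weak_derivable0 (R : realType) : weak_derivable (fun=> 0 : R) (fun=> 0).
Proof. by apply: smooth_weak_derivable => x; exact: cvg_cst. Qed.

(** Space containing the modes, the discrete functions and the dual solutions, on which the [L^2]
    and energy forms are both semi-definite. Packaging it as a submodule is what allows the abstract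
    scheme to be applied. *)
Definition navier_pred {R : realType} : {pred (R -> R^o)} :=
  [pred f : R -> R^o | `[< Sobolev 2 f /\ boundary_zero f >]].

Lemma navier_pred_closed (R : realType) : submod_closed (@navier_pred R).
Proof.
split; first apply/asboolP.
  split; last by exists 0 => x _; rewrite normr0 mul0r.
  have w0 := @weak_derivable0 R.
  by case: w0 => L0 _ d0; split => //; exists (fun=> 0); split => //; split => //; exists (fun=> 0).
move=> c f g /asboolP[Sf bf] /asboolP[Sg bg]; apply/asboolP; split.
  exact: (Sobolev2_lin c Sf Sg).1.
exact: boundary_zero_lin.
Qed.

HB.instance Definition _ (R : realType) :=
  GRing.isSubmodClosed.Build R (R -> R^o) navier_pred (@navier_pred_closed R).

Record navier (R : realType) := Navier { nfun : R -> R^o; nfunP : nfun \in @navier_pred R }.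

HB.instance Definition _ (R : realType) := [isSub for @nfun R].
HB.instance Definition _ (R : realType) := [Choice of navier R by <:].
HB.instance Definition _ (R : realType) := [SubChoice_isSubLmodule of navier R by <:].

Section Forms.
Context {R : realType}.
Local Notation leb := (@lebesgue_measure R).
Local Notation D := (@D R).
Local Notation V := (navier R).
Implicit Types f g w : V.

Definition L2form f g : R := inner (nfun f) (nfun g).
Definition energy f g : R := inner (weakD (weakD (nfun f))) (weakD (weakD (nfun g))).

Lemma navierP f : Sobolev 2 (nfun f : R -> R) /\ boundary_zero (nfun f : R -> R).
Proof. exact/asboolP/(nfunP f). Qed.

Lemma navier_L2D f : L2D (nfun f : R -> R).
Proof. by have [[]] := navierP f. Qed.

Lemma navier_weakD2 f : L2D (weakD (weakD (nfun f)) : R -> R).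
Proof. by have [/Sobolev2_weakD2_L2D] := navierP f. Qed.

Lemma L2form_psd : psd_form L2form.
Proof.
split=> [c f g h|f g|f]; last 2 first.
- exact: inner_sym.
- exact: inner_ge0.
by apply: (inner_linear c (navier_L2D f) (navier_L2D g) (navier_L2D h)).
Qed.

Lemma energy_psd : psd_form energy.
Proof.
split=> [c f g h|f g|f]; last 2 first.
- exact: inner_sym.
- exact: inner_ge0.
have [S ae] := Sobolev2_lin c (navierP f).1 (navierP g).1.
rewrite /energy -inner_linear; try exact: navier_weakD2.
by apply: (inner_ae _ _ (navier_weakD2 h) ae);
  [exact: Sobolev2_weakD2_L2D|apply: L2D_lin; exact: navier_weakD2].
Qed.

Lemma eps_navier k : (@eps R k : R -> R^o) \in navier_pred.
Proof. by apply/asboolP; split; [exact: eps_Sobolev|exact: eps_boundary_zero]. Qed.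

Definition neps k : V := Navier (eps_navier k).

Lemma energy_neps k f : energy (neps k) f = lambda k ^+ 4 * L2form (neps k) f.
Proof.
have [Sf bf] := navierP f.
rewrite /energy (@inner_ae _ _ (fun x => - lambda k ^+ 2 * eps k x)).
- rewrite inner_sym innerZr; [|exact: navier_weakD2|exact: eps_L2D].
  by rewrite inner_sym eps_green// /L2form /=; ring.
- exact: navier_weakD2.
- exact: L2DZ (eps_L2D _).
- exact: navier_weakD2.
- exact: eps_weakD2.
Qed.

Lemma L2form_neps k : (0 < k)%N -> L2form (neps k) (neps k) = 1.
Proof. by move=> k0; rewrite /L2form eps_orthonormal// eqxx. Qed.

Section FE.
Variables (p : nat) (h CFM : R) (S : set (R -> R)).
Hypotheses (p23 : p = 2%N \/ p = 3%N) (CFM_gt0 : 0 < CFM).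
Hypotheses (feS : fe_space p h S) (apS : approximation_property p CFM h S).

Definition fe_navier : set V := [set f | S (nfun f)].

Lemma fe_in_navier (f : R -> R) : S f -> (f : R -> R^o) \in navier_pred.
Proof.
move=> Sf; apply/asboolP; split; last exact: fe_boundary_zero feS f Sf.
by case: feS => _ _ /(_ f Sf)[].
Qed.

Lemma fe_subspace : subspace fe_navier.
Proof. by case: feS => S0 Sl _ _; split => // c f g; exact: Sl. Qed.

Lemma fe_dim : exists N : nat, forall f : 'I_N.+1 -> V, (forall i, fe_navier (f i)) ->
  exists c : 'I_N.+1 -> R, (exists i, c i != 0) /\
    let z := \sum_i c i *: f i in energy z z = 0 /\ L2form z z = 0.
Proof.
have [N dN] := fe_dependent feS; exists N => f Sf.
have [c [i ci] c0] := dN (fun i => nfun (f i)) Sf.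
exists c; split; first by exists i.
set z := \sum_i _.
have zE x : D x -> nfun z x = 0.
  move=> /DE/andP[x0 x1]; rewrite -(c0 x) ?(ltW x0) ?(ltW x1)//.
  have -> : nfun z = \sum_i c i *: (nfun (f i) : R -> R^o).
    exact: (big_morph (@nfun R) (fun _ _ => erefl) erefl).
  by rewrite fct_sumE.
have w0 := @weak_derivable0 R.
have wz : weak_derivable (nfun z) (fun=> 0).
  apply: (weak_derivable_ae w0 (navier_L2D z) (L2D_cst 0)); last exact: aeW.
  by apply: aeW => x Dx; rewrite zE.
have L0 := @L2D_cst R 0.
have i0 : inner (fun=> 0 : R) (fun=> 0) = 0.
  by rewrite /inner mulr0 (Rintegral_cst leb (@measurable_D R)) mul0r.
split; rewrite -i0.
  have ae0 := weakD2_unique wz w0.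
  by apply: inner_ae2 => //; exact: navier_weakD2.
apply: inner_ae2 => //; try exact: navier_L2D.
- by apply: aeW => x; exact: zE.
- by apply: aeW => x; exact: zE.
Qed.

(** The approximation property at [l = p.+1], with the slack [t] because the infimum may not be
    attained; the [H^2] norm dominates the energy. *)
Lemma fe_approx (v : V) : Sobolev p.+1 (nfun v : R -> R) -> Sobolev10 (nfun v : R -> R) ->
  forall t, 0 < t -> exists2 f, fe_navier f &
    energy (v - f) (v - f) <= (CFM * h ^+ p.-1 * Sobolev_norm p.+1 (nfun v : R -> R) + t) ^+ 2.
Proof.
move=> Sv Sv0 t t0.
have p3 : (3 <= p.+1 <= p.+1)%N by case: p23 => ->.
have := apS p3 Sv Sv0; rewrite subn2 /=.
set A := [set _ | _ in S] => infA.
have hinf : has_inf A.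
  split; first by exists (Sobolev_norm 2 (fun x => nfun v x - cst 0 x)); exists (cst 0) => //; case: feS.
  by exists 0 => _ [f _ <-]; exact: sqrtr_ge0.
have [_ [f Sf <-] ft] := inf_adherent t0 hinf.
exists (Navier (fe_in_navier Sf)) => //.
set e := v - _.
have : energy e e <= Sobolev_norm 2 (fun x => nfun v x - f x) ^+ 2.
  rewrite sqr_sqrtr; last by apply: sumr_ge0 => j _; exact: inner_ge0.
  by rewrite 2!big_ord_recr/= [leLHS](_ : _ = 0 + energy e e) ?add0r// lerDr addr_ge0 ?sumr_ge0//= => *; exact: inner_ge0.
move=> /le_trans; apply; rewrite lerXn2r ?nnegrE ?sqrtr_ge0//.
  rewrite addr_ge0 ?(ltW t0)// !mulr_ge0 ?sqrtr_ge0 ?exprn_ge0 ?(ltW CFM_gt0)//.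
  by have /andP[/ltW] := fe_mesh feS.
by apply/ltW/(lt_le_trans ft); rewrite lerD2r.
Qed.

(* The dual problem [w'''' = q] can be solved classically, because [q] agrees almost
   everywhere with a continuous function. *)
Lemma fe_duality k (q : V) : (0 < k)%N -> fe_navier (neps k - q) ->
  (forall f, fe_navier f -> energy q f = 0) ->
  L2form q q <= 80 * CFM ^+ 4 * h ^+ (4 * p.-1) * lambda k ^+ (2 * p.+1).
Proof.
move=> k0 Sq qP; have [Sb [_ [g [cg fg g0 g1]]]] : Sobolev 2 (nfun (neps k - q) : R -> R) /\ Sobolev10 (nfun (neps k - q) : R -> R).
  by case: feS => _ _ /(_ _ Sq).
(* The discrete function [neps k - q] has a continuous representative [g], so [q] is almost
   everywhere [eps k - g], which is continuous and may serve as datum of the dual problem. *)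
have ceg : {within `[0, 1], continuous (fun x => eps k x - g x)}.
  have cek : {within `[0, 1], continuous (@eps R k)}.
    by apply: continuous_subspaceT => y; exact: continuous_eps.
  by move=> x; apply: cvgB; [exact: cek|exact: cg].
have [e [ce eE e0]] := extend01 ceg.
have aeq : {ae leb, forall x, D x -> nfun q x = e x}.
  apply: ae_mono fg => x ng Dx; have /DE/andP[x0 x1] := Dx.
  rewrite eE ?(ltW x0) ?(ltW x1)// -ng//.
  by change (nfun q x = eps k x - (eps k x - nfun q x)); ring.
have [W [chW W4 [W00 W01] [W20 W21] Wle]] := dual_solution ce e0.
have chW2 : derivative_chain 2 W.
  by split=> [j j2|]; [apply: chW.1; exact: leq_trans j2 _|exact: chain_continuous chW _].
have wV : (W 0%N : R -> R^o) \in navier_pred.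
  apply/asboolP; split; first exact: chain_Sobolev chW2.
  exact: smooth_boundary_zero (chW.1 0%N isT) (chain_continuous chW (isT : (1 <= 4)%N)) W00 W01.
pose w : V := Navier wV.
have Le := continuous_L2D ce.
have wq : energy w q = L2form q q.
  have [Sq2 bq] := navierP q.
  have w1 := chain_weak chW (isT : (0 < 4)%N); have w2 := chain_weak chW (isT : (1 < 4)%N).
  rewrite /energy (inner_ae _ _ (navier_weakD2 q) (weakD2_unique w1 w2)); last first.
  - exact: continuous_L2D (chain_continuous chW (isT : (2 <= 4)%N)).
  - exact: navier_weakD2 w.
  have chW' : derivative_chain 2 (fun j => W j.+2).
    by split=> [j j2|]; [apply: chW.1|exact: chW.2].
  rewrite (green_formula Sq2 bq chW' W20 W21) W4.
  by apply/esym/inner_ae => //; exact: navier_L2D.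
have eqq : inner e e = L2form q q.
  apply/esym/inner_ae2 => //; try exact: navier_L2D; exact: aeq.
have h0 : 0 <= h by have /andP[/ltW] := fe_mesh feS.
have l0 : 0 <= lambda k :> R by rewrite ltW// lambda_gt0.
have p4 : (p.+1 <= 4)%N by case: p23 => ->.
have chWp : derivative_chain p.+1 W.
  by split=> [j jp|]; [apply: chW.1; exact: leq_trans jp p4|exact: chain_continuous chW p4].
have normW : Sobolev_norm p.+1 (W 0%N) <= Num.sqrt (5 * L2form q q).
  rewrite (chain_norm chWp) ler_wsqrtr//.
  apply: (@le_trans _ _ (\sum_(j < p.+2) inner e e)).
    by apply: ler_sum => j _; apply: Wle; exact: leq_trans (ltn_ord j : (j <= p.+1)%N) p4.
  rewrite sumr_const card_ord -[_ *+ _]mulr_natl eqq ler_wpM2r ?(form_ge0 L2form_psd)//.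
  by rewrite ler_nat.
set Q := L2form q q in normW *.
have Q0 : 0 <= Q by exact: form_ge0 L2form_psd q.
(* [A] and [B] are the approximation errors of the dual solution and of [eps k]. From [Q <= A * B],
   squaring and dividing by [Q] leaves the constant [5 * 4 ^ 2 = 80]. *)
pose A := CFM * h ^+ p.-1 * Num.sqrt (5 * Q).
pose B := CFM * h ^+ p.-1 * (4 * lambda k ^+ p.+1).
have Ch : 0 <= CFM * h ^+ p.-1 by rewrite mulr_ge0 ?exprn_ge0 ?(ltW CFM_gt0).
have A0 : 0 <= A by rewrite mulr_ge0 ?sqrtr_ge0.
have B0 : 0 <= B by rewrite mulr_ge0// mulr_ge0// exprn_ge0.
have mono (x y t : R) : 0 < t -> 0 <= x -> x <= y ->
    (CFM * h ^+ p.-1 * x + t) ^+ 2 <= (CFM * h ^+ p.-1 * y + t) ^+ 2.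
  move=> t0 x0 xy; have y0 := le_trans x0 xy.
  rewrite lerXn2r ?nnegrE ?(addr_ge0 _ (ltW t0)) ?(mulr_ge0 Ch)//.
  by rewrite lerD2r ler_wpM2l.
have key : Q <= A * B.
  apply: (duality_bound energy_psd L2form_psd fe_subspace Sq qP wq A0 B0) => t t0.
    have wS : Sobolev p.+1 (nfun w : R -> R) by exact: chain_Sobolev chWp.
    have wS0 : Sobolev10 (nfun w : R -> R).
      by apply: smooth_Sobolev10 => //; split=> [j j1|]; [apply: chW.1; exact: leq_trans j1 _|exact: chain_continuous chW _].
    have [f Sf fe] := fe_approx wS wS0 t0; exists f => //.
    by apply: (le_trans fe); apply: mono => //; exact: sqrtr_ge0.
  have [f Sf fe] := @fe_approx (neps k) (eps_Sobolev k p.+1) (eps_Sobolev10 k) t t0.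
  exists f => //; apply: (le_trans fe); apply: mono => //; first exact: sqrtr_ge0.
  exact: eps_norm.
have [Q0'|Qp] := leP Q 0.
  by apply: (le_trans Q0'); do ! apply: mulr_ge0; rewrite ?exprn_ge0// ltW.
have Q2 : Q * Q <= (A * B) ^+ 2.
  by rewrite -expr2 lerXn2r// nnegrE mulr_ge0.
rewrite -(ler_pM2r Qp); apply: (le_trans Q2).
rewrite /A /B !exprMn sqr_sqrtr ?mulr_ge0//.
by rewrite le_eqVlt; apply/orP; left; apply/eqP; rewrite [(4 * _)%N]mulnC [(2 * _)%N]mulnC !exprM; ring.
Qed.

Lemma mode_bound k i : 0 < k -> (0 < i)%N ->
  exists X : nat -> V, [/\ forall n, fe_navier (X n),
    forall f, fe_navier f -> cn_step energy L2form k 0 (X 0%N) f = L2form (neps i) f,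
    forall n f, fe_navier f -> cn_step energy L2form k (X n) (X n.+1) f = 0
  & forall m, k * \sum_(n < m) L2form (X n - cn_kernel k (lambda i ^+ 4) n *: neps i)
                                      (X n - cn_kernel k (lambda i ^+ 4) n *: neps i)
      <= Num.min (160 * CFM ^+ 4 * h ^+ (4 * p.-1) * lambda i ^+ (2 * p.-1)) (3 / lambda i ^+ 4)].
Proof.
move=> k0 i0; have [N dN] := fe_dim; have l0 := @lambda_gt0 R i i0.
have L0 : 0 < lambda i ^+ 4 :> R by rewrite exprn_gt0.
have ae : energy (neps i) (neps i) = lambda i ^+ 4.
  by rewrite energy_neps L2form_neps// mulr1.
have [q [Sq qP] [X [SX X0 XS b1 b2]]] := cn_mode_exists energy_psd L2form_psd fe_subspace k0 dN L0
  (fun f _ => energy_neps i f) ae (L2form_neps i0).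
exists X; split => // m; rewrite le_min b2 andbT; apply: (le_trans (b1 m)).
have H := fe_duality i0 Sq qP.
have c0 : 0 <= 2 / lambda i ^+ 4 :> R by rewrite divr_ge0// ltW.
apply: (le_trans (ler_wpM2l c0 H)).
(* The factor [2 / lambda i ^+ 4] of the first mode bound cancels four powers of [lambda i] and
   doubles [80]. *)
have -> : (2 * p.+1 = 2 * p.-1 + 4)%N by case: p23 => ->.
rewrite exprD le_eqVlt; apply/orP; left; apply/eqP; field.
by rewrite gt_eqF.
Qed.

End FE.
End Forms.

(** * White noise *)

Section Gaussian.
Context d {Omega : measurableType d} {R : realType} (P : probability Omega R).
Local Notation leb := (@lebesgue_measure R).

(* [t exp(-t) <= 1] trades the factor [x^2] for a doubled variance. *)
Lemma normal_pdf_sqr_le (s x : R) : 0 < s ->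
  x ^+ 2 * normal_pdf 0 s x <= 8 * s ^+ 2 * normal_pdf 0 (Num.sqrt 2 * s) x.
Proof.
move=> s0; have s20 : 0 < Num.sqrt 2 * s by rewrite mulr_gt0 ?sqrtr_gt0.
have sN0 : s != 0 by rewrite gt_eqF.
(* With this [t] the left density contains [exp (- 2 t)] and the wider one [exp (- t)], while
   [x ^+ 2 = 4 * s ^+ 2 * t]. *)
have [t tE] : exists t, t = x ^+ 2 / (4 * s ^+ 2) by eexists.
have e1 : expR (- x ^+ 2 / (s ^+ 2 *+ 2)) = expR (- t) * expR (- t).
  by rewrite -expRD tE -mulr_natr; congr expR; field.
have e2 : expR (- x ^+ 2 / (2 * s ^+ 2 *+ 2)) = expR (- t).
  by rewrite tE -mulr_natr; congr expR; field.
have e3 : Num.sqrt (2 * s ^+ 2 * pi *+ 2) = Num.sqrt 2 * Num.sqrt (s ^+ 2 * pi *+ 2).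
  by rewrite -sqrtrM//; congr Num.sqrt; rewrite [RHS]mulrnAr !mulrA.
rewrite !normal_pdfE ?gt_eqF//.
rewrite /normal_fun /normal_peak subr0 [(Num.sqrt 2 * s) ^+ 2]exprMn sqr_sqrtr//.
rewrite e1 e2 e3.
set pk := Num.sqrt (s ^+ 2 * pi *+ 2).
have pk0 : 0 < pk by rewrite sqrtr_gt0 mulrn_wgt0// mulr_gt0 ?pi_gt0// exprn_gt0.
have r0 : 0 < Num.sqrt 2 :> R by rewrite sqrtr_gt0.
have r2 : Num.sqrt 2 <= 2 :> R.
  by rewrite -(ler_pXn2r (ltn0Sn 1)) ?nnegrE ?sqrtr_ge0// sqr_sqrtr//; lra.
have te : t * expR (- t) <= 1.
  rewrite -(ler_pM2r (expR_gt0 t)) mul1r -mulrA [expR (- t) * _]mulrC expRxMexpNx_1 mulr1.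
  by apply: le_trans (expR_ge1Dx t); lra.
have -> : x ^+ 2 = 4 * s ^+ 2 * t by rewrite tE; field.
have E0 := expR_gt0 (- t).
have s2 : 0 < s ^+ 2 by rewrite exprn_gt0.
rewrite invfM.
have -> : 4 * s ^+ 2 * t * (pk^-1 * (expR (- t) * expR (- t))) =
  (4 * s ^+ 2 * pk^-1 * expR (- t)) * (t * expR (- t)) by ring.
have -> : 8 * s ^+ 2 * ((Num.sqrt 2)^-1 * pk^-1 * expR (- t)) =
  (4 * s ^+ 2 * pk^-1 * expR (- t)) * (2 * (Num.sqrt 2)^-1) by ring.
rewrite ler_wpM2l//.
  by rewrite !mulr_ge0 ?invr_ge0 ?ltW.
by apply: (le_trans te); rewrite ler_pdivlMr// mul1r.
Qed.

Lemma integral_normal_prob_ge0 (s : R) (f : R -> R) : measurable_fun setT f -> (forall x, 0 <= f x) ->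
  (\int[normal_prob 0 s]_x (f x)%:E = \int[leb]_x (f x * normal_pdf 0 s x)%:E)%E.
Proof.
move=> mf f0; have dom := @normal_prob_dominates R 0 s.
have mfE : measurable_fun setT (EFin \o f) by exact/measurable_EFinP.
have mpdf : measurable_fun setT (EFin \o normal_pdf 0 s).
  by apply/measurable_EFinP; exact: measurable_normal_pdf.
rewrite -(@Radon_Nikodym_SigmaFinite.change_of_variables _ _ _ _ _ dom (EFin \o f))//.
have fi := Radon_Nikodym_SigmaFinite.f_integrable dom.
under [RHS]eq_integral do rewrite EFinM.
apply: ae_eq_integral => //.
- by apply: emeasurable_funM => //; exact: measurable_int fi.
- by apply: emeasurable_funM.
- apply: ae_eqe_mul2l; apply: integral_ae_eq => // E _ mE.
  by rewrite -Radon_Nikodym_SigmaFinite.f_integral.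
Qed.

(** Integrate the pointwise comparison of densities; the wider Gaussian has total mass one. The
    exact value is [v], and the constant [8] only enters the final constant. *)
Lemma gaussian_second_moment (X : {RV P >-> R}) (v : R) : 0 <= v -> centered_gaussian X v ->
  (\int[P]_w (X w ^+ 2)%:E <= (8 * v)%:E)%E.
Proof.
rewrite /centered_gaussian => v0; case: eqVneq => [->|vN0] XG.
  rewrite mulr0 le_eqVlt; apply/orP; left; apply/eqP.
  rewrite [RHS](_ : _ = \int[P]_w (cst 0%E w))%E; last by rewrite integral0.
  apply: ae_eq_integral => //.
    by apply/measurable_EFinP; exact: measurable_funX.
  by apply: filterS XG => w /= -> _; rewrite expr0n.
have vp : 0 < v by rewrite lt_def vN0.
have mX2 : measurable_fun setT (fun x : measurableTypeR R => (x ^+ 2)%:E).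
  by apply/measurable_EFinP; exact: measurable_funX.
have mX : measurable_fun setT (X : Omega -> measurableTypeR R) by exact: (@measurable_funPT _ _ _ _ X).
pose X' : {mfun Omega >-> measurableTypeR R} :=
  HB.pack (X : Omega -> measurableTypeR R) (isMeasurableFun.Build _ _ _ _ _ mX).
have -> : (\int[P]_w (X w ^+ 2)%:E = \int[pushforward P X']_y (y ^+ 2)%:E)%E.
  apply/esym; apply: etrans.
    apply: ge0_integral_pushforward => //.
    by move=> y _; rewrite lee_fin sqr_ge0.
  by rewrite preimage_setT.
rewrite (@eq_measure_integral _ _ _ _ (normal_prob 0 (Num.sqrt v))); last first.
  by move=> A mA _; exact: XG.
rewrite integral_normal_prob_ge0; last 2 first.
- exact: measurable_funX.
- by move=> x; exact: sqr_ge0.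
have s0 : 0 < Num.sqrt v by rewrite sqrtr_gt0.
apply: (@le_trans _ _ (\int[leb]_x ((8 * v)%:E * (normal_pdf 0 (Num.sqrt 2 * Num.sqrt v) x)%:E)))%E.
  apply: ge0_le_integral => //.
  - by move=> x _; rewrite lee_fin mulr_ge0 ?sqr_ge0 ?normal_pdf_ge0.
  - apply/measurable_EFinP; apply: measurable_funM; first exact: measurable_funX.
    exact: measurable_normal_pdf.
  - apply: emeasurable_funM => //; apply/measurable_EFinP; exact: measurable_normal_pdf.
  - move=> x _; rewrite -EFinM lee_fin.
    by have := normal_pdf_sqr_le x s0; rewrite sqr_sqrtr.
rewrite ge0_integralZl//.
- by rewrite integral_normal_pdf mule1.
- by apply/measurable_EFinP; exact: measurable_normal_pdf.
- by move=> x _; rewrite lee_fin normal_pdf_ge0.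
- by rewrite lee_fin mulr_ge0.
Qed.

End Gaussian.

Section Noise.
Context d {Omega : measurableType d} {R : realType} (P : probability Omega R).
Local Notation leb := (@lebesgue_measure R).
Local Notation leb2 := (leb \x leb)%E.
Local Notation D := (@D R).
Variables (T : R) (T_gt0 : 0 < T).
Variables (W : (R * R -> R) -> {RV P >-> R}) (W_noise : white_noise T W).
Variables (Ms Ns : nat) (Ns_gt0 : (0 < Ns)%N).
Local Notation Dt := (Dt T Ns).
Local Notation Tint := (Tint T Ns).

Lemma Dt_gt0 : 0 < Dt.
Proof. by rewrite divr_gt0 ?ltr0n. Qed.

Lemma measurable_QT : measurable (QT T : set (measurableTypeR R * measurableTypeR R)).
Proof. by apply: measurableX; exact: measurable_itv. Qed.

Lemma leb2_QT_fin : (leb2 (QT T) < +oo)%E.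
Proof.
rewrite /QT product_measure1E; [|exact: measurable_itv|exact: measurable_itv].
have lT : leb `]0, T[ = T%:E by rewrite lebesgue_measure_itv/= lte_fin T_gt0 -EFinD subr0.
by rewrite [X in (_ * X)%E]leb_D [X in (X * _)%E]lT mule1 ltry.
Qed.

Lemma measurable_Tint n : measurable (Tint n : set (measurableTypeR R)).
Proof. exact: measurable_itv. Qed.

Lemma leb_Tint n : (0 < n)%N -> leb (Tint n) = Dt%:E.
Proof.
case: n => // n _; rewrite lebesgue_measure_itv/= lte_fin /tgrid/=.
have E : n.+1%:R * Dt - n%:R * Dt = Dt by rewrite -natr1; ring.
by rewrite -subr_gt0 E Dt_gt0 -EFinD E.
Qed.

Lemma Tint_disjoint n m (s : R) : (0 < n)%N -> (0 < m)%N -> Tint n s -> Tint m s -> n = m.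
Proof.
rewrite /Defs.Tint/= !in_itv/= /tgrid => n0 m0 /andP[n1 n2] /andP[m1 m2].
wlog nm : n m n0 m0 n1 n2 m1 m2 / (n <= m)%N.
  move=> H; have [/H|/ltnW/H] := leqP n m; first exact.
  by move=> E; apply/esym/E.
apply/eqP; rewrite eqn_leq nm /=.
have : (m.-1%:R < n%:R :> R).
  by rewrite -(ltr_pM2r Dt_gt0); exact: lt_trans m1 n2.
by rewrite ltr_nat; case: m m0 {nm m1 m2}.
Qed.

Definition noise_fun (n i : nat) (z : R * R) : R := \1_(Tint n `*` D) z * eps i z.2.

Lemma noise_funE n i s y : D y -> noise_fun n i (s, y) = \1_(Tint n) s * eps i y.
Proof.
move=> Dy; rewrite /noise_fun !indicE; congr (_%:R * _); congr nat_of_bool.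
by rewrite in_setX/= [y \in D]mem_set// andbT.
Qed.

Lemma measurable_noise_fun n i : measurable_fun setT (noise_fun n i : measurableTypeR R * measurableTypeR R -> R).
Proof.
apply: measurable_funM.
  by apply: measurable_indic; apply: measurableX; [exact: measurable_Tint|exact: measurable_D].
by apply: measurableT_comp => //; apply: continuous_measurable_fun; exact: continuous_eps.
Qed.

Lemma noise_fun_L2 n i : L2 leb2 (QT T) (noise_fun n i).
Proof.
apply: (@L2_bounded _ _ _ leb2 (QT T) measurable_QT _ (Num.sqrt 2) leb2_QT_fin).
  by apply: measurable_funTS; exact: measurable_noise_fun.
move=> z _; rewrite normrM; apply: (@le_trans _ _ (1 * `|eps i z.2|)).
  by rewrite ler_wpM2r// indicE; case: (_ \in _); rewrite ?normr1 ?normr0.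
by rewrite mul1r eps_bound.
Qed.

Lemma ae_P (A B : Omega -> Prop) : (forall w, A w -> B w) ->
  {ae P, forall w, A w} -> {ae P, forall w, B w}.
Proof. by move=> AB; apply: filterS. Qed.

Lemma W_sum I (s : seq I) (c : I -> R) (Phi : I -> R * R -> R) :
  (forall i, L2 leb2 (QT T) (Phi i)) ->
  L2 leb2 (QT T) (fun z => \sum_(i <- s) c i * Phi i z) /\
  {ae P, forall w, W (fun z => \sum_(i <- s) c i * Phi i z) w = \sum_(i <- s) c i * W (Phi i) w}.
Proof.
move=> L; elim: s => [|i s [IH1 IH2]].
  have E : (fun z => \sum_(i <- [::]) c i * Phi i z) = (fun=> 0 : R).
    by apply/funext => z; rewrite big_nil.
  have L0 : L2 leb2 (QT T) (fun=> 0 : R).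
    apply: (@L2_bounded _ _ _ leb2 (QT T) measurable_QT _ 0 leb2_QT_fin) => //.
    by move=> *; rewrite normr0.
  (* For the empty sum, [W] of the null function has variance zero and therefore vanishes almost
     surely. *)
  rewrite E; split => //; have := W_noise.1 _ L0; rewrite /centered_gaussian.
  rewrite (_ : \int[leb2]_(z in QT T) _ = 0) ?eqxx.
    by apply: ae_P => w ->; rewrite big_nil.
  under eq_Rintegral do rewrite expr0n/=.
  by rewrite Rintegral_cst ?mul0r//; exact: measurable_QT.
have E : (fun z => \sum_(j <- i :: s) c j * Phi j z) =
    (fun z => c i * Phi i z + \sum_(j <- s) c j * Phi j z).
  by apply/funext => z; rewrite big_cons.
rewrite E; split; first exact: (L2_lin measurable_QT).
have := W_noise.2 (c i) _ _ (L i) IH1; move: IH2; apply: filterS2 => w H1 H2.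
by rewrite H2 H1 big_cons.
Qed.

Lemma indic_sum_sqr (c : nat -> R) (s : R) :
  (\sum_(1 <= n < Ns.+1) c n * \1_(Tint n) s) ^+ 2 = \sum_(1 <= n < Ns.+1) c n ^+ 2 * \1_(Tint n) s.
Proof.
rewrite expr2 mulr_suml; apply: eq_big_nat => n n1.
rewrite mulr_sumr (bigD1_seq n) ?mem_index_iota ?iota_uniq//= big1_seq ?addr0.
  by rewrite indicE; case: (s \in _); rewrite ?mulr0 ?mul0r ?mulr1//= -expr2.
move=> m /andP[mn]; rewrite mem_index_iota => m1.
rewrite !indicE; have [/set_mem sn|_] := boolP (s \in Tint n); last by rewrite mulr0 mul0r.
have [/set_mem sm|_] := boolP (s \in Tint m); last by rewrite !mulr0.
move/andP: n1 => [n0 _]; move/andP: m1 => [m0 _].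
by move: mn; rewrite (Tint_disjoint n0 m0 sn sm) eqxx.
Qed.

Lemma L2D_eps_sum (s : seq nat) (a : nat -> R) : L2D (fun y => \sum_(i <- s) a i * eps i y).
Proof.
elim: s => [|i s IH]; first by under eq_fun do rewrite big_nil; exact: L2D_cst.
under eq_fun do rewrite big_cons; apply: L2D_lin => //; exact: eps_L2D.
Qed.

Lemma inner_eps_sum (a : nat -> R) (s : seq nat) (f : R -> R) : L2D f ->
  inner (fun y => \sum_(i <- s) a i * eps i y) f = \sum_(i <- s) a i * inner (eps i) f.
Proof.
move=> Lf; elim: s => [|i s IH].
  rewrite big_nil /inner; under eq_Rintegral do rewrite big_nil mul0r.
  by rewrite (Rintegral_cst leb (@measurable_D R)) mul0r.
have -> : (fun y => \sum_(j <- i :: s) a j * eps j y) = (fun y => a i * eps i y + \sum_(j <- s) a j * eps j y).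
  by apply/funext => y; rewrite big_cons.
by rewrite inner_linear ?IH ?big_cons//; [exact: eps_L2D|exact: L2D_eps_sum].
Qed.

Lemma inner_eps_sum_sqr (a : nat -> R) :
  inner (fun y => \sum_(1 <= i < Ms.+1) a i * eps i y) (fun y => \sum_(1 <= i < Ms.+1) a i * eps i y)
  = \sum_(1 <= i < Ms.+1) a i ^+ 2.
Proof.
rewrite inner_eps_sum; last exact: L2D_eps_sum.
apply: eq_big_nat => i /andP[i1 iM]; rewrite inner_sym inner_eps_sum; last exact: eps_L2D.
rewrite (bigD1_seq i) ?mem_index_iota ?iota_uniq ?i1//= eps_orthonormal// eqxx mulr1.
rewrite big1_seq ?addr0 ?expr2// => j /andP[ji]; rewrite mem_index_iota => /andP[j1 _].
by rewrite eps_orthonormal// (negbTE ji) mulr0.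
Qed.

(** Tonelli: for fixed [s], orthonormality of the [eps i] leaves the squares of the coefficients and
    disjointness of the cells removes the products over different [n]; integrating in [s], each cell
    contributes its length. *)
Lemma noise_sum_norm (c : nat -> nat -> R) :
  \int[leb2]_(z in QT T) ((\sum_(1 <= n < Ns.+1) \sum_(1 <= i < Ms.+1) c n i * noise_fun n i z) ^+ 2)
  <= Dt * \sum_(1 <= n < Ns.+1) \sum_(1 <= i < Ms.+1) c n i ^+ 2.
Proof.
set f := fun z : R * R => \sum_(1 <= n < Ns.+1) \sum_(1 <= i < Ms.+1) c n i * noise_fun n i z.
have mf : measurable_fun setT (f : measurableTypeR R * measurableTypeR R -> R).
  apply: measurable_sum => n; apply: measurable_sum => i.
  by apply: measurable_funM => //; exact: measurable_noise_fun.
have mI : measurable_fun setT (\1_(QT T) : measurableTypeR R * measurableTypeR R -> R).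
  by apply: measurable_indic; exact: measurable_QT.
set rhs := Dt * _.
have rhs0 : 0 <= rhs.
  rewrite mulr_ge0 ?(ltW Dt_gt0)//; apply: sumr_ge0 => n _; apply: sumr_ge0 => i _; exact: sqr_ge0.
suff H : (\int[leb2]_(z in QT T) (f z ^+ 2)%:E <= rhs%:E)%E.
  rewrite /Rintegral -lee_fin fineK// ge0_fin_numE ?(le_lt_trans H) ?ltry//.
  by apply: integral_ge0 => z _; rewrite lee_fin sqr_ge0.
pose g (z : measurableTypeR R * measurableTypeR R) := (f z ^+ 2 * \1_(QT T) z)%:E.
have -> : (\int[leb2]_(z in QT T) (f z ^+ 2)%:E = \int[leb2]_z g z)%E.
  rewrite integral_mkcond; apply: eq_integral => z _.
  by rewrite patchE /g indicE; case: (z \in QT T); rewrite ?mulr1 ?mulr0.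
have mg : measurable_fun setT g.
  by apply/measurable_EFinP; apply: measurable_funM => //; exact: measurable_funX.
have g0 z : (0 <= g z)%E by rewrite lee_fin mulr_ge0 ?sqr_ge0.
rewrite fubini_tonelli1//.
pose k (s : R) := \sum_(1 <= n < Ns.+1) (\sum_(1 <= i < Ms.+1) c n i ^+ 2) * \1_(Tint n) s.
have mk : measurable_fun setT (k : measurableTypeR R -> R).
  apply: measurable_sum => n; apply: measurable_funM => //.
  by apply: measurable_indic; exact: measurable_Tint.
have k0 s : 0 <= k s.
  apply: sumr_ge0 => n _; apply: mulr_ge0 => //; apply: sumr_ge0 => i _; exact: sqr_ge0.
apply: (@le_trans _ _ (\int[leb]_s (k s)%:E)%E).
  apply: ge0_le_integral => //.
  - by move=> s _; apply: integral_ge0 => y _; exact: g0.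
  - exact: measurable_fun_fubini_tonelli_F.
  - exact/measurable_EFinP.
  move=> s _; rewrite /fubini_F.
  pose a i := \sum_(1 <= n < Ns.+1) c n i * \1_(Tint n) s.
  have La := L2D_eps_sum (index_iota 1 Ms.+1) a.
  apply: (@le_trans _ _ (\int[leb]_(y in D) ((\sum_(1 <= i < Ms.+1) a i * eps i y) ^+ 2)%:E)%E).
    rewrite [leRHS]integral_mkcond; apply: ge0_le_integral => //.
    - by apply: measurableT_comp.
    - apply/(measurable_restrictT _ _).1; first exact: measurable_D.
      by apply/measurable_EFinP; apply: measurable_funX; case: La.
    move=> y _; rewrite patchE; case: ifPn => [/set_mem Dy|nDy].
      have E : f (s, y) = \sum_(1 <= i < Ms.+1) a i * eps i y.
        rewrite /f exchange_big/=; apply: eq_bigr => i _; rewrite mulr_suml.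
        by apply: eq_bigr => n _; rewrite noise_funE// mulrA.
      by rewrite /g E lee_fin ler_piMr ?sqr_ge0// indicE lern1 leq_b1.
    by rewrite /g indicE in_setX/= (negbTE nDy) andbF mulr0.
  have -> : (\int[leb]_(y in D) ((\sum_(1 <= i < Ms.+1) a i * eps i y) ^+ 2)%:E)%E =
      (inner (fun y => \sum_(1 <= i < Ms.+1) a i * eps i y) (fun y => \sum_(1 <= i < Ms.+1) a i * eps i y))%:E.
    rewrite /inner /Rintegral fineK; first by apply: eq_integral => y _; rewrite expr2.
    apply: integrable_fin_num; first exact: measurable_D.
    exact: L2D_integrable.
  rewrite inner_eps_sum_sqr lee_fin /k.
  under [leLHS]eq_bigr do rewrite /a indic_sum_sqr.
  rewrite exchange_big/=; apply: ler_sum => n _.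
  by rewrite mulr_suml.
rewrite /k; under eq_integral do rewrite -sumEFin.
rewrite ge0_integral_sum//; last 2 first.
- move=> n; apply/measurable_EFinP; apply: measurable_funM => //.
  by apply: measurable_indic; exact: measurable_Tint.
- by move=> n s _; rewrite lee_fin; apply: mulr_ge0 => //; apply: sumr_ge0 => i _; exact: sqr_ge0.
rewrite /rhs mulr_sumr -sumEFin le_eqVlt; apply/orP; left; apply/eqP.
apply: eq_big_nat => n /andP[n1 _].
under eq_integral do rewrite EFinM.
have m1 : measurable_fun setT (fun s : measurableTypeR R => (\1_(Tint n) s)%:E : \bar R).
  by apply/measurable_EFinP; apply: measurable_indic; exact: measurable_Tint.
have c0 : (0 <= (\sum_(1 <= i < Ms.+1) c n i ^+ 2)%:E)%E.
  by rewrite lee_fin; apply: sumr_ge0 => i _; exact: sqr_ge0.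
rewrite ge0_integralZl//.
rewrite integral_indic//; last exact: measurable_Tint.
by rewrite setIT [X in (_ * X)%E](leb_Tint n1) -EFinM mulrC.
Qed.

End Noise.

Section NoiseBound.
Context d {Omega : measurableType d} {R : realType} (P : probability Omega R).
Local Notation leb := (@lebesgue_measure R).
Local Notation leb2 := (leb \x leb)%E.
Local Notation D := (@D R).
Variables (T : R) (T_gt0 : 0 < T).
Variables (W : (R * R -> R) -> {RV P >-> R}) (W_noise : white_noise T W).
Variables (Ms Ns : nat) (Ns_gt0 : (0 < Ns)%N).
Local Notation Dt := (Dt T Ns).

(** The combination is almost surely [W Phi] for a single [Phi], so its second moment is governed by
    one [L^2] norm. *)
Lemma noise_sum_moment (c : nat -> nat -> R) :
  (\int[P]_w ((\sum_(1 <= n < Ns.+1) \sum_(1 <= i < Ms.+1) Rin T W Ns n i w * c n i) ^+ 2)%:E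
   <= (8 * (Dt * \sum_(1 <= n < Ns.+1) \sum_(1 <= i < Ms.+1) c n i ^+ 2))%:E)%E.
Proof.
pose idx := [seq (n, i) | n <- index_iota 1 Ns.+1, i <- index_iota 1 Ms.+1].
have sumE (F : nat -> nat -> R) : \sum_(1 <= n < Ns.+1) \sum_(1 <= i < Ms.+1) F n i =
    \sum_(k <- idx) F k.1 k.2 by rewrite big_allpairs.
have [LPhi aeW] := W_sum T_gt0 W_noise idx (fun k => c k.1 k.2) (fun k => noise_fun_L2 T_gt0 Ns k.1 k.2).
set Phi := fun z => _ in LPhi aeW.
have PhiE : Phi = (fun z => \sum_(1 <= n < Ns.+1) \sum_(1 <= i < Ms.+1) c n i * noise_fun T Ns n i z).
  by apply/funext => z; rewrite sumE.
have v0 : 0 <= \int[leb2]_(z in QT T) (Phi z ^+ 2) by apply: Rintegral_ge0 => z _; exact: sqr_ge0.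
have := gaussian_second_moment v0 (W_noise.1 _ LPhi).
rewrite (_ : (\int[P]_w (W Phi w ^+ 2)%:E = \int[P]_w ((\sum_(1 <= n < Ns.+1) \sum_(1 <= i < Ms.+1) Rin T W Ns n i w * c n i) ^+ 2)%:E)%E).
  move=> /le_trans; apply; rewrite lee_fin ler_wpM2l// PhiE.
  exact: noise_sum_norm.
apply: ae_eq_integral => //.
- by apply/measurable_EFinP; exact: measurable_funX.
- apply/measurable_EFinP; apply: measurable_funX; apply: measurable_sum => n; apply: measurable_sum => i.
  by apply: measurable_funM => //; exact: measurable_funPT.
- move: aeW; apply: filterS => w H _; rewrite H sumE; congr (_ ^+ 2)%:E.
  by apply: eq_bigr => k _; rewrite mulrC.
Qed.

(** Tonelli exchanges expectation and the integral over [D], and the moment bound is applied at each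
    fixed [x] with coefficients [v n i x]. Extension by zero gives a jointly measurable integrand on
    the whole product. *)
Lemma noise_bound (v : nat -> nat -> R -> R) (Psi : R -> R) :
  (forall n i, measurable_fun D (v n i)) -> leb.-integrable D (EFin \o Psi) ->
  (forall x, D x -> Dt * (\sum_(1 <= n < Ns.+1) \sum_(1 <= i < Ms.+1) v n i x ^+ 2) <= Psi x) ->
  (\int[P]_w \int[leb]_(x in D)
     ((\sum_(1 <= n < Ns.+1) \sum_(1 <= i < Ms.+1) Rin T W Ns n i w * v n i x) ^+ 2)%:E
   <= (8 * \int[leb]_(x in D) Psi x)%:E)%E.
Proof.
move=> mv iPsi vPsi; have mD := @measurable_D R.
pose v' n i : measurableTypeR R -> R := v n i \_ D.
have mv' n i : measurable_fun setT (v' n i).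
  by apply/(measurable_restrictT _ _).1; [exact: mD|exact: mv].
pose F (z : Omega * measurableTypeR R) : \bar R :=
  ((\sum_(1 <= n < Ns.+1) \sum_(1 <= i < Ms.+1) Rin T W Ns n i z.1 * v' n i z.2) ^+ 2)%:E.
have mF : measurable_fun setT F.
  apply/measurable_EFinP; apply: measurable_funX; apply: measurable_sum => n; apply: measurable_sum => i.
  have mR : measurable_fun setT (Rin T W Ns n i) by exact: (@measurable_funPT _ _ _ _ (W _)).
  by apply: measurable_funM; [exact: (measurableT_comp mR measurable_fst)|
    exact: (measurableT_comp (mv' n i) measurable_snd)].
have F0 z : (0 <= F z)%E by rewrite lee_fin sqr_ge0.
have restE x : (fun w => F (w, x)) =
    (fun w => if x \in D then ((\sum_(1 <= n < Ns.+1) \sum_(1 <= i < Ms.+1) Rin T W Ns n i w * v n i x) ^+ 2)%:E else 0%E).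
  apply/funext => w; rewrite /F /v'/=.
  under eq_bigr => n _ do under eq_bigr => i _ do rewrite patchE.
  case: ifP => // _.
  by rewrite big1 ?expr0n// => n _; rewrite big1// => i _; rewrite mulr0.
have -> : (\int[P]_w \int[leb]_(x in D)
     ((\sum_(1 <= n < Ns.+1) \sum_(1 <= i < Ms.+1) Rin T W Ns n i w * v n i x) ^+ 2)%:E
     = \int[P]_w \int[leb]_x F (w, x))%E.
  apply: eq_integral => w _; rewrite integral_mkcond; apply: eq_integral => x _.
  by rewrite patchE; have := congr1 (fun f => f w) (restE x) => /= ->.
rewrite (@fubini_tonelli _ _ _ _ _ P leb F mF F0).
apply: (@le_trans _ _ (\int[leb]_(x in D) (8 * Psi x)%:E)%E); last first.
  rewrite -RintegralZl//; rewrite /Rintegral fineK//.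
  apply: integrable_fin_num => //.
  have := integrableZl mD 8 iPsi; apply: eq_integrable => // x _ /=; by rewrite -EFinM.
have Psi0 x : D x -> 0 <= Psi x.
  move=> Dx; apply: le_trans (vPsi x Dx); rewrite mulr_ge0 ?(ltW (Dt_gt0 T_gt0 Ns_gt0))//.
  by apply: sumr_ge0 => n _; apply: sumr_ge0 => i _; exact: sqr_ge0.
rewrite [leRHS]integral_mkcond; apply: ge0_le_integral => //.
- by move=> x _; exact: integral_ge0.
- exact: measurable_fun_fubini_tonelli_G.
- apply/(measurable_restrictT _ _).1; first exact: mD.
  apply/measurable_EFinP; apply: measurable_funM => //.
  by apply/measurable_EFinP; case/integrableP : iPsi.
move=> x _; rewrite restE patchE; case: ifPn => [/set_mem Dx|_]; last by rewrite integral0.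
apply: (le_trans (noise_sum_moment _)); rewrite lee_fin ler_wpM2l//.
exact: vPsi.
Qed.

End NoiseBound.

(** * Error representation *)

Section TimeIntegrals.
Context {R : realType}.
Local Notation leb := (@lebesgue_measure R).

Lemma continuous_itv_integrable (f : R -> R) (a b : R) : continuous f ->
  leb.-integrable `[a, b] (EFin \o f).
Proof.
move=> cf; apply: continuous_compact_integrable; first exact: segment_compact.
exact: continuous_subspaceT.
Qed.

Lemma indic_mul_integrable (A B : set (measurableTypeR R)) (f : measurableTypeR R -> R) :
  measurable A -> measurable B -> leb.-integrable B (EFin \o f) ->
  leb.-integrable B (EFin \o (fun s => \1_A s * f s)).
Proof.
move=> mA mB fi; apply: (le_integrable mB _ _ fi).
  apply/measurable_EFinP; apply: measurable_funM.
    by apply: measurable_funTS; exact: measurable_indic.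
  by apply/measurable_EFinP; case/integrableP : fi.
move=> x _ /=; rewrite lee_fin normrM indicE.
by case: (_ \in _); rewrite ?normr1 ?mul1r// normr0 mul0r.
Qed.

Lemma indic_itv_integrable (A : set (measurableTypeR R)) (a b : R) :
  measurable A -> leb.-integrable `[a, b] (EFin \o (\1_A : R -> R)).
Proof.
move=> mA.
have mB : measurable ([set` `[a, b]] : set (measurableTypeR R)) by exact: measurable_itv.
have i1 : leb.-integrable `[a, b] (EFin \o (fun=> 1 : R)).
  by apply: continuous_itv_integrable => x; exact: cvg_cst.
have := indic_mul_integrable mA mB i1.
by apply: eq_integrable => // x _ /=; rewrite mulr1.
Qed.

Lemma Rintegral_itv_sum (f : R -> R) (k : R) (m : nat) : 0 < k ->
  leb.-integrable `[0, m%:R * k] (EFin \o f) ->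
  \int[leb]_(s in `[0, m%:R * k]) f s =
  \sum_(j < m) \int[leb]_(s in `[j%:R * k, j.+1%:R * k]) f s.
Proof.
move=> k0; elim: m => [|m IH] fi.
  by rewrite big_ord0 mul0r set_itv1 Rintegral_set1.
have mk0 : 0 <= m%:R * k by rewrite mulr_ge0 ?(ltW k0).
have mk : m%:R * k <= m.+1%:R * k by rewrite ler_wpM2r ?(ltW k0)// ler_nat.
rewrite big_ord_recr/= -IH; last first.
  apply: (integrableS _ _ _ fi) => //.
  by apply: subset_itvl; rewrite bnd_simp.
rewrite -(@Rintegral_itv_obnd_cbnd _ (m%:R * k)); last first.
  apply: (integrableS _ _ _ fi) => //.
  by apply: subset_itvr; rewrite bnd_simp.
by rewrite -(@Rintegral_itvB _ f (BLeft 0) (BRight (m.+1%:R * k)) (m%:R * k)) ?bnd_simp// addrC subrK.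
Qed.

(** Jensen on each cell of the noise grid, followed by summation over the disjoint cells. The two
    time grids are unrelated, so a cell is cut by the steps [j] through its indicator; [th] depends
    on [j] because the discrete propagator is constant on each step. *)
Lemma time_average (T k : R) (Ns m : nat) (th : nat -> R -> R) :
  0 < T -> (0 < Ns)%N -> 0 < k -> (forall j, continuous (th j)) ->
  Dt T Ns * (\sum_(1 <= n < Ns.+1) ((Dt T Ns)^-1 *
    \sum_(j < m) \int[leb]_(s in `[j%:R * k, j.+1%:R * k]) (\1_(Tint T Ns n) s * th j s)) ^+ 2)
  <= \sum_(j < m) \int[leb]_(s in `[j%:R * k, j.+1%:R * k]) (th j s ^+ 2).
Proof.
move=> T0 Ns0 k0 cth; have Dt0 := Dt_gt0 T0 Ns0.
have cth2 j : continuous (fun s => th j s ^+ 2).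
  by move=> s; under eq_fun do rewrite expr2; apply: cvgM; exact: cth.
pose J (j : nat) : set (measurableTypeR R) := [set` `[j%:R * k, j.+1%:R * k]].
have mJ j : measurable (J j) by exact: measurable_itv.
have mT n := @measurable_Tint R T Ns n.
have iT n j (f : R -> R) : continuous f ->
    leb.-integrable (J j) (EFin \o (fun s => \1_(Tint T Ns n) s * f s)).
  by move=> cf; apply: indic_mul_integrable => //; exact: continuous_itv_integrable.
have iI n j : leb.-integrable (J j) (EFin \o (\1_(Tint T Ns n) : R -> R)).
  exact: indic_itv_integrable.
have H n : (1 <= n)%N -> Dt T Ns * ((Dt T Ns)^-1 *
    \sum_(j < m) \int[leb]_(s in J j) (\1_(Tint T Ns n) s * th j s)) ^+ 2
    <= \sum_(j < m) \int[leb]_(s in J j) (\1_(Tint T Ns n) s * th j s ^+ 2).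
  move=> n1; set v := _^-1 * _.
  have vE : \sum_(j < m) \int[leb]_(s in J j) (\1_(Tint T Ns n) s * th j s) = Dt T Ns * v.
    by rewrite /v mulrA divff ?mul1r// gt_eqF.
  clearbody v.
  have mu_le : \sum_(j < m) \int[leb]_(s in J j) \1_(Tint T Ns n) s <= Dt T Ns.
    have iB := indic_itv_integrable 0 (m%:R * k) (mT n).
    rewrite -(Rintegral_itv_sum k0 iB) /Rintegral integral_indic//.
    set B := [set` _]; have le1 : (leb (Tint T Ns n `&` B) <= (Dt T Ns)%:E)%E.
      rewrite -(leb_Tint T0 Ns0 n1); apply: le_measure; rewrite ?inE//.
      by apply: measurableI => //; exact: measurable_itv.
    by rewrite -lee_fin fineK// ge0_fin_numE// (le_lt_trans le1) ?ltry.
  (* Expanding this square gives Jensen's inequality. The part of the cell inside [[0, m k]] may be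
     shorter than [Dt], which has the right sign. *)
  have : 0 <= \sum_(j < m) \int[leb]_(s in J j) (\1_(Tint T Ns n) s * (th j s - v) ^+ 2).
    by apply: sumr_ge0 => j _; apply: Rintegral_ge0 => s _; rewrite mulr_ge0 ?sqr_ge0.
  have -> : \sum_(j < m) \int[leb]_(s in J j) (\1_(Tint T Ns n) s * (th j s - v) ^+ 2) =
      \sum_(j < m) \int[leb]_(s in J j) (\1_(Tint T Ns n) s * th j s ^+ 2)
      - 2 * v * (Dt T Ns * v) + v ^+ 2 * \sum_(j < m) \int[leb]_(s in J j) \1_(Tint T Ns n) s.
    rewrite -vE !mulr_sumr -!sumrN -!big_split/=; apply: eq_bigr => j _.
    rewrite -mulNr.
    transitivity (\int[leb]_(s in J j) (- (2 * v) * (\1_(Tint T Ns n) s * th j s) +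
       (v ^+ 2 * \1_(Tint T Ns n) s + \1_(Tint T Ns n) s * th j s ^+ 2))).
      apply: eq_Rintegral => s _; move: (th j s) (\1_(Tint T Ns n) s) (v) => x y z.
      by ring.
    rewrite Rintegral_lin//; last by apply: integrable_lin => //; exact: iT.
      rewrite Rintegral_lin//; last exact: iT.
      by ring.
    exact: iT.
  have : v ^+ 2 * \sum_(j < m) \int[leb]_(s in J j) \1_(Tint T Ns n) s <= v ^+ 2 * Dt T Ns.
    by rewrite ler_wpM2l ?sqr_ge0.
  set a := \sum_(j < m) _; set b := \sum_(j < m) _; move: (a) (b) (v) (Dt T Ns) => {}a {}b v' D'.
  by nra.
rewrite mulr_sumr; apply: (@le_trans _ _ (\sum_(1 <= n < Ns.+1)
   \sum_(j < m) \int[leb]_(s in J j) (\1_(Tint T Ns n) s * th j s ^+ 2))).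
  by apply: ler_sum_nat => n /andP[n1 _]; exact: H.
rewrite exchange_big/=; apply: ler_sum => j _.
have -> : \sum_(1 <= n < Ns.+1) \int[leb]_(s in J j) (\1_(Tint T Ns n) s * th j s ^+ 2) =
   \int[leb]_(s in J j) (\sum_(1 <= n < Ns.+1) 1 * (\1_(Tint T Ns n) s * th j s ^+ 2)).
  rewrite (Rintegral_sum_lin (mJ j) (index_iota 1 Ns.+1) (fun=> 1) (fun n => iT n j _ (cth2 j))).2.
  by apply: eq_bigr => n _; rewrite mul1r.
apply: le_Rintegral => //.
- by have [] := Rintegral_sum_lin (mJ j) (index_iota 1 Ns.+1) (fun=> 1) (fun n => iT n j _ (cth2 j)).
- exact: continuous_itv_integrable.
move=> s _; under eq_bigr do rewrite mul1r.
rewrite -mulr_suml ler_piMl ?sqr_ge0//.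
(* The sum of the indicators equals its own square, hence is [0] or [1]. *)
have := @indic_sum_sqr R T T0 Ns Ns0 (fun=> 1) s.
under eq_bigr do rewrite mul1r; under [in X in _ = X]eq_bigr do rewrite expr1n mul1r.
set a := \sum_(1 <= n < Ns.+1) _; move: (a) => {}a aE.
have : (a - 1) * a = 0 by rewrite -[RHS](subrr a) -[X in _ = X - _]aE; ring.
by move=> /eqP; rewrite mulf_eq0 subr_eq0 => /orP[] /eqP ->.
Qed.

End TimeIntegrals.

(** * The Green function, the load and the exact solution in terms of the noise coefficients *)

Section GreenFunction.
Context {R : realType}.
Local Notation leb := (@lebesgue_measure R).
Local Notation D := (@D R).

Definition green_term (r x y : R) (k : nat) : R := expR (- lambda k ^+ 4 * r) * eps k x * eps k y.

(** Since [lambda k ^+ 4 >= k], the exponentials are dominated by powers of [exp (- r)]; the factor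
    [2] bounds the product of two modes. *)
Lemma green_term_le (r x y : R) (k : nat) : 0 < r -> `|green_term r x y k| <= geometric 2 (expR (- r)) k.
Proof.
move=> r0; rewrite /green_term /geometric/= [leLHS]normrM normrM (ger0_norm (expR_ge0 _)).
have k1 : (k%:R : R) <= lambda k ^+ 4.
  case: k => [|k]; first by rewrite exprn_even_ge0.
  have l1 := @lambda_ge1 R k.+1 isT.
  apply: (@le_trans _ _ (lambda k.+1)).
    by rewrite /lambda ler_peMr// (le_trans _ (@pi_ge2 R)) ?ler1n.
  by rewrite -[leLHS]expr1; apply: ler_weXn2l.
have e1 : expR (- lambda k ^+ 4 * r) <= expR (- r) ^+ k.
  rewrite -expRM_natl ler_expR mulNr -[leRHS]mulrC mulNr lerN2 mulrC.
  by rewrite ler_wpM2r// ltW.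
have e2 : `|eps k x| * `|eps k y| <= 2.
  apply: (@le_trans _ _ (Num.sqrt 2 * Num.sqrt 2)); last by rewrite -expr2 sqr_sqrtr.
  by apply: ler_pM; rewrite ?eps_bound.
rewrite -mulrA [leLHS]mulrC; apply: ler_pM; [exact: mulr_ge0|exact: expR_ge0|exact: e2|exact: e1].
Qed.

Lemma green_seriesE (r x y : R) (n : nat) :
  \sum_(1 <= k < n) green_term r x y k = series (green_term r x y) n.
Proof.
case: n => [|n]; first by rewrite big_geq// /series/= big_geq.
rewrite /series/= [RHS]big_ltn// [X in _ = X + _](_ : _ = 0) ?add0r//.
by rewrite /green_term /eps /lambda !mul0r sin0 !mulr0 ?mul0r.
Qed.

Lemma green_partial_le (r x y : R) (n : nat) : 0 < r ->
  `|\sum_(1 <= k < n) green_term r x y k| <= 2 / (1 - expR (- r)).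
Proof.
move=> r0; have q1 : expR (- r) < 1 by rewrite -expR0 ltr_expR oppr_lt0.
rewrite green_seriesE; apply: (le_trans (ler_norm_sum _ _ _)).
apply: (@le_trans _ _ (series (geometric 2 (expR (- r))) n)).
  by apply: ler_sum => k _; exact: green_term_le.
rewrite geometric_seriesE ?lt_eqF//= ler_wpM2r ?invr_ge0 ?subr_ge0 ?(ltW q1)//.
by rewrite ler_piMr// gerBl exprn_ge0// expR_ge0.
Qed.

Lemma green_cvg (r x y : R) : 0 < r ->
  (\sum_(1 <= k < n) green_term r x y k) @[n --> \oo] --> Green r x y.
Proof.
move=> r0; have q1 : `|expR (- r)| < 1 by rewrite ger0_norm ?expR_ge0// -expR0 ltr_expR oppr_lt0.
have c : cvgn (series (green_term r x y)).
  apply: normed_cvg; apply: (@series_le_cvg _ _ (geometric 2 (expR (- r)))) => //.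
  - by move=> n; rewrite /=.
  - by move=> n; rewrite /geometric/= mulr_ge0 ?exprn_ge0 ?expR_ge0.
  - by move=> n; exact: green_term_le.
  - exact: is_cvg_geometric_series.
rewrite /Green; have -> : (fun n => \sum_(1 <= k < n) green_term r x y k) = series (green_term r x y).
  by apply/funext => n; exact: green_seriesE.
exact: c.
Qed.

Lemma green_L2D (r x : R) : 0 < r -> L2D (Green r x).
Proof.
move=> r0; have q1 : expR (- r) < 1 by rewrite -expR0 ltr_expR oppr_lt0.
apply: (@L2D_bounded _ _ (2 / (1 - expR (- r)))).
  apply: (measurable_fun_cvg (h := fun n y => \sum_(1 <= k < n) green_term r x y k)).
    move=> n; apply: measurable_sum => k; apply: measurable_funM => //.
    exact: (eps_L2D k).1.
  by move=> y _; exact: green_cvg.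
move=> y _; have c := green_cvg (x := x) (y := y) r0.
have cn : `|\sum_(1 <= k < n) green_term r x y k| @[n --> \oo] --> `|Green r x y| by apply: cvg_norm; exact: c.
rewrite -(cvg_lim (@Rhausdorff R) cn); apply: limr_le; first by apply/cvg_ex; exists `|Green r x y|.
by near=> n; exact: green_partial_le.
Unshelve. all: by end_near.
Qed.

(** Dominated convergence along the partial sums, whose product with [eps i] is constant as soon as
    mode [i] is included. *)
Lemma inner_green (r x : R) (i : nat) : 0 < r -> (0 < i)%N ->
  inner (Green r x) (eps i) = expR (- lambda i ^+ 4 * r) * eps i x.
Proof.
move=> r0 i0; have mD := @measurable_D R.
set B := 2 / (1 - expR (- r)).
have q1 : expR (- r) < 1 by rewrite -expR0 ltr_expR oppr_lt0.
have B0 : 0 <= B by rewrite divr_ge0// subr_ge0 ltW.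
pose f n y := (\sum_(1 <= k < n) green_term r x y k) * eps i y.
have me : measurable_fun D (eps i) by exact: (eps_L2D i).1.
have c1 : \int[leb]_(y in D) f n y @[n --> \oo] --> inner (Green r x) (eps i).
  apply: (@Rdominated_cvg _ _ _ leb D mD f _ (fun=> B * Num.sqrt 2)).
  - move=> n; apply: measurable_funM => //.
    by apply: measurable_sum => k; apply: measurable_funM => //; exact: (eps_L2D k).1.
  - by apply: measurable_funM => //; exact: (green_L2D x r0).1.
  - by move=> y _; apply: cvgM; [exact: green_cvg|exact: cvg_cst].
  - by apply: L2D_integrable1; exact: L2D_cst.
  - by move=> n y _; rewrite normrM; apply: ler_pM; rewrite ?eps_bound//; exact: green_partial_le.
have c2 : \int[leb]_(y in D) f n y @[n --> \oo] --> expR (- lambda i ^+ 4 * r) * eps i x.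
  apply: cvg_eventually_eq; exists i.+1 => // n /= ni.
  rewrite -/(inner _ _) (inner_eps_sum (fun k => expR (- lambda k ^+ 4 * r) * eps k x)); last exact: eps_L2D.
  rewrite (bigD1_seq i) ?mem_index_iota ?iota_uniq ?i0//= eps_orthonormal// eqxx mulr1.
  rewrite big1_seq ?addr0// => k /andP[ki]; rewrite mem_index_iota => /andP[k1 _].
  by rewrite eps_orthonormal// (negbTE ki) mulr0.
exact: (cvg_unique _ c1 c2).
Qed.

End GreenFunction.

Section Formulas.
Context d {Omega : measurableType d} {R : realType} (P : probability Omega R).
Local Notation leb := (@lebesgue_measure R).
Local Notation D := (@D R).
Variables (T : R) (T_gt0 : 0 < T).
Variables (W : (R * R -> R) -> {RV P >-> R}).
Variables (Ms Ns : nat) (Ns_gt0 : (0 < Ns)%N).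
Local Notation Dt := (Dt T Ns).
Local Notation Tint := (Tint T Ns).
Local Notation Rin := (Rin T W Ns).

Let idx := [seq (n, i) | n <- index_iota 1 Ns.+1, i <- index_iota 1 Ms.+1].

Lemma Rintegral_double_sum (B : set (measurableTypeR R)) (c : nat -> nat -> R)
    (F : nat -> nat -> R -> R) :
  measurable B -> (forall n i, leb.-integrable B (EFin \o F n i)) ->
  leb.-integrable B (EFin \o (fun s => \sum_(1 <= n < Ns.+1) \sum_(1 <= i < Ms.+1) c n i * F n i s)) /\
  \int[leb]_(s in B) (\sum_(1 <= n < Ns.+1) \sum_(1 <= i < Ms.+1) c n i * F n i s) =
  \sum_(1 <= n < Ns.+1) \sum_(1 <= i < Ms.+1) c n i * \int[leb]_(s in B) F n i s.
Proof.
move=> mB iF.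
have sumE (G : nat -> nat -> R) : \sum_(1 <= n < Ns.+1) \sum_(1 <= i < Ms.+1) G n i =
    \sum_(k <- idx) G k.1 k.2 by rewrite big_allpairs.
rewrite sumE; have -> : (fun s => \sum_(1 <= n < Ns.+1) \sum_(1 <= i < Ms.+1) c n i * F n i s) =
    (fun s => \sum_(k <- idx) c k.1 k.2 * F k.1 k.2 s).
  by apply/funext => s; rewrite sumE.
exact: (Rintegral_sum_lin mB idx (fun k => c k.1 k.2) (fun k => iF k.1 k.2)).
Qed.

Lemma inner_WhatE (w : Omega) (s : R) (f : R -> R) : L2D f ->
  inner (What T W Ms Ns w s) f =
  \sum_(1 <= n < Ns.+1) \sum_(1 <= i < Ms.+1) (Rin n i w * Dt^-1 * inner (eps i) f) * \1_(Tint n) s.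
Proof.
move=> Lf.
pose a i := \sum_(1 <= n < Ns.+1) \1_(Tint n) s * (Dt^-1 * Rin n i w).
have -> : What T W Ms Ns w s = (fun y => \sum_(1 <= i < Ms.+1) a i * eps i y).
  apply/funext => y; rewrite /What; under [RHS]eq_bigr do rewrite mulr_suml.
  rewrite exchange_big/=; apply: eq_bigr => n _; rewrite !mulr_sumr.
  by apply: eq_bigr => i _; rewrite !mulrA.
rewrite inner_eps_sum// exchange_big/=; apply: eq_bigr => i _.
by rewrite mulr_suml; apply: eq_bigr => n _; ring.
Qed.

Lemma load_formula (w : Omega) (f : R -> R) (a b : R) : L2D f ->
  \int[leb]_(s in `[a, b]) inner (What T W Ms Ns w s) f =
  \sum_(1 <= i < Ms.+1) (\sum_(1 <= n < Ns.+1) Rin n i w * (Dt^-1 *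
     \int[leb]_(s in `[a, b]) \1_(Tint n) s)) * inner (eps i) f.
Proof.
move=> Lf; under eq_Rintegral do rewrite inner_WhatE//.
pose B : set (measurableTypeR R) := [set` `[a, b]].
have mB : measurable B by exact: measurable_itv.
have iI n : leb.-integrable B (EFin \o (\1_(Tint n) : R -> R)).
  by apply: indic_itv_integrable; exact: measurable_Tint.
rewrite (Rintegral_double_sum (fun n i => Rin n i w * Dt^-1 * inner (eps i) f) mB (fun n _ => iI n)).2.
rewrite exchange_big/=; apply: eq_bigr => i _; rewrite mulr_suml.
apply: eq_bigr => n _; move: (\int[leb]_(s in B) _) (Dt^-1) => u v; rewrite -/B.
by rewrite -/u; ring.
Qed.

Lemma continuous_heat (L c e : R) : continuous (fun s : R => expR (- L * (c - s)) * e).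
Proof.
move=> s; apply: cvgM; last exact: cvg_cst.
apply: (continuous_comp (f := fun s : R => - L * (c - s))); last exact: continuous_expR.
by apply: cvgM; [exact: cvg_cst|apply: cvgB; [exact: cvg_cst|exact: cvg_id]].
Qed.

Lemma uhat_formula (w : Omega) (k x : R) (m : nat) : 0 < k ->
  uhat T W Ms Ns w (m%:R * k) x =
  \sum_(1 <= n < Ns.+1) \sum_(1 <= i < Ms.+1) Rin n i w * (Dt^-1 *
    \sum_(j < m) \int[leb]_(s in `[j%:R * k, j.+1%:R * k])
      (\1_(Tint n) s * (expR (- lambda i ^+ 4 * (m%:R * k - s)) * eps i x))).
Proof.
move=> k0; set t := m%:R * k.
pose F n i (s : R) := \1_(Tint n) s * (expR (- lambda i ^+ 4 * (t - s)) * eps i x).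
pose H s := \sum_(1 <= n < Ns.+1) \sum_(1 <= i < Ms.+1) (Rin n i w * Dt^-1) * F n i s.
pose B : set (measurableTypeR R) := [set` `[0, t]].
have mB : measurable B by exact: measurable_itv.
have iF n i : leb.-integrable B (EFin \o F n i).
  apply: indic_mul_integrable => //; first exact: measurable_Tint.
  exact: continuous_itv_integrable (@continuous_heat _ _ _).
have [iH HE] := Rintegral_double_sum (fun n i => Rin n i w * Dt^-1) mB iF.
transitivity (\int[leb]_(s in B) H s); last first.
  rewrite HE; apply: eq_bigr => n _; apply: eq_bigr => i _.
  by rewrite (Rintegral_itv_sum k0 (iF n i)) mulrA.
have e1 s : `[0, t[%classic s -> inner (Green (t - s) x) (What T W Ms Ns w s) = H s.
  rewrite /= in_itv/= => /andP[s0 st]; rewrite inner_sym inner_WhatE; last first.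
    by apply: green_L2D; rewrite subr_gt0.
  apply: eq_big_nat => n _; apply: eq_big_nat => i /andP[i1 _].
  by rewrite inner_sym inner_green ?subr_gt0// /F; ring.
(* The series of the Green function is controlled only for positive time, so the null point [s = t]
   is removed. *)
pose B' : set (measurableTypeR R) := [set` `[0, t[].
have iH' : leb.-integrable B' (EFin \o H).
  apply: (integrableS _ _ _ iH) => //; first exact: measurable_itv.
  by apply: subset_itvl; rewrite bnd_simp.
rewrite /uhat.
transitivity (\int[leb]_(s in B') inner (Green (t - s) x) (What T W Ms Ns w s)).
  rewrite Rintegral_itv_bndo_bndc//.
  by move: iH'; apply: eq_integrable => [|s /set_mem sB /=]; [exact: measurable_itv|rewrite e1].
rewrite -[RHS]Rintegral_itv_bndo_bndc//.
by apply: eq_Rintegral => s /set_mem sB; rewrite e1.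
Qed.

End Formulas.

(** * Summation over the modes *)

Section ModeSums.
Context {R : realType}.
Local Notation leb := (@lebesgue_measure R).

Lemma lambda_ge (i : nat) : (i%:R : R) <= lambda i.
Proof. by rewrite /lambda ler_peMr// (le_trans _ (@pi_ge2 R)) ?ler1n. Qed.

Lemma lambda_pow_le (i : nat) : (0 < i)%N -> (lambda i ^+ 4)^-1 * i%:R ^+ 4 <= 1 :> R.
Proof.
move=> i0; have l0 := @lambda_gt0 R i i0.
by rewrite mulrC ler_pdivrMr ?exprn_gt0// mul1r lerXn2r ?nnegrE ?(ltW l0) ?ler0n ?lambda_ge.
Qed.

(** [sum_min_bound] with mesh [H = k^(1/4)] and [A = k]: the two bounds meet where
    [k * lambda i ^+ 4] is of order one, and [4 A / H = 4 H^3]. *)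
Lemma time_modes_sum (k : R) (B : nat -> R) (N : nat) : 0 < k ->
  (forall i, (0 < i)%N -> 0 <= B i <= Num.min ((lambda i ^+ 4)^-1) (k ^+ 2 * lambda i ^+ 4 / 2)) ->
  \sum_(1 <= i < N.+1) B i <= 4 * k `^ (3 / 4).
Proof.
move=> k0 HB; set H := k `^ (4^-1).
have H0 : 0 < H by rewrite powR_gt0.
have H4 : H ^+ 4 = k by rewrite -powR_mulrn ?powR_ge0// -powRrM mulVf// powRr1// ltW.
have H3 : H ^+ 3 = k `^ (3 / 4) by rewrite -powR_mulrn ?powR_ge0// -powRrM mulrC.
rewrite -H3 -(ler_pM2l H0) mulrCA -exprS H4; apply: sum_min_bound => //; first exact: ltW.
move=> i i0; have /andP[B0] := HB i i0; rewrite le_min => /andP[B1 B2].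
have l0 : 0 < lambda i ^+ 4 :> R by rewrite exprn_gt0// lambda_gt0.
split=> //.
  have [kl|kl] := leP (k * lambda i ^+ 4) 1.
    apply: (le_trans B2); move: kl l0; set L := lambda i ^+ 4; move: L => L; move: k0.
    move: (k) => q; nra.
  by apply: (le_trans B1); rewrite -[leLHS]mul1r ler_pdivrMr// ltW.
rewrite exprMn H4 mulrCA -[leRHS]mulr1 ler_wpM2l ?(ltW k0)//.
by apply: le_trans (lambda_pow_le i0); rewrite ler_wpM2r.
Qed.

(** [sum_min_bound] with mesh [H = h^(p/3)] and bound [c * H^4], so that the sum is at most
    [4 c H^3 = 4 c h^p]. The condition [3 <= c] puts the second bound under the same constant. *)
Lemma space_modes_sum (p : nat) (h c : R) (A : nat -> R) (N : nat) :
  p = 2%N \/ p = 3%N -> 0 < h -> 3 <= c ->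
  (forall i, (0 < i)%N -> 0 <= A i <= Num.min (c * h ^+ (4 * p.-1) * lambda i ^+ (2 * p.-1)) (3 / lambda i ^+ 4)) ->
  \sum_(1 <= i < N.+1) A i <= 4 * c * h ^+ p.
Proof.
move=> p23 h0 c3 HA; set H := h `^ (p%:R / 3).
have c0 : 0 <= c by apply: le_trans c3.
have H0 : 0 < H by rewrite powR_gt0.
have HX n : H ^+ n = h `^ (p%:R / 3 * n%:R) by rewrite -powR_mulrn ?powR_ge0// -powRrM.
have H3 : H ^+ 3 = h ^+ p.
  by rewrite HX mulfVK ?pnatr_eq0// powR_mulrn// ltW.
(* The exponents match because [p (2 p + 2) = 12 (p - 1)], whose solutions are [2] and [3]. *)
have Hp : H ^+ (4 + 2 * p.-1) = h ^+ (4 * p.-1).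
  rewrite HX -powR_mulrn ?ltW//; congr (_ `^ _).
  case: p23 => ->.
    by rewrite -[(4 + _)%N]/6%N -[(4 * _)%N]/4%N; field.
  by rewrite -[(4 + _)%N]/8%N -[(4 * _)%N]/8%N; field.
rewrite -H3 -(ler_pM2l H0) [leRHS]mulrCA -exprS -mulrA; apply: sum_min_bound => //.
  by rewrite mulr_ge0// exprn_ge0// ltW.
move=> i i0; have /andP[A0] := HA i i0; rewrite le_min => /andP[A1 A2].
have l0 : 0 < lambda i :> R by rewrite lambda_gt0.
have l4 : 0 < lambda i ^+ 4 :> R by rewrite exprn_gt0.
split=> //.
  have [kl|kl] := leP (H * lambda i) 1.
    apply: (le_trans A1); rewrite -Hp.
    have -> : c * H ^+ (4 + 2 * p.-1) * lambda i ^+ (2 * p.-1) = c * H ^+ 4 * (H * lambda i) ^+ (2 * p.-1).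
      rewrite exprD (exprMn _ H).
      by move: (H ^+ (2 * p.-1)) (lambda i ^+ (2 * p.-1)) (H ^+ 4) => X Y Z; ring.
    apply: ler_piMr; first by rewrite mulr_ge0// exprn_ge0// ltW.
    by apply: exprn_ile1 => //; rewrite mulr_ge0// ltW.
  apply: (le_trans A2); rewrite ler_pdivrMr// -mulrA -exprMn.
  by apply: le_trans c3 _; rewrite ler_peMr// exprn_ege1// ltW.
rewrite exprMn mulrCA mulrC ler_wpM2r ?exprn_ge0 ?(ltW H0)//.
apply: le_trans c3; apply: (@le_trans _ _ (3 * ((lambda i ^+ 4)^-1 * i%:R ^+ 4))).
  by rewrite mulrA ler_wpM2r// exprn_ge0.
by rewrite ler_piMr// lambda_pow_le.
Qed.

(* [x - exp e = (x - kappa e) + (kappa - exp) e]: spatial and temporal error *)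
Lemma mode_error_le (k L e : R) (x : nat -> R) (m : nat) : 0 < k ->
  \sum_(j < m) \int[leb]_(s in `[j%:R * k, j.+1%:R * k])
     ((x (m - j.+1)%N - expR (- L * (m%:R * k - s)) * e) ^+ 2)
  <= 2 * (k * \sum_(n < m) (x n - cn_kernel k L n * e) ^+ 2) +
     2 * e ^+ 2 * \sum_(j < m) \int[leb]_(s in `[j%:R * k, j.+1%:R * k])
        ((cn_kernel k L (m - j.+1) - expR (- L * (m%:R * k - s))) ^+ 2).
Proof.
move=> k0.
have sqc (f : R -> R) : continuous f -> continuous (fun s => f s ^+ 2).
  by move=> cf s; under eq_fun do rewrite expr2; apply: cvgM; exact: cf.
have cE (c y : R) : continuous (fun s : R => c - expR (- L * (m%:R * k - s)) * y).
  by move=> s; apply: cvgB; [exact: cvg_cst|exact: continuous_heat].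
rewrite mulrA mulr_sumr -(big_mkord xpredT (fun n => 2 * k * (x n - cn_kernel k L n * e) ^+ 2)).
rewrite big_nat_rev/= add0n big_mkord mulr_sumr -big_split/=; apply: ler_sum => j _.
set a := cn_kernel k L (m - j.+1); set y := x _.
pose J : set (measurableTypeR R) := [set` `[j%:R * k, j.+1%:R * k]].
have mJ : measurable J by exact: measurable_itv.
have i1 : leb.-integrable J (EFin \o (fun s => (a - expR (- L * (m%:R * k - s))) ^+ 2)).
  apply: continuous_itv_integrable; apply: sqc.
  have -> : (fun s : R => a - expR (- L * (m%:R * k - s))) = (fun s => a - expR (- L * (m%:R * k - s)) * 1).
    by apply/funext => s; rewrite mulr1.
  exact: cE.
have i2 : leb.-integrable J (EFin \o (fun=> (2 * (y - a * e) ^+ 2) : R)).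
  by apply: continuous_itv_integrable => s; exact: cvg_cst.
apply: (@le_trans _ _ (\int[leb]_(s in J) (2 * e ^+ 2 * (a - expR (- L * (m%:R * k - s))) ^+ 2 + 2 * (y - a * e) ^+ 2))).
  apply: le_Rintegral => //.
  - by apply: continuous_itv_integrable; apply: sqc; exact: cE.
  - exact: integrable_lin.
  move=> s _; move: (expR _) => E; rewrite -subr_ge0.
  rewrite (_ : _ - _ = ((y - a * e) - (a - E) * e) ^+ 2) ?sqr_ge0//; ring.
rewrite Rintegral_lin// (Rintegral_cst leb mJ) [leLHS]addrC lerD2r.
have lJ : leb [set` `[j%:R * k, j.+1%:R * k]] = k%:E.
  rewrite lebesgue_measure_itv/= lte_fin ltr_pM2r// ltr_nat ltnSn.
  by rewrite -EFinD -mulrBl -natrB// subSnn mul1r.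
by rewrite [X in fine X]lJ /= mulrAC.
Qed.

End ModeSums.

(** * Expansion of the error in noise coefficients and its mean square *)

Section Expansion.
Context {R : realType}.
Local Notation leb := (@lebesgue_measure R).
Local Notation D := (@D R).
Variables (p : nat) (h CFM : R) (S : set (R -> R)).
Hypotheses (p23 : p = 2%N \/ p = 3%N) (CFM_gt0 : 0 < CFM).
Hypotheses (feS : fe_space p h S) (apS : approximation_property p CFM h S).

Definition mode_family (k : R) (X : nat -> nat -> navier R) := forall i, (0 < i)%N ->
  [/\ forall n, fe_navier S (X i n),
      forall f, fe_navier S f -> cn_step energy L2form k 0 (X i 0%N) f = L2form (neps i) f,
      forall n f, fe_navier S f -> cn_step energy L2form k (X i n) (X i n.+1) f = 0
    & forall m, k * \sum_(n < m) L2form (X i n - cn_kernel k (lambda i ^+ 4) n *: neps i)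
                                      (X i n - cn_kernel k (lambda i ^+ 4) n *: neps i)
      <= Num.min (160 * CFM ^+ 4 * h ^+ (4 * p.-1) * lambda i ^+ (2 * p.-1)) (3 / lambda i ^+ 4)].

Lemma mode_family_exists (k : R) : 0 < k -> exists X, mode_family k X.
Proof.
move=> k0; have /choice[X HX] := fun i => mode_bound p23 CFM_gt0 feS apS k0 (ltn0Sn i).
by exists (fun i => X i.-1) => -[//|i] _; exact: HX.
Qed.

Lemma nfun_sum I (s : seq I) (f : I -> navier R) (x : R) :
  nfun (\sum_(i <- s) f i) x = \sum_(i <- s) nfun (f i) x.
Proof. exact: (big_morph (fun g : navier R => nfun g x : R) (fun _ _ => erefl) erefl). Qed.

(** Discrete Duhamel formula for the concrete forms; a vanishing [L^2] form yields equality almost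
    everywhere on [D]. *)
Lemma scheme_expansion (k : R) (X : nat -> nat -> navier R) (U : nat -> R -> R)
    (c : nat -> nat -> R) (M N : nat) : 0 < k -> mode_family k X ->
  (forall m, (m <= M)%N -> S (U m)) -> U 0%N = cst 0 ->
  (forall m, (1 <= m <= M)%N -> forall chi, S chi ->
     inner (fun x => U m x - U m.-1 x) chi
     + k / 2 * inner (weakD (weakD (fun x => U m x + U m.-1 x))) (weakD (weakD chi))
     = \sum_(1 <= i < N.+1) c i m.-1 * inner (eps i) chi) ->
  forall m, (m <= M)%N -> {ae leb, forall x, D x ->
    U m x = \sum_(1 <= i < N.+1) \sum_(j < m) c i j * nfun (X i (m - j.+1)%N) x}.
Proof.
move=> k0 HX SU U0 UE m mM.
have [V VE] : exists V : nat -> navier R, forall n, (n <= M)%N -> nfun (V n) = U n.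
  have /choice[V HV] : forall n, exists f : navier R, (n <= M)%N -> nfun f = U n.
    move=> n; have [nM|_] := boolP (n <= M)%N; last by exists 0.
    by exists (Navier (fe_in_navier feS (SU n nM))).
  by exists V.
have V0 : V 0%N = 0 by apply: val_inj; rewrite /= VE.
(* [cn_duhamel] asks for its hypotheses at every index, [mode_family] gives them for positive ones;
   the shift changes nothing for [i >= 1]. *)
pose Y i := X i.-1.+1.
have := @cn_duhamel R (navier R) energy L2form energy_psd L2form_psd (fe_navier S) (fe_subspace feS)
  k k0 nat (index_iota 1 N.+1) (fun i => neps i.-1.+1) Y c M V.
move=> /(_ (fun i n => let: And4 a _ _ _ := HX i.-1.+1 isT in a n)).
move=> /(_ (fun i f => let: And4 _ a _ _ := HX i.-1.+1 isT in a f)).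
move=> /(_ (fun i n f => let: And4 _ _ a _ := HX i.-1.+1 isT in a n f)).
have SV n : (n <= M)%N -> fe_navier S (V n) by move=> nM; rewrite /fe_navier/= VE//; exact: SU.
move=> /(_ SV V0).
have stepV n f : (n < M)%N -> fe_navier S f ->
    cn_step energy L2form k (V n) (V n.+1) f =
    \sum_(i <- index_iota 1 N.+1) c i n * L2form (neps i.-1.+1) f.
  move=> nM Sf; have := UE n.+1 nM (nfun f) Sf.
  rewrite -!VE ?(ltnW nM)// => E.
  rewrite /cn_step /L2form /energy; transitivity (\sum_(1 <= i < N.+1) c i n * inner (eps i) (nfun f)).
    exact: E.
  by apply: eq_big_nat => -[].
move=> /(_ stepV m mM) /=; set u := _ - _ => u0.
have uE x : nfun u x = U m x - \sum_(1 <= i < N.+1) \sum_(j < m) c i j * nfun (X i (m - j.+1)%N) x.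
  rewrite -VE// [LHS]/(nfun (V m) x - nfun (\sum_(i <- index_iota 1 N.+1) _) x) nfun_sum.
  congr (_ - _); apply: eq_big_nat => -[//|i] _.
  by rewrite nfun_sum.
apply: ae_mono (inner_eq0_ae (navier_L2D u) u0) => x H Dx.
by move: (H Dx); rewrite uE => /eqP; rewrite subr_eq0 => /eqP.
Qed.

End Expansion.

Section MeanSquare.
Context d {Omega : measurableType d} {R : realType} (P : probability Omega R).
Local Notation leb := (@lebesgue_measure R).
Local Notation D := (@D R).
Variables (T : R) (T_gt0 : 0 < T).
Variables (W : (R * R -> R) -> {RV P >-> R}) (W_noise : white_noise T W).
Variables (Ms Ns M : nat) (Ns_gt0 : (0 < Ns)%N) (M_gt0 : (0 < M)%N).
Variables (p : nat) (h CFM : R) (S : set (R -> R)).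
Hypotheses (p23 : p = 2%N \/ p = 3%N).
Hypotheses (feS : fe_space p h S).
Variables (U : nat -> Omega -> R -> R) (CNU : CN_approximation T W Ms Ns M S U).
Local Notation Dt := (Dt T Ns).
Local Notation Tint := (Tint T Ns).
Local Notation Rin := (Rin T W Ns).
Local Notation k := (T / M%:R).

Let k_gt0 : 0 < k. Proof. by rewrite divr_gt0 ?ltr0n. Qed.

Let itv (j : nat) : set (measurableTypeR R) := [set` `[j%:R * k, j.+1%:R * k]].

Let mitv j : measurable (itv j). Proof. exact: measurable_itv. Qed.

Variable X : nat -> nat -> navier R.
Hypothesis XP : mode_family p h CFM S k X.

Let alpha (n j : nat) : R := \int[leb]_(s in itv j) \1_(Tint n) s.
Let beta (m n i j : nat) : R :=
  \int[leb]_(s in itv j) (\1_(Tint n) s * expR (- lambda i ^+ 4 * (m%:R * k - s))).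

(** Coefficient of [Rin n i] in the error at step [m]: the average over the cell [Tint n] of
    discrete minus exact propagator applied to [eps i]. *)
Let v (m n i : nat) (x : R) : R :=
  Dt^-1 * \sum_(j < m) (alpha n j * nfun (X i (m - j.+1)%N) x - beta m n i j * eps i x).

Let itv_integral (m n i j : nat) (y e : R) :
  \int[leb]_(s in itv j) (\1_(Tint n) s * (y - expR (- lambda i ^+ 4 * (m%:R * k - s)) * e)) =
  alpha n j * y - beta m n i j * e.
Proof.
have iT : leb.-integrable (itv j) (EFin \o (\1_(Tint n) : R -> R)).
  by apply: indic_itv_integrable; exact: measurable_Tint.
have ib : leb.-integrable (itv j) (EFin \o (fun s => \1_(Tint n) s * expR (- lambda i ^+ 4 * (m%:R * k - s)))).
  apply: indic_mul_integrable => //; first exact: measurable_Tint.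
  have := @continuous_itv_integrable R _ (j%:R * k) (j.+1%:R * k) (@continuous_heat R (lambda i ^+ 4) (m%:R * k) 1).
  by apply: eq_integrable => // x _ /=; rewrite mulr1.
transitivity (\int[leb]_(s in itv j) (- e * (\1_(Tint n) s * expR (- lambda i ^+ 4 * (m%:R * k - s))) +
   (y * \1_(Tint n) s + 0))).
  by apply: eq_Rintegral => s _; move: (\1_(Tint n) s) (expR _) => a b; ring.
have i0 : leb.-integrable (itv j) (EFin \o (fun=> 0 : R)).
  by apply: continuous_itv_integrable => x; exact: cvg_cst.
rewrite Rintegral_lin//; last exact: integrable_lin.
rewrite Rintegral_lin// (Rintegral_cst leb (mitv j)) mul0r /alpha /beta.
by move: (\int[leb]_(s in itv j) _) (\int[leb]_(s in itv j) _) => a b; ring.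
Qed.

Let beta_integral (m n i j : nat) (e : R) :
  \int[leb]_(s in itv j) (\1_(Tint n) s * (expR (- lambda i ^+ 4 * (m%:R * k - s)) * e)) =
  beta m n i j * e.
Proof.
have := itv_integral m n i j 0 (- e); rewrite mulr0 sub0r mulrN opprK => <-.
by apply: eq_Rintegral => s _; rewrite sub0r [_ * - e]mulrN opprK.
Qed.

Lemma error_expansion (m : nat) (w : Omega) : (m <= M)%N ->
  {ae leb, forall x, D x -> U m w x - uhat T W Ms Ns w (m%:R * k) x =
    \sum_(1 <= n < Ns.+1) \sum_(1 <= i < Ms.+1) Rin n i w * v m n i x}.
Proof.
move=> mM; have [US U0 UE] := CNU.
pose c i j := \sum_(1 <= n < Ns.+1) Rin n i w * (Dt^-1 * alpha n j).
have UE' n : (1 <= n <= M)%N -> forall chi, S chi ->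
     inner (fun x => U n w x - U n.-1 w x) chi
     + k / 2 * inner (weakD (weakD (fun x => U n w x + U n.-1 w x))) (weakD (weakD chi))
     = \sum_(1 <= i < Ms.+1) c i n.-1 * inner (eps i) chi.
  move=> nM chi Schi; rewrite (UE n w nM chi Schi) load_formula; last first.
    exact: navier_L2D (Navier (fe_in_navier feS Schi)).
  case: n nM => [//|n] nM; apply: eq_bigr => i _; congr (_ * _).
have := @scheme_expansion R p h CFM S feS k X (U^~ w) c M Ms k_gt0 XP (fun n nM => US n w nM) (U0 w) UE' m mM.
apply: ae_mono => x H Dx; rewrite {}H// uhat_formula//.
under eq_bigr => i _ do under eq_bigr => j _ do rewrite /c mulr_suml.
under eq_bigr => i _ do rewrite exchange_big/=.
rewrite exchange_big/= -sumrB; apply: eq_bigr => n _; rewrite -sumrB; apply: eq_bigr => i _.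
rewrite /v !mulr_sumr -sumrB; apply: eq_bigr => j _.
rewrite -/(itv j) beta_integral.
by ring.
Qed.

Let B (m i : nat) : R := \sum_(j < m) \int[leb]_(s in itv j)
  ((cn_kernel k (lambda i ^+ 4) (m - j.+1) - expR (- lambda i ^+ 4 * (m%:R * k - s))) ^+ 2).

Let A (m i : nat) : R := k * \sum_(n < m) L2form (X i n - cn_kernel k (lambda i ^+ 4) n *: neps i)
                                      (X i n - cn_kernel k (lambda i ^+ 4) n *: neps i).

(** Pointwise majorant supplied by [mode_error_le], summed over the modes; the first part is the
    time error, the second the space error. *)
Let Psi (m : nat) (x : R) : R := \sum_(1 <= i < Ms.+1) 1 *
  (2 * B m i * (eps i x * eps i x) + \sum_(n < m) (2 * k) *
     (nfun (X i n - cn_kernel k (lambda i ^+ 4) n *: neps i) x *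
      nfun (X i n - cn_kernel k (lambda i ^+ 4) n *: neps i) x)).

Let Psi_integral m : leb.-integrable D (EFin \o Psi m) /\
  \int[leb]_(x in D) Psi m x = \sum_(1 <= i < Ms.+1) (2 * B m i * L2form (neps i) (neps i) + 2 * A m i).
Proof.
have mD := @measurable_D R.
pose Y i n := X i n - cn_kernel k (lambda i ^+ 4) n *: neps i.
have iY i n : leb.-integrable D (EFin \o (fun x => nfun (Y i n) x * nfun (Y i n) x)).
  by apply: L2D_integrable; exact: navier_L2D.
have ie i : leb.-integrable D (EFin \o (fun x => eps i x * eps i x)).
  by apply: L2D_integrable; exact: eps_L2D.
pose G i x := 2 * B m i * (eps i x * eps i x) + \sum_(n < m) (2 * k) * (nfun (Y i n) x * nfun (Y i n) x).
have s1 i := Rintegral_sum_lin mD (index_enum 'I_m) (fun=> 2 * k) (fun n : 'I_m => iY i n).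
have iG i : leb.-integrable D (EFin \o G i).
  by apply: integrable_lin => //; exact: (s1 i).1.
have GE i : \int[leb]_(x in D) G i x = 2 * B m i * L2form (neps i) (neps i) + 2 * A m i.
  rewrite /G Rintegral_lin//; last exact: (s1 i).1.
  by rewrite (s1 i).2 -mulr_sumr; congr (_ + _); rewrite -[LHS]mulrA.
have [H1 H2] := Rintegral_sum_lin mD (index_iota 1 Ms.+1) (fun=> 1) iG.
split; first exact: H1.
rewrite [LHS]H2; apply: eq_bigr => i _; by rewrite mul1r GE.
Qed.

Let v_bound m x : Dt * (\sum_(1 <= n < Ns.+1) \sum_(1 <= i < Ms.+1) v m n i x ^+ 2) <= Psi m x.
Proof.
rewrite exchange_big/= mulr_sumr; apply: ler_sum => i _; rewrite mul1r.
pose th (j : nat) (s : R) := nfun (X i (m - j.+1)%N) x - expR (- lambda i ^+ 4 * (m%:R * k - s)) * eps i x.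
have cth j : continuous (th j).
  by move=> s; apply: cvgB; [exact: cvg_cst|exact: continuous_heat].
have -> : \sum_(1 <= n < Ns.+1) v m n i x ^+ 2 = \sum_(1 <= n < Ns.+1) (Dt^-1 *
    \sum_(j < m) \int[leb]_(s in itv j) (\1_(Tint n) s * th j s)) ^+ 2.
  apply: eq_bigr => n _; congr ((_ * _) ^+ 2); apply: eq_bigr => j _.
  by rewrite itv_integral.
apply: (le_trans (time_average m T_gt0 Ns_gt0 k_gt0 cth)).
apply: (le_trans (@mode_error_le R k (lambda i ^+ 4) (eps i x) (fun n => nfun (X i n) x) m k_gt0)).
rewrite addrC le_eqVlt; apply/orP; left; apply/eqP; congr (_ + _).
  by rewrite /B -expr2; ring.
rewrite !mulr_sumr; apply: eq_bigr => n _.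
by rewrite mulrA -expr2.
Qed.

(** The constant is [64 = 8 * 2 * 4]: Gaussian moment, splitting into space and time error,
    summation over the modes. *)
Lemma mean_square_bound (m : nat) : (m <= M)%N ->
  (mean_square_L2 P (fun w x => (U m w x - uhat T W Ms Ns w (m%:R * k) x)%R)
   <= (64 * (Num.max (160 * CFM ^+ 4) 3 * h ^+ p + k `^ (3 / 4)))%:E)%E.
Proof.
move=> mM; have mD := @measurable_D R.
have mv n i : measurable_fun D (v m n i).
  apply: measurable_funM => //; apply: measurable_sum => j; apply: measurable_funB.
    by apply: measurable_funM => //; exact: (navier_L2D _).1.
  by apply: measurable_funM => //; exact: (eps_L2D i).1.
have [iPsi PsiE] := Psi_integral m.
have := noise_bound T_gt0 W_noise (Ms := Ms) Ns_gt0 mv iPsi (fun x _ => v_bound m x).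
rewrite (_ : (\int[P]_w \int[leb]_(x in D) _)%E = mean_square_L2 P (fun w x => (U m w x - uhat T W Ms Ns w (m%:R * k) x)%R)); last first.
  apply: eq_integral => w _; have ae := error_expansion w mM.
  have mS : measurable_fun D (fun x => \sum_(1 <= n < Ns.+1) \sum_(1 <= i < Ms.+1) Rin n i w * v m n i x).
    by apply: measurable_sum => n; apply: measurable_sum => i; apply: measurable_funM.
  have mU : measurable_fun D (fun x => U m w x - uhat T W Ms Ns w (m%:R * k) x).
    apply: measurable_funB.
      have [US _ _] := CNU.
      exact: (navier_L2D (Navier (fe_in_navier feS (US m w mM)))).1.
    have -> : uhat T W Ms Ns w (m%:R * k) = (fun x => \sum_(1 <= n < Ns.+1) \sum_(1 <= i < Ms.+1)
        Rin n i w * (Dt^-1 * \sum_(j < m) beta m n i j * eps i x)).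
      apply/funext => x; rewrite uhat_formula//; apply: eq_bigr => n _; apply: eq_bigr => i _.
      by congr (_ * (_ * _)); apply: eq_bigr => j _; exact: beta_integral.
    apply: measurable_sum => n; apply: measurable_sum => i; apply: measurable_funM => //.
    apply: measurable_funM => //; apply: measurable_sum => j.
    by apply: measurable_funM => //; exact: (eps_L2D i).1.
  apply: ae_eq_integral => //.
  - by apply/measurable_EFinP; exact: measurable_funX.
  - by apply/measurable_EFinP; exact: measurable_funX.
  by apply: ae_mono ae => x H Dx; rewrite H.
move=> /le_trans; apply; rewrite lee_fin PsiE.
set c := Num.max _ _.
have h0 : 0 < h by have /andP[] := fe_mesh feS.
have SA : \sum_(1 <= i < Ms.+1) A m i <= 4 * c * h ^+ p.
  apply: space_modes_sum => //; first by rewrite le_max lexx orbT.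
  move=> i i0; have [_ _ _ /(_ m) b] := XP i0; apply/andP; split.
    rewrite mulr_ge0 ?(ltW k_gt0)//; apply: sumr_ge0 => n _; exact: inner_ge0.
  apply: (le_trans b); rewrite le_min !ge_min lexx orbT andbT; apply/orP; left.
  rewrite ler_wpM2r ?exprn_ge0 ?(ltW (lambda_gt0 i0))// ler_wpM2r ?exprn_ge0 ?(ltW h0)//.
  by rewrite le_max lexx.
have SB : \sum_(1 <= i < Ms.+1) B m i <= 4 * k `^ (3 / 4).
  apply: time_modes_sum => // i i0; apply/andP; split.
    by apply: sumr_ge0 => j _; apply: Rintegral_ge0 => s _; exact: sqr_ge0.
  by apply: time_kernel_bound => //; rewrite exprn_gt0// lambda_gt0.
rewrite big_split/= -mulr_sumr.
have -> : \sum_(1 <= i < Ms.+1) 2 * B m i * L2form (neps i) (neps i) = 2 * \sum_(1 <= i < Ms.+1) B m i.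
  rewrite mulr_sumr; apply: eq_big_nat => i /andP[i0 _].
  by rewrite L2form_neps// mulr1.
move: SA SB; move: (\sum_(1 <= i < Ms.+1) A m i) (\sum_(1 <= i < Ms.+1) B m i) (c) (h ^+ p) (k `^ (3 / 4)).
by move=> a b c' h' k' H1 H2; lra.
Qed.

End MeanSquare.

(** * Passage to the rates with [e1] and [e2] *)

Section Rates.
Context {R : realType}.

(** [e <= 3 / 2] gives [2 / 3 <= 1 / e], and [h <= 1] makes the smaller exponent the weaker
    bound. *)
Lemma space_rate (q h e : R) : 0 < h <= 1 -> 0 < e <= 3 / 2 ->
  2 / 3 * h `^ (q * 2) <= (e `^ (- 2^-1) * h `^ (q - e)) ^+ 2.
Proof.
move=> /andP[h0 h1] /andP[e0 e1].
rewrite exprMn -!powR_mulrn ?powR_ge0// -!powRrM mulNr mulVf// powRN powRr1 ?(ltW e0)//.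
apply: ler_pM => //.
- by rewrite powR_ge0.
- by rewrite -[leLHS]invrK lef_pV2 ?posrE ?invr_gt0//; lra.
by apply: ger_powR; rewrite ?h0//; lra.
Qed.

(** The step [k] may exceed one, so the spare factor [k^(2e)] is bounded by [Num.max T 1] through
    [2 e <= 3 / 4]; moreover [1 / e >= 1]. *)
Lemma time_rate (T k e : R) : 0 < k <= T -> 0 < e <= 3 / 8 ->
  (Num.max T 1)^-1 * k `^ (3 / 4) <= (e `^ (- 2^-1) * k `^ (3 / 8 - e)) ^+ 2.
Proof.
move=> /andP[k0 kT] /andP[e0 e1].
set c := Num.max T 1; have c1 : 1 <= c by rewrite le_max lexx orbT.
have kc : k <= c by rewrite le_max kT.
rewrite exprMn -!powR_mulrn ?powR_ge0// -!powRrM mulNr mulVf// powRN powRr1 ?(ltW e0)//.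
have -> : k `^ (3 / 4) = k `^ (2 * e) * k `^ ((3 / 8 - e) * 2).
  by rewrite -powRD ?(gt_eqF k0) ?implybT//; congr (_ `^ _); field.
rewrite mulrA ler_wpM2r ?powR_ge0//; apply: (@le_trans _ _ 1).
  rewrite mulrC ler_pdivrMr ?(lt_le_trans _ c1)// mul1r.
  apply: (@le_trans _ _ (c `^ (2 * e))).
    by apply: ge0_ler_powR; rewrite ?nnegrE ?(ltW k0)//; lra.
  rewrite -[leRHS]powRr1 ?(le_trans _ c1)//; apply: ler_powR => //; lra.
by rewrite invf_ge1//; lra.
Qed.

End Rates.

Theorem theorem5p4 (R : realType) (T : R) (T_gt0 : 0 < T)
  (d : measure_display) (Omega : measurableType d) (P : probability Omega R)
  (P_complete : measure_is_complete P)
  (W : (R * R -> R) -> {RV P >-> R}) (W_noise : white_noise T W)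
  (p : nat) (p23 : p = 2%N \/ p = 3%N) (CFM : R) (CFM_gt0 : 0 < CFM) :
  exists2 C : R, 0 < C &
    forall (Ms Ns M : nat), (0 < Ms)%N -> (0 < Ns)%N -> (0 < M)%N ->
    forall (h : R) (S : set (R -> R)),
      fe_space p h S -> approximation_property p CFM h S ->
    forall U : nat -> Omega -> R -> R,
      CN_approximation T W Ms Ns M S U ->
    forall e1 e2 : R, 0 < e1 <= p%:R / 2 -> 0 < e2 <= 3 / 8 ->
    (\big[maxe/0]_(m < M.+1)
        sqrte (mean_square_L2 P (fun w x =>
          U m w x - uhat T W Ms Ns w (m%:R * (T / M%:R)) x)%R)
      <= (C * (e1 `^ (- 2^-1) * h `^ (p%:R / 2 - e1)
               + e2 `^ (- 2^-1) * (T / M%:R) `^ (3 / 8 - e2)))%:E)%E.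
Proof.
set c := Num.max (160 * CFM ^+ 4) 3; set t := Num.max T 1.
have c3 : 3 <= c by rewrite le_max lexx orbT.
have t1 : 1 <= t by rewrite le_max lexx orbT.
have C1 : 1 <= 96 * c * t by nra.
(* [96 = 64 * 3 / 2] undoes the factor [2 / 3] of the space rate and [t] the factor of the time
   rate. As the constant is at least one, it may be replaced by its square when square roots are
   taken. *)
exists (96 * c * t); first exact: lt_le_trans C1.
move=> Ms Ns M _ Ns_gt0 M_gt0 h S feS apS U CNU e1 e2 e1P e2P.
have h01 := fe_mesh feS; have /andP[h0 _] := h01.
have k0 : 0 < T / M%:R by rewrite divr_gt0 ?ltr0n.
have kT : T / M%:R <= T by rewrite ler_pdivrMr ?ltr0n// ler_peMr ?ler1n// ltW.
set a := e1 `^ _ * _; set b := e2 `^ _ * _.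
have a0 : 0 <= a by rewrite mulr_ge0 ?powR_ge0.
have b0 : 0 <= b by rewrite mulr_ge0 ?powR_ge0.
have aE : 2 / 3 * h ^+ p <= a ^+ 2.
  rewrite -powR_mulrn ?(ltW h0)// -[X in h `^ X](@divfK _ 2)//.
  apply: space_rate => //; case/andP: e1P => -> /le_trans; apply.
  by case: p23 => ->; lra.
have bE : t^-1 * (T / M%:R) `^ (3 / 4) <= b ^+ 2 by apply: time_rate; rewrite ?k0.
clearbody a b.
have E0 : 0 <= 96 * c * t * (a + b) by rewrite mulr_ge0 ?addr_ge0// (le_trans _ C1).
apply: bigmax_le => [|m _]; first by rewrite lee_fin.
have [X XP] := mode_family_exists p23 CFM_gt0 feS apS k0.
have ms := mean_square_bound T_gt0 W_noise Ns_gt0 M_gt0 p23 feS CNU XP (ltn_ord m).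
rewrite (_ : (96 * c * t * (a + b))%:E = sqrte ((96 * c * t * (a + b)) ^+ 2)%:E); last first.
  by rewrite EFin_expe sqrte_sqr gee0_abs ?lee_fin.
rewrite lee_sqrt ?lee_fin ?sqr_ge0//; apply: (le_trans ms).
rewrite lee_fin -/c.
have ct : 0 < 96 * c * t by exact: lt_le_trans C1.
apply: (@le_trans _ _ (96 * c * t * (a ^+ 2 + b ^+ 2))); last first.
  rewrite [leRHS]exprMn; apply: ler_pM.
  - exact: ltW.
  - by apply: addr_ge0; exact: sqr_ge0.
  - by rewrite [leRHS]expr2; apply: ler_peMl; [exact: ltW|exact: C1].
  - by rewrite sqrrD -addrA lerD2l addrC lerDl mulrn_wge0// mulr_ge0.
rewrite 2!mulrDr; apply: lerD.
  rewrite -(ler_pM2l (ltr0Sn R 95)) in aE.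
  have -> : 64 * (c * h ^+ p) = c * (96 * (2 / 3 * h ^+ p)) by field.
  apply: (@le_trans _ _ (c * (96 * a ^+ 2))); first by rewrite ler_wpM2l// (le_trans _ c3).
  rewrite mulrA [leRHS]mulrAC [c * 96]mulrC ler_peMr//.
  by rewrite mulr_ge0 ?sqr_ge0// mulr_ge0// (le_trans _ c3).
have -> : 64 * (T / M%:R) `^ (3 / 4) = 64 * t * (t^-1 * (T / M%:R) `^ (3 / 4)).
  by rewrite -mulrA mulVKf// gt_eqF// (lt_le_trans _ t1).
apply: (@le_trans _ _ (64 * t * b ^+ 2)); first by rewrite ler_wpM2l// mulr_ge0// (le_trans _ t1).
rewrite ler_wpM2r ?sqr_ge0// ler_wpM2r ?(le_trans _ t1)//.
by apply: (@le_trans _ _ (96 * 3)); [lra|rewrite ler_wpM2l].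
Qed.
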